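(* Let $k>0$ be an even integer, $D$ a positive discriminant, and $s\in\mathbb{C}$ with $\mathrm{Re}(s)\geq\frac k2+\frac14$. (1) For every $z\in\mathbb{H}\setminus E_D$, $$\xi_{2-2k}\left(\mathcal{F}_{1-k,s,D}(z)\right)=2\left(\bar s-\tfrac34+\tfrac k2\right)f_{k,\bar s,D}(z).$$ (2) For every $z\in\mathbb{H}\setminus E_D$, $$\xi_{2k}\left(f_{k,s,D}(z)\right)=2\left(\bar s-\tfrac k2-\tfrac14\right)\mathcal{F}_{1-k,\bar s,D}(z).$$
   Context: Write $z=x+iy\in\mathbb{H}$. For $D\in\mathbb{Z}$, $\mathcal{Q}_D$ is the set of integral binary quadratic forms $Q=[a,b,c]$ with $b^2-4ac=D$, $Q(z,1)=az^2+bz+c$, $Q_z:=\frac1y(a|z|^2+bx+c)$, and $E_D:=\{z\in\mathbb{H}:\exists[a,b,c]\in\mathcal{Q}_D,\ a|z|^2+bx+c=0\}$. For $\kappa\in\mathbb{Z}$, $\xi_\kappa(G)(z):=2iy^\kappa\overline{\partial G/\partial\bar z}$. $f_{k,s,D}(z):=\sum_{Q\in\mathcal{Q}_D}Q(z,1)^{-k}\varphi_s\!\left(\frac{Dy^2}{|Q(z,1)|^2}\right)$ with, for $0<w\le1$, $$\varphi_s(w):=\frac{\Gamma(s+\frac k2-\frac14)D^{\frac k2+\frac14}}{6\Gamma(2s)(4\pi)^{\frac k2-\frac14}}w^{s-\frac k2-\frac14}\,{}_2F_1\!\left(s+\tfrac k2-\tfrac14,s-\tfrac k2-\tfrac14;2s;w\right).$$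 $\mathcal{F}_{1-k,s,D}(z):=\sum_{Q\in\mathcal{Q}_D}\mathrm{sgn}(Q_z)Q(z,1)^{k-1}\varphi^*_s\!\left(\frac{Dy^2}{|Q(z,1)|^2}\right)$ with, for $0<w\le1$, $$\varphi^*_s(w):=\frac{\Gamma(s+\frac k2-\frac14)(4\pi D)^{\frac34-\frac k2}}{12\sqrt\pi\,\Gamma(2s)}w^{\frac k2-\frac34+s}\,{}_2F_1\!\left(s-\tfrac k2+\tfrac14,s+\tfrac k2-\tfrac34;2s;w\right).$$ *)

(* Defs.v *)
From Stdlib Require Import Reals ZArith List.
From Coquelicot Require Import Coquelicot.

Open Scope R_scope.

Definition upper_half_plane (z : C) : Prop := 0 < Im z.

Definition Cpow_Z (z : C) (n : Z) : C :=
  match n with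
  | Z0 => RtoC 1
  | Zpos p => Cpow z (Pos.to_nat p)
  | Zneg p => Cinv (Cpow z (Pos.to_nat p))
  end.

(** [Rcpow x s] is x^s = exp (s * ln x), for a real base x > 0. *)
Definition Rcpow (x : R) (s : C) : C :=
  (RtoC (exp (Re s * ln x)) * (cos (Im s * ln x), sin (Im s * ln x)))%C.

(** Euler's integral; it converges exactly for Re s > 0, the only range needed
    here. *)
Definition CGamma (s : C) : C :=
  RInt_gen (V := C_R_CompleteNormedModule)
    (fun t : R => (Rcpow t (s - 1) * RtoC (exp (- t)))%C)
    (at_right 0) (Rbar_locally p_infty).

Fixpoint pochhammer (a : C) (n : nat) : C :=
  match n with
  | O => RtoC 1
  | S m => (pochhammer a m * (a + RtoC (INR m)))%C
  end.

(** Gauss' series, including the boundary point w = 1 when it converges there. *)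
Definition hyp2F1 (a b c w : C) : C :=
  iota (T := C_R_CompleteNormedModule)
    (is_series (V := C_R_NormedModule)
       (fun n : nat =>
          (pochhammer a n * pochhammer b n / pochhammer c n
           * Cpow w n / RtoC (INR (fact n)))%C)).

(** Neighbourhoods of infinity in the finite subsets of [P], each of which is
    represented by its duplicate-free enumerations. *)
Definition finite_subsets {T : Type} (P : T -> Prop) (A : list T -> Prop) : Prop :=
  exists l0 : list T, List.Forall P l0 /\
    forall l : list T, NoDup l -> List.Forall P l -> incl l0 l -> A l.

Definition Csum_list {T : Type} (a : T -> C) (l : list T) : C :=
  fold_right (fun t acc => (a t + acc)%C) (RtoC 0) l.

Definition is_Csum {T : Type} (P : T -> Prop) (a : T -> C) (S : C) : Prop :=
  filterlim (Csum_list a) (finite_subsets P)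
    (locally (T := C_R_CompleteNormedModule) S).

Definition ex_Csum {T : Type} (P : T -> Prop) (a : T -> C) : Prop :=
  exists S : C, is_Csum P a S.

Definition Csum {T : Type} (P : T -> Prop) (a : T -> C) : C :=
  iota (T := C_R_CompleteNormedModule) (is_Csum P a).

(** The Wirtinger derivative of [G] with respect to the conjugate variable; only
    the two partial derivatives are required, so [G] need not be holomorphic. *)
Definition is_dbar (G : C -> C) (z v : C) : Prop :=
  exists gx gy : C,
    is_derive (V := C_R_NormedModule) (fun x : R => G (x, Im z)) (Re z) gx /\
    is_derive (V := C_R_NormedModule) (fun y : R => G (Re z, y)) (Im z) gy /\
    v = ((gx + Ci * gy) / RtoC 2)%C.

Definition is_xi (kappa : Z) (G : C -> C) (z v : C) : Prop :=
  exists g : C, is_dbar G z g /\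
    v = (RtoC 2 * Ci * RtoC (powerRZ (Im z) kappa) * Cconj g)%C.

Record qform : Set := QForm { qa : Z; qb : Z; qc : Z }.

Definition is_positive_discriminant (D : Z) : Prop :=
  (0 < D)%Z /\ (D mod 4 = 0 \/ D mod 4 = 1)%Z.

Definition Q_D (D : Z) (Q : qform) : Prop :=
  (qb Q * qb Q - 4 * qa Q * qc Q)%Z = D.

Definition qeval (Q : qform) (z : C) : C :=
  (RtoC (IZR (qa Q)) * Cpow z 2 + RtoC (IZR (qb Q)) * z + RtoC (IZR (qc Q)))%C.

Definition qgeod (Q : qform) (z : C) : R :=
  IZR (qa Q) * Cmod z ^ 2 + IZR (qb Q) * Re z + IZR (qc Q).

Definition Q_sub_z (Q : qform) (z : C) : R := / Im z * qgeod Q z.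

Definition E_D (D : Z) (z : C) : Prop :=
  upper_half_plane z /\ exists Q : qform, Q_D D Q /\ qgeod Q z = 0.

Definition warg (D : Z) (Q : qform) (z : C) : R :=
  IZR D * Im z ^ 2 / Cmod (qeval Q z) ^ 2.

Definition phi (k : Z) (s : C) (D : Z) (w : R) : C :=
  let h := IZR k / 2 in
  (CGamma (s + RtoC h - RtoC (1/4)) * RtoC (Rpower (IZR D) (h + 1/4))
   / (RtoC 6 * CGamma (RtoC 2 * s) * RtoC (Rpower (4 * PI) (h - 1/4)))
   * Rcpow w (s - RtoC h - RtoC (1/4))
   * hyp2F1 (s + RtoC h - RtoC (1/4)) (s - RtoC h - RtoC (1/4)) (RtoC 2 * s)
       (RtoC w))%C.

Definition phi_star (k : Z) (s : C) (D : Z) (w : R) : C :=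
  let h := IZR k / 2 in
  (CGamma (s + RtoC h - RtoC (1/4)) * RtoC (Rpower (4 * PI * IZR D) (3/4 - h))
   / (RtoC 12 * RtoC (sqrt PI) * CGamma (RtoC 2 * s))
   * Rcpow w (RtoC h - RtoC (3/4) + s)
   * hyp2F1 (s - RtoC h + RtoC (1/4)) (s + RtoC h - RtoC (3/4)) (RtoC 2 * s)
       (RtoC w))%C.

Definition f_term (k : Z) (s : C) (D : Z) (z : C) (Q : qform) : C :=
  (Cpow_Z (qeval Q z) (- k) * phi k s D (warg D Q z))%C.

Definition f_fun (k : Z) (s : C) (D : Z) (z : C) : C :=
  Csum (Q_D D) (f_term k s D z).

(** [F_term k] and [F_fun k] carry the index k of the weight 2 - 2k function
    F_{1-k,s,D}. *)
Definition F_term (k : Z) (s : C) (D : Z) (z : C) (Q : qform) : C :=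
  (RtoC (sign (Q_sub_z Q z)) * Cpow_Z (qeval Q z) (k - 1)
   * phi_star k s D (warg D Q z))%C.

Definition F_fun (k : Z) (s : C) (D : Z) (z : C) : C :=
  Csum (Q_D D) (F_term k s D z).

(* Main.v *)
Require Import Defs.
From Stdlib Require Import Reals ZArith List Lra Lia Psatz Classical Permutation.
From Stdlib Require FunctionalExtensionality.
From mathcomp Require ssreflect ssrfun ssrbool eqtype ssrnat seq div prime zify.
From Coquelicot Require Import Coquelicot.
Open Scope R_scope.

(** Write p = Q_z and q = Q(z,1). Then |q|^2 = y^2 (p^2 + D), so that
    w = D / (p^2 + D), and dp/dzbar = - i q / (2 y^2) while q is holomorphic.
    Hence each term q^m g(w) has dbar-derivative q^m g'(w) dw/dzbar, and both
    identities hold term by term once g' is known. For g = phi or phi_star,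
    d/dw (w^b F(a,b;c;w)) = b w^(b-1) F(a,b+1;c;w), and Euler's transformation
    with c - a - (b+1) = -1/2 turns the right-hand side into the other profile
    divided by sqrt (1 - w) = |p| / sqrt (p^2 + D). Off E_D the quantity |p| is
    bounded below by a multiple of the norm of Q, uniformly near z; the terms and
    their first derivatives are therefore O(|Q|^-k), and the sum of |Q|^-2
    over all forms of discriminant D converges by the divisor bound. *)

(** * Real-variable calculus for complex-valued functions *)

(** The Euler transformation is drawn from the differential equation: multiplication by sqrt (1 - w)
    exchanges the exponents at w = 1, and a solution that vanishes to first order at the origin is 0
    as soon as Re c >= 1. Here c = 2 s, so Re s >= 1/2 is enough. The sign in F is p / |p|: it
    arises when the factor p of dw/dzbar meets sqrt (1 - w). The different powers of D and w in the
    two profiles combine into powers of D / w = p^2 + D = |q|^2 / y^2, which are what conjugating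
    q^m produces. The conjugate of s appears because xi conjugates, so Gamma and the series must
    commute with conjugation. The tight case is k = 2 with Re s = k/2 + 1/4: there phi does not
    decay as w tends to 0, and only |Q|^-2 is left to sum. Profiles are used only on 0 < w < 1,
    since w = 1 means Q_z = 0, where their derivatives are in general singular like (1 -
    w)^(-1/2). *)

Notation is_deriveC := (is_derive (V := C_R_NormedModule)).

Lemma is_deriveC_eps (f : R -> C) (x : R) (l : C) :
  is_deriveC f x l <->
  forall eps, 0 < eps -> exists delta, 0 < delta /\ forall t, Rabs (t - x) < delta ->
    Cmod (f t - f x - RtoC (t - x) * l)%C <= eps * Rabs (t - x).
Proof.
  assert (E : forall t, norm (minus (minus (f t) (f x)) (scal (minus t x) l) : C_R_NormedModule)
              = Cmod (f t - f x - RtoC (t - x) * l)%C).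
  { intros t. rewrite <- Cmod_norm.
    change (Cmod (f t - f x + - (scal (minus t x : R) (fst l), scal (minus t x : R) (snd l)))
       = Cmod (f t - f x - RtoC (t - x) * l)).
    f_equal. apply injective_projections; simpl; unfold scal, minus, plus, opp; simpl;
    unfold mult; simpl; ring. }
  split.
  - intros [_ H] eps He.
    destruct (H x (fun P h => h) (mkposreal eps He)) as [d Hd].
    exists d; split; [apply cond_pos|]. intros t Ht.
    eapply Rle_trans; [right; symmetry; exact (E t) | exact (Hd t Ht)].
  - intros H. split; [apply is_linear_scal_l|].
    intros y Hy. apply (is_filter_lim_locally_unique (V := R_NormedModule) x y) in Hy; subst y.
    intros [eps He]. destruct (H eps He) as (d & Hd & Hd').
    exists (mkposreal d Hd). intros t Ht.
    eapply Rle_trans; [right; exact (E t) | exact (Hd' t Ht)].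
Qed.

Lemma is_deriveR_eps (f : R -> R) (x l : R) :
  is_derive f x l <->
  forall eps, 0 < eps -> exists delta, 0 < delta /\ forall t, Rabs (t - x) < delta ->
    Rabs (f t - f x - (t - x) * l) <= eps * Rabs (t - x).
Proof.
  split.
  - intros [_ H] eps He.
    destruct (H x (fun P h => h) (mkposreal eps He)) as [d Hd].
    exists d; split; [apply cond_pos|]. intros t Ht.
    exact (Hd t Ht).
  - intros H. split; [apply is_linear_scal_l|].
    intros y Hy. apply (is_filter_lim_locally_unique (V := R_NormedModule) x y) in Hy; subst y.
    intros [eps He]. destruct (H eps He) as (d & Hd & Hd').
    exists (mkposreal d Hd). intros t Ht. apply Hd'. exact Ht.
Qed.

Lemma Cmod_le_Re_Im (z : C) : Cmod z <= Rabs (Re z) + Rabs (Im z).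
Proof.
  replace z with (RtoC (Re z) + Ci * RtoC (Im z))%C at 1
    by (apply injective_projections; unfold Re, Im; simpl; ring).
  eapply Rle_trans; [apply Cmod_triangle|].
  rewrite Cmod_mult, Cmod_Ci, !Cmod_R. lra.
Qed.

Lemma im_le_Cmod (z : C) : Rabs (Im z) <= Cmod z.
Proof. eapply Rle_trans; [apply Rmax_r | apply Rmax_Cmod]. Qed.

(** The variable is real, so differentiation is componentwise; the product and inverse rules below
    are reduced to real ones through this. *)
Lemma is_deriveC_Re_Im (f : R -> C) (x : R) (l : C) :
  is_deriveC f x l <->
  is_derive (fun t => Re (f t)) x (Re l) /\ is_derive (fun t => Im (f t)) x (Im l).
Proof.
  rewrite is_deriveC_eps, !is_deriveR_eps. split.
  - intros H; split; intros eps He; destruct (H eps He) as (d & Hd & Hd');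
    exists d; split; auto; intros t Ht; eapply Rle_trans; [|apply (Hd' t Ht)| |apply (Hd' t Ht)].
    + replace (Re (f t) - _ - _) with (Re (f t - f x - RtoC (t - x) * l)%C).
      apply re_le_Cmod. unfold Re; simpl. ring.
    + replace (Im (f t) - _ - _) with (Im (f t - f x - RtoC (t - x) * l)%C).
      apply im_le_Cmod. unfold Im; simpl. ring.
  - intros [H1 H2] eps He.
    destruct (H1 (eps/2)) as (d1 & Hd1 & Hd1'); [lra|].
    destruct (H2 (eps/2)) as (d2 & Hd2 & Hd2'); [lra|].
    exists (Rmin d1 d2); split; [now apply Rmin_pos|]. intros t Ht.
    eapply Rle_trans; [apply Cmod_le_Re_Im|].
    specialize (Hd1' t (Rlt_le_trans _ _ _ Ht (Rmin_l _ _))).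
    specialize (Hd2' t (Rlt_le_trans _ _ _ Ht (Rmin_r _ _))).
    replace (Re (f t - f x - RtoC (t - x) * l)%C) with (Re (f t) - Re (f x) - (t - x) * Re l)
      by (unfold Re; simpl; ring).
    replace (Im (f t - f x - RtoC (t - x) * l)%C) with (Im (f t) - Im (f x) - (t - x) * Im l)
      by (unfold Im; simpl; ring).
    lra.
Qed.

Lemma is_deriveC_eq (f : R -> C) (x : R) (l l' : C) :
  is_deriveC f x l -> l = l' -> is_deriveC f x l'.
Proof. now intros H <-. Qed.

Lemma is_deriveR_eq (f : R -> R) (x : R) (l l' : R) :
  is_derive f x l -> l = l' -> is_derive f x l'.
Proof. now intros H <-. Qed.

Lemma is_deriveR_plus (f g : R -> R) (x l m : R) :
  is_derive f x l -> is_derive g x m -> is_derive (fun t => f t + g t) x (l + m).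
Proof. exact (@is_derive_plus R_AbsRing R_NormedModule f g x l m). Qed.

Lemma is_deriveR_minus (f g : R -> R) (x l m : R) :
  is_derive f x l -> is_derive g x m -> is_derive (fun t => f t - g t) x (l - m).
Proof. exact (@is_derive_minus R_AbsRing R_NormedModule f g x l m). Qed.

Lemma is_deriveR_opp (f : R -> R) (x l : R) :
  is_derive f x l -> is_derive (fun t => - f t) x (- l).
Proof. exact (@is_derive_opp R_AbsRing R_NormedModule f x l). Qed.

Lemma is_deriveR_mult (f g : R -> R) (x l m : R) :
  is_derive f x l -> is_derive g x m ->
  is_derive (fun t => f t * g t) x (l * g x + f x * m).
Proof.
  intros Hf Hg. exact (@is_derive_mult R_AbsRing f g x l m Hf Hg Rmult_comm).
Qed.

Lemma is_deriveR_comp (f g : R -> R) (x l m : R) :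
  is_derive f (g x) l -> is_derive g x m -> is_derive (fun t => f (g t)) x (m * l).
Proof. exact (@is_derive_comp R_AbsRing R_NormedModule f g x l m). Qed.

Lemma is_deriveR_scal (c : R) (f : R -> R) (x l : R) :
  is_derive f x l -> is_derive (fun t => c * f t) x (c * l).
Proof.
  intros H. eapply is_deriveR_eq.
  - exact (is_deriveR_mult _ _ _ _ _ (is_derive_const (c : R_NormedModule) x) H).
  - unfold zero; simpl; ring.
Qed.

Lemma is_deriveC_mult (f g : R -> C) (x : R) (l m : C) :
  is_deriveC f x l -> is_deriveC g x m ->
  is_deriveC (fun t => f t * g t)%C x (l * g x + f x * m)%C.
Proof.
  rewrite !is_deriveC_Re_Im. intros [F1 F2] [G1 G2]. split.
  - eapply is_deriveR_eq.
    { apply is_deriveR_minus; apply is_deriveR_mult; eassumption. }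
    unfold Re, Im; simpl; ring.
  - eapply is_deriveR_eq.
    { apply is_deriveR_plus; apply is_deriveR_mult; eassumption. }
    unfold Re, Im; simpl; ring.
Qed.

Lemma is_deriveC_const (c : C) (x : R) : is_deriveC (fun _ => c) x (RtoC 0).
Proof. exact (@is_derive_const R_AbsRing C_R_NormedModule c x). Qed.

Lemma is_deriveC_RtoC (f : R -> R) (x l : R) :
  is_derive f x l -> is_deriveC (fun t => RtoC (f t)) x (RtoC l).
Proof.
  intros H. apply is_deriveC_Re_Im. split; [exact H|].
  exact (is_derive_const (0 : R_NormedModule) x).
Qed.

Lemma is_deriveC_scal (c : C) (f : R -> C) (x : R) (l : C) :
  is_deriveC f x l -> is_deriveC (fun t => c * f t)%C x (c * l)%C.
Proof.
  intros H. eapply is_deriveC_eq.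
  - apply is_deriveC_mult; [apply is_deriveC_const | exact H].
  - cbv beta; ring.
Qed.

Lemma is_deriveC_comp (f : R -> C) (g : R -> R) (x : R) (l : C) (m : R) :
  is_deriveC f (g x) l -> is_derive g x m ->
  is_deriveC (fun t => f (g t)) x (RtoC m * l)%C.
Proof.
  intros Hf Hg. eapply is_deriveC_eq.
  - exact (@is_derive_comp R_AbsRing C_R_NormedModule f g x l m Hf Hg).
  - apply injective_projections; simpl; unfold scal; simpl; unfold mult; simpl; ring.
Qed.

Lemma is_deriveC_continuity (f : R -> C) (x : R) (l : C) :
  is_deriveC f x l -> continuous (fun t => Re (f t)) x /\ continuous (fun t => Im (f t)) x.
Proof.
  rewrite is_deriveC_Re_Im. intros [H1 H2].
  split; refine (@ex_derive_continuous R_AbsRing R_NormedModule _ _ _); eexists; eassumption.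
Qed.

Lemma Cmod_sqr (z : C) : Cmod z ^ 2 = Re z * Re z + Im z * Im z.
Proof. rewrite Cmod2_alt; ring. Qed.

Lemma C_nonzero_sqr (z : C) : z <> 0%C -> 0 < Re z ^ 2 + Im z ^ 2.
Proof.
  intros H. rewrite <- Cmod2_alt. apply pow_lt. now apply Cmod_gt_0.
Qed.

Lemma is_deriveC_inv (f : R -> C) (x : R) (l : C) :
  f x <> 0%C -> is_deriveC f x l -> is_deriveC (fun t => / f t)%C x (- l / (f x * f x))%C.
Proof.
  intros Hx. rewrite !is_deriveC_Re_Im. intros [F1 F2].
  pose proof (C_nonzero_sqr _ Hx) as Hp.
  assert (E : is_derive (fun t => Re (f t) ^ 2 + Im (f t) ^ 2) x
                (2 * Re (f x) * Re l + 2 * Im (f x) * Im l)).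
  { eapply is_deriveR_eq.
    - apply is_deriveR_plus; apply is_derive_pow; eassumption.
    - unfold plus; simpl; ring. }
  split.
  - eapply is_deriveR_eq.
    + apply is_derive_div; [exact F1 | exact E | apply Rgt_not_eq; exact Hp].
    + clear - Hp. cbv beta in *. destruct (f x) as [a b], l as [c d]. unfold Re, Im in *; simpl in *.
      assert (Hp2 : 0 < (a ^ 2 + b ^ 2) ^ 2) by (apply pow_lt; simpl; lra).
      field. repeat split; simpl in Hp2; intro; nra.
  - eapply is_deriveR_eq.
    + apply is_derive_div; [apply is_deriveR_opp; exact F2 | exact E | apply Rgt_not_eq; exact Hp].
    + clear - Hp. cbv beta in *. destruct (f x) as [a b], l as [c d]. unfold Re, Im in *; simpl in *.
      assert (Hp2 : 0 < (a ^ 2 + b ^ 2) ^ 2) by (apply pow_lt; simpl; lra).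
      field. repeat split; simpl in Hp2; intro; nra.
Qed.

Lemma is_deriveC_pow (f : R -> C) (x : R) (l : C) (n : nat) :
  is_deriveC f x l ->
  is_deriveC (fun t => Cpow (f t) n) x (RtoC (INR n) * l * Cpow (f x) (pred n))%C.
Proof.
  intros H. induction n as [|n IH].
  - eapply is_deriveC_eq; [exact (is_deriveC_const 1 x)|]. simpl; ring.
  - eapply is_deriveC_eq; [exact (is_deriveC_mult _ _ _ _ _ H IH)|].
    rewrite S_INR, RtoC_plus. destruct n as [|n]; simpl; ring.
Qed.

(** * Integral powers, and real bases with complex exponents *)

Lemma Cpow_Z_of_nat (z : C) (n : nat) : Cpow_Z z (Z.of_nat n) = Cpow z n.
Proof.
  destruct n; [reflexivity|]. change (Cpow z (Pos.to_nat (Pos.of_succ_nat n)) = Cpow z (S n)).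
  now rewrite SuccNat2Pos.id_succ.
Qed.

Lemma Cpow_Z_opp_nat (z : C) (n : nat) : Cpow_Z z (- Z.of_nat n) = (/ Cpow z n)%C.
Proof.
  destruct n.
  - simpl. apply injective_projections; simpl; field.
  - change (/ Cpow z (Pos.to_nat (Pos.of_succ_nat n)) = / Cpow z (S n))%C. now rewrite SuccNat2Pos.id_succ.
Qed.

Lemma Z_nat_cases (P : Z -> Prop) :
  (forall n, P (Z.of_nat n)) -> (forall n, P (- Z.of_nat n)%Z) -> forall m, P m.
Proof.
  intros H1 H2 m. destruct (Z.le_ge_cases 0 m) as [H|H].
  - rewrite <- (Z2Nat.id m) by lia. apply H1.
  - replace m with (- Z.of_nat (Z.to_nat (- m)))%Z by (rewrite Z2Nat.id; lia). apply H2.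
Qed.

Lemma Cpow_Z_succ (z : C) (m : Z) : z <> 0%C -> Cpow_Z z (m + 1) = (z * Cpow_Z z m)%C.
Proof.
  intros Hz. revert m. apply Z_nat_cases; intros n.
  - replace (Z.of_nat n + 1)%Z with (Z.of_nat (S n)) by lia.
    now rewrite !Cpow_Z_of_nat.
  - destruct n.
    + simpl. ring.
    + replace (- Z.of_nat (S n) + 1)%Z with (- Z.of_nat n)%Z by lia.
      rewrite !Cpow_Z_opp_nat. simpl. field. split; [now apply Cpow_nz | auto].
Qed.

Lemma Cpow_Z_add (z : C) (m n : Z) : z <> 0%C ->
  Cpow_Z z (m + n) = (Cpow_Z z m * Cpow_Z z n)%C.
Proof.
  intros Hz. revert n. apply Z_nat_cases; intros n; induction n as [|n IH].
  - rewrite Z.add_0_r. simpl; ring.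
  - replace (m + Z.of_nat (S n))%Z with ((m + Z.of_nat n) + 1)%Z by lia.
    replace (Z.of_nat (S n))%Z with (Z.of_nat n + 1)%Z by lia.
    rewrite !Cpow_Z_succ, IH by auto. ring.
  - rewrite Z.add_0_r. simpl; ring.
  - assert (E : (z * Cpow_Z z (m + - Z.of_nat (S n)) = z * (Cpow_Z z m * Cpow_Z z (- Z.of_nat (S n))))%C).
    { rewrite <- Cpow_Z_succ by auto.
      replace (m + - Z.of_nat (S n) + 1)%Z with (m + - Z.of_nat n)%Z by lia. rewrite IH.
      replace (- Z.of_nat n)%Z with (- Z.of_nat (S n) + 1)%Z by lia.
      rewrite Cpow_Z_succ by auto. ring. }
    assert (E2 : forall a b, (z * a = z * b)%C -> a = b).
    { intros a b Hab. replace a with (/ z * (z * a))%C by (field; auto). rewrite Hab. field; auto. }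
    now apply E2.
Qed.

Lemma Cmod_Cpow_Z (z : C) (m : Z) : z <> 0%C -> Cmod (Cpow_Z z m) = powerRZ (Cmod z) m.
Proof.
  intros Hz. destruct m; simpl.
  - apply Cmod_1.
  - apply Cmod_pow.
  - rewrite Cmod_inv by now apply Cpow_nz. now rewrite Cmod_pow.
Qed.

Lemma Cpow_Z_conj (z : C) (m : Z) : z <> 0%C -> Cconj (Cpow_Z z m) = Cpow_Z (Cconj z) m.
Proof.
  intros Hz. destruct m; simpl.
  - apply injective_projections; simpl; ring.
  - apply Cpow_conj.
  - rewrite Cinv_conj by now apply Cpow_nz. now rewrite Cpow_conj.
Qed.

Lemma is_deriveC_Cpow_Z (f : R -> C) (x : R) (l : C) (m : Z) :
  f x <> 0%C -> is_deriveC f x l ->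
  is_deriveC (fun t => Cpow_Z (f t) m) x (RtoC (IZR m) * l * Cpow_Z (f x) (m - 1))%C.
Proof.
  intros Hx Hf. revert m. apply Z_nat_cases; intros n.
  - eapply is_derive_ext; [intros t; symmetry; apply Cpow_Z_of_nat|].
    eapply is_deriveC_eq; [apply is_deriveC_pow; exact Hf|].
    rewrite <- INR_IZR_INZ. destruct n.
    + simpl; ring.
    + replace (Z.of_nat (S n) - 1)%Z with (Z.of_nat n) by lia. now rewrite Cpow_Z_of_nat.
  - eapply is_derive_ext; [intros t; symmetry; apply Cpow_Z_opp_nat|].
    eapply is_deriveC_eq.
    { apply is_deriveC_inv; [now apply Cpow_nz | apply is_deriveC_pow; exact Hf]. }
    replace (- Z.of_nat n - 1)%Z with (- Z.of_nat (S n))%Z by lia.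
    rewrite Cpow_Z_opp_nat, opp_IZR, <- INR_IZR_INZ, RtoC_opp.
    destruct n; simpl; field; repeat split; auto; now apply Cpow_nz.
Qed.

Lemma Rcpow_exp (x : R) (s : C) : Cmod (Rcpow x s) = exp (Re s * ln x).
Proof.
  unfold Rcpow. rewrite Cmod_mult, Cmod_R, Rabs_pos_eq by (left; apply exp_pos).
  unfold Cmod; simpl. rewrite !Rmult_1_r.
  replace (_ + _) with 1. rewrite sqrt_1; ring.
  pose proof (sin2_cos2 (Im s * ln x)) as H. unfold Rsqr in H. lra.
Qed.

Lemma Cmod_Rcpow (x : R) (s : C) : Cmod (Rcpow x s) = Rpower x (Re s).
Proof. apply Rcpow_exp. Qed.

Lemma Rcpow_add (x : R) (s t : C) : Rcpow x (s + t) = (Rcpow x s * Rcpow x t)%C.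
Proof.
  unfold Rcpow. replace (Re (s + t)%C) with (Re s + Re t) by reflexivity.
  replace (Im (s + t)%C) with (Im s + Im t) by reflexivity.
  rewrite !Rmult_plus_distr_r, exp_plus, cos_plus, sin_plus.
  apply injective_projections; simpl; ring.
Qed.

Lemma Rcpow_RtoC (x a : R) : Rcpow x (RtoC a) = RtoC (Rpower x a).
Proof.
  unfold Rcpow, Rpower; simpl. rewrite Rmult_0_l, cos_0, sin_0.
  apply injective_projections; simpl; ring.
Qed.

Lemma Rcpow_conj (x : R) (s : C) : Cconj (Rcpow x s) = Rcpow x (Cconj s).
Proof.
  unfold Rcpow. rewrite re_conj, im_conj.
  replace (- Im s * ln x) with (- (Im s * ln x)) by ring.
  rewrite cos_neg, sin_neg. apply injective_projections; simpl; ring.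
Qed.

Lemma is_deriveC_Rcpow (s : C) (x : R) : 0 < x ->
  is_deriveC (fun t => Rcpow t s) x (s / RtoC x * Rcpow x s)%C.
Proof.
  intros Hx. unfold Rcpow.
  assert (L : is_derive ln x (/ x)) by now apply is_derive_ln.
  assert (L' : forall a, is_derive (fun t => a * ln t) x (a * / x))
    by (intros a; now apply is_deriveR_scal).
  eapply is_deriveC_eq.
  { refine (is_deriveC_mult _ (fun t => (cos (Im s * ln t), sin (Im s * ln t))) x (RtoC _)
      (Im s * / x * - sin (Im s * ln x), Im s * / x * cos (Im s * ln x)) _ _).
    - apply is_deriveC_RtoC. apply (is_deriveR_comp exp).
      + apply (is_derive_exp (Re s * ln x)).
      + apply L'.
    - apply is_deriveC_Re_Im. split.
      + apply (is_deriveR_comp cos); [apply is_derive_cos | apply L'].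
      + apply (is_deriveR_comp sin); [apply is_derive_sin | apply L']. }
  apply injective_projections; unfold Re, Im; simpl; field; lra.
Qed.

(** The mean value theorem is applied to real and imaginary parts, whose intermediate points differ;
    this costs the factor 2. *)
Lemma mvt_Cmod (f df : R -> C) (a b M : R) :
  (forall t, Rmin a b <= t <= Rmax a b -> is_deriveC f t (df t)) ->
  (forall t, Rmin a b <= t <= Rmax a b -> Cmod (df t) <= M) ->
  Cmod (f b - f a)%C <= 2 * M * Rabs (b - a).
Proof.
  intros Hd HM.
  destruct (MVT_gen (fun t => Re (f t)) a b (fun t => Re (df t))) as (c & Hc & Ec).
  { intros t Ht. apply (proj1 (is_deriveC_Re_Im f t (df t))). apply Hd. lra. }
  { intros t Ht. apply continuity_pt_filterlim.
    apply (is_deriveC_continuity f t (df t)). now apply Hd. }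
  destruct (MVT_gen (fun t => Im (f t)) a b (fun t => Im (df t))) as (c' & Hc' & Ec').
  { intros t Ht. apply (proj1 (is_deriveC_Re_Im f t (df t))). apply Hd. lra. }
  { intros t Ht. apply continuity_pt_filterlim.
    apply (is_deriveC_continuity f t (df t)). now apply Hd. }
  eapply Rle_trans; [apply Cmod_le_Re_Im|].
  replace (Re (f b - f a)%C) with (Re (f b) - Re (f a)) by reflexivity.
  replace (Im (f b - f a)%C) with (Im (f b) - Im (f a)) by reflexivity.
  rewrite Ec, Ec', !Rabs_mult.
  pose proof (Rle_trans _ _ _ (re_le_Cmod _) (HM c Hc)).
  pose proof (Rle_trans _ _ _ (im_le_Cmod _) (HM c' Hc')).
  pose proof (Rabs_pos (b - a)). nra.
Qed.

(** * Unordered sums *)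

Definition Rsum_list {T : Type} (m : T -> R) (l : list T) : R :=
  fold_right (fun t acc => m t + acc) 0 l.

(** Partial sums run over duplicate-free lists, as in [finite_subsets]. For nonnegative terms their
    boundedness is summability, and the value of the sum never has to be named. *)
Definition summable_on {T : Type} (P : T -> Prop) (m : T -> R) : Prop :=
  (forall t, P t -> 0 <= m t) /\
  exists B, forall l, NoDup l -> List.Forall P l -> Rsum_list m l <= B.

Lemma Rsum_list_app {T} (m : T -> R) l l' :
  Rsum_list m (l ++ l') = Rsum_list m l + Rsum_list m l'.
Proof. induction l as [|x l IH]; simpl; [ring | rewrite IH; ring]. Qed.

Lemma Rsum_list_perm {T} (m : T -> R) l l' :
  Permutation l l' -> Rsum_list m l = Rsum_list m l'.
Proof. induction 1; simpl; lra. Qed.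

Lemma Rsum_list_le {T} (m m' : T -> R) l :
  (forall t, In t l -> m t <= m' t) -> Rsum_list m l <= Rsum_list m' l.
Proof.
  induction l as [|x l IH]; simpl; intros H; [lra|].
  pose proof (H x (or_introl eq_refl)). specialize (IH (fun t h => H t (or_intror h))). lra.
Qed.

Lemma Rsum_list_scal {T} (c : R) (m : T -> R) l :
  Rsum_list (fun t => c * m t) l = c * Rsum_list m l.
Proof. induction l as [|x l IH]; simpl; [ring | rewrite IH; ring]. Qed.

Lemma Rsum_list_nonneg {T} (m : T -> R) l :
  (forall t, In t l -> 0 <= m t) -> 0 <= Rsum_list m l.
Proof.
  induction l as [|x l IH]; simpl; intros H; [lra|].
  pose proof (H x (or_introl eq_refl)). specialize (IH (fun t h => H t (or_intror h))). lra.
Qed.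

(** Lists stand for finite sets: a list containing [l0] is rearranged into [l0] followed by a
    remainder, on which tail estimates act. *)
Lemma incl_Permutation_app {T} (l0 l : list T) :
  NoDup l0 -> incl l0 l -> exists r, Permutation l (l0 ++ r).
Proof.
  intros H; revert l; induction H as [|x l0 Hx H IH]; intros l Hl.
  - exists l; reflexivity.
  - destruct (in_split x l (Hl x (or_introl eq_refl))) as (l1 & l2 & ->).
    destruct (IH (l1 ++ l2)) as [r Hr].
    + intros y Hy. assert (y <> x) by congruence.
      specialize (Hl y (or_intror Hy)). apply in_app_or in Hl. apply in_or_app.
      simpl in Hl. intuition congruence.
    + exists r. rewrite <- Permutation_middle. simpl. now apply perm_skip.
Qed.

Lemma Rsum_list_incl {T} (m : T -> R) l l' :
  NoDup l -> incl l l' -> (forall t, In t l' -> 0 <= m t) ->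
  Rsum_list m l <= Rsum_list m l'.
Proof.
  intros Hn Hi Hm. destruct (incl_Permutation_app l l' Hn Hi) as [r Hr].
  rewrite (Rsum_list_perm _ _ _ Hr), Rsum_list_app.
  pose proof (Rsum_list_nonneg m r) as H.
  assert (0 <= Rsum_list m r); [|lra]. apply H. intros t Ht. apply Hm.
  eapply Permutation_in; [symmetry; exact Hr|]. apply in_or_app; auto.
Qed.

Lemma summable_on_scal {T} (P : T -> Prop) (m : T -> R) c :
  0 <= c -> summable_on P m -> summable_on P (fun t => c * m t).
Proof.
  intros Hc [Hm [B HB]]. split.
  - intros t Ht. apply Rmult_le_pos; auto.
  - exists (c * B). intros l Hn Hl. rewrite Rsum_list_scal.
    apply Rmult_le_compat_l; auto.
Qed.

(** A list whose sum is within eps of the supremum of all partial sums leaves at most eps for any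
    disjoint remainder. *)
Lemma summable_on_tail {T} (P : T -> Prop) (m : T -> R) eps :
  summable_on P m -> 0 < eps ->
  exists l0, NoDup l0 /\ List.Forall P l0 /\
    forall r, NoDup (l0 ++ r) -> List.Forall P r -> Rsum_list m r <= eps.
Proof.
  intros [Hm [B HB]] He.
  destruct (completeness (fun s => exists l, NoDup l /\ List.Forall P l /\ s = Rsum_list m l)) as [S [S1 S2]].
  - exists B. intros s (l & Hn & Hl & ->). auto.
  - exists 0, nil. repeat split; constructor.
  - destruct (classic (exists l, NoDup l /\ List.Forall P l /\ S - eps < Rsum_list m l)) as [(l & Hn & Hl & H)|H].
    + exists l; repeat split; auto. intros r Hr HPr.
      specialize (S1 (Rsum_list m (l ++ r))). rewrite Rsum_list_app in S1.
      assert (Rsum_list m l + Rsum_list m r <= S); [|lra].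
      apply S1. exists (l ++ r). repeat split; auto.
      * apply Forall_app; auto.
      * now rewrite Rsum_list_app.
    + exfalso. specialize (S2 (S - eps)). apply (Rlt_irrefl S).
      eapply Rle_lt_trans; [apply S2|lra]. intros s (l & Hn & Hl & ->).
      apply Rnot_lt_le. intros Hlt. apply H. exists l; auto.
Qed.

Lemma Csum_list_perm {T} (a : T -> C) l l' :
  Permutation l l' -> Csum_list a l = Csum_list a l'.
Proof.
  induction 1; simpl; auto.
  - now rewrite IHPermutation.
  - ring.
  - congruence.
Qed.

Lemma Csum_list_app {T} (a : T -> C) l l' :
  Csum_list a (l ++ l') = (Csum_list a l + Csum_list a l')%C.
Proof. induction l as [|x l IH]; simpl; [ring | rewrite IH; ring]. Qed.

Lemma Cmod_Csum_list {T} (a : T -> C) (m : T -> R) l :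
  (forall t, In t l -> Cmod (a t) <= m t) -> Cmod (Csum_list a l) <= Rsum_list m l.
Proof.
  induction l as [|x l IH]; simpl; intros H; [rewrite Cmod_0; lra|].
  eapply Rle_trans; [apply Cmod_triangle|].
  apply Rplus_le_compat; auto.
Qed.

Lemma Csum_list_plus {T} (a b : T -> C) l :
  Csum_list (fun t => a t + b t)%C l = (Csum_list a l + Csum_list b l)%C.
Proof. induction l as [|x l IH]; simpl; [ring | rewrite IH; ring]. Qed.

Lemma Csum_list_scal {T} c (a : T -> C) l :
  Csum_list (fun t => c * a t)%C l = (c * Csum_list a l)%C.
Proof. induction l as [|x l IH]; simpl; [ring | rewrite IH; ring]. Qed.

Lemma Csum_list_conj {T} (a : T -> C) l :
  Csum_list (fun t => Cconj (a t)) l = Cconj (Csum_list a l).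
Proof.
  induction l as [|x l IH]; simpl.
  - apply injective_projections; simpl; ring.
  - now rewrite IH, Cplus_conj.
Qed.

Lemma Csum_list_ext {T} (P : T -> Prop) (a b : T -> C) l :
  (forall t, P t -> a t = b t) -> List.Forall P l -> Csum_list a l = Csum_list b l.
Proof. intros H; induction 1; simpl; [auto | rewrite H, IHForall; auto]. Qed.

(** The base list of a neighbourhood in [finite_subsets] may repeat entries; membership is decided
    classically to remove the repetitions. *)
Lemma exists_NoDup_incl {T} (P : T -> Prop) (l : list T) :
  List.Forall P l -> exists l', NoDup l' /\ List.Forall P l' /\ incl l l'.
Proof.
  induction 1 as [|x l Hx Hl (l' & H1 & H2 & H3)].
  - exists nil; repeat split; auto using NoDup_nil. intros y [].
  - destruct (classic (In x l')).
    + exists l'; repeat split; auto. intros y [->|Hy]; auto.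
    + exists (x :: l'); split; [constructor; auto | split; [constructor; auto|]].
      intros y [->|Hy]; simpl; auto.
Qed.

Global Instance finite_subsets_filter {T} (P : T -> Prop) : ProperFilter (finite_subsets P).
Proof.
  split; [|split].
  - intros A (l0 & H0 & H). destruct (exists_NoDup_incl P l0 H0) as (l & H1 & H2 & H3).
    exists l. exact (H l H1 H2 H3).
  - exists nil; split; auto.
  - intros A B (l1 & H1 & H1') (l2 & H2 & H2'). exists (l1 ++ l2); split.
    + apply Forall_app; auto.
    + intros l Hn Hl Hi. apply incl_app_inv in Hi. destruct Hi. split; auto.
  - intros A B HAB (l1 & H1 & H1'). exists l1; split; auto.
Qed.

Lemma ball_C_of_Cmod (x y : C) (e : R) : Cmod (y - x)%C < e ->
  ball (M := C_R_CompleteNormedModule) x e y.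
Proof.
  intros H. split.
  - apply (Rle_lt_trans _ (Cmod (y - x)%C)); auto. exact (re_le_Cmod (y - x)%C).
  - apply (Rle_lt_trans _ (Cmod (y - x)%C)); auto. exact (im_le_Cmod (y - x)%C).
Qed.

(** Balls of C are products of real balls, whence the factor 2. *)
Lemma Cmod_of_ball_C (x y : C) (e : R) :
  ball (M := C_R_CompleteNormedModule) x e y -> Cmod (y - x)%C < 2 * e.
Proof.
  intros [H1 H2]. eapply Rle_lt_trans; [apply Cmod_le_Re_Im|].
  change (Rabs (fst y - fst x) < e) in H1. change (Rabs (snd y - snd x) < e) in H2.
  unfold Re, Im; simpl. unfold Rminus in *. lra.
Qed.

Lemma is_Csum_eps {T} (P : T -> Prop) (a : T -> C) (S : C) :
  is_Csum P a S <->
  forall eps, 0 < eps -> finite_subsets P (fun l => Cmod (Csum_list a l - S)%C < eps).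
Proof.
  unfold is_Csum. rewrite filterlim_locally. split.
  - intros H eps He. assert (He2 : 0 < eps / 2) by lra.
    eapply filter_imp; [|apply (H (mkposreal _ He2))].
    intros l Hl. apply Cmod_of_ball_C in Hl. simpl in Hl. lra.
  - intros H [eps He]. eapply filter_imp; [|apply (H eps He)].
    intros l Hl. now apply ball_C_of_Cmod.
Qed.

Lemma is_Csum_unique {T} (P : T -> Prop) (a : T -> C) (S : C) :
  is_Csum P a S -> Csum P a = S.
Proof.
  intros H. unfold Csum, is_Csum.
  exact (iota_filterlim_locally (V := C_R_CompleteNormedModule) (Csum_list a) S H).
Qed.

Lemma Csum_correct {T} (P : T -> Prop) (a : T -> C) :
  ex_Csum P a -> is_Csum P a (Csum P a).
Proof. intros [S H]. now rewrite (is_Csum_unique _ _ _ H). Qed.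

Lemma is_Csum_ext {T} (P : T -> Prop) (a b : T -> C) S :
  (forall t, P t -> a t = b t) -> is_Csum P a S -> is_Csum P b S.
Proof.
  rewrite !is_Csum_eps. intros H Ha eps He. destruct (Ha eps He) as (l0 & H0 & H').
  exists l0; split; auto. intros l Hn Hl Hi.
  rewrite <- (Csum_list_ext P a b l H Hl). auto.
Qed.

Lemma is_Csum_plus {T} (P : T -> Prop) (a b : T -> C) A B :
  is_Csum P a A -> is_Csum P b B -> is_Csum P (fun t => a t + b t)%C (A + B)%C.
Proof.
  rewrite !is_Csum_eps. intros Ha Hb eps He.
  assert (He2 : 0 < eps / 2) by lra.
  eapply filter_imp; [|apply (filter_and _ _ (Ha _ He2) (Hb _ He2))].
  intros l [H1 H2]. simpl in *. rewrite Csum_list_plus.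
  replace (_ - _)%C with ((Csum_list a l - A) + (Csum_list b l - B))%C by ring.
  eapply Rle_lt_trans; [apply Cmod_triangle|]. lra.
Qed.

Lemma is_Csum_scal {T} (P : T -> Prop) c (a : T -> C) A :
  is_Csum P a A -> is_Csum P (fun t => c * a t)%C (c * A)%C.
Proof.
  rewrite !is_Csum_eps. intros Ha eps He.
  pose proof (Cmod_ge_0 c) as Hc.
  assert (He2 : 0 < eps / (Cmod c + 1)) by (apply Rdiv_lt_0_compat; lra).
  eapply filter_imp; [|apply (Ha _ He2)].
  intros l H. simpl in *. rewrite Csum_list_scal.
  replace (_ - _)%C with (c * (Csum_list a l - A))%C by ring.
  rewrite Cmod_mult. apply (Rmult_lt_compat_l (Cmod c + 1)) in H; [|lra].
  replace ((Cmod c + 1) * (eps / (Cmod c + 1))) with eps in H by (field; lra).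
  pose proof (Cmod_ge_0 (Csum_list a l - A)%C). lra.
Qed.

Lemma is_Csum_conj {T} (P : T -> Prop) (a : T -> C) A :
  is_Csum P a A -> is_Csum P (fun t => Cconj (a t)) (Cconj A).
Proof.
  rewrite !is_Csum_eps. intros Ha eps He.
  eapply filter_imp; [|apply (Ha _ He)].
  intros l H. simpl in *. now rewrite Csum_list_conj, <- Cminus_conj, Cmod_conj.
Qed.

Lemma Csum_list_tail {T} (P : T -> Prop) (a : T -> C) (m : T -> R) eps l0 :
  (forall t, P t -> Cmod (a t) <= m t) ->
  NoDup l0 -> (forall r, NoDup (l0 ++ r) -> List.Forall P r -> Rsum_list m r <= eps) ->
  forall l, NoDup l -> List.Forall P l -> incl l0 l ->
    Cmod (Csum_list a l - Csum_list a l0)%C <= eps.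
Proof.
  intros Ha Hn0 H l Hn Hl Hi.
  destruct (incl_Permutation_app l0 l Hn0 Hi) as [r Hr].
  rewrite (Csum_list_perm _ _ _ Hr), Csum_list_app.
  replace (_ - _)%C with (Csum_list a r) by ring.
  assert (Hr' : List.Forall P r).
  { rewrite Forall_forall in *. intros t Ht. apply Hl.
    eapply Permutation_in; [symmetry; exact Hr|]. apply in_or_app; auto. }
  eapply Rle_trans; [apply (Cmod_Csum_list a m)|].
  - intros t Ht. apply Ha. rewrite Forall_forall in Hr'. auto.
  - apply H; auto. eapply Permutation_NoDup; eassumption.
Qed.

(** Cauchy criterion: all lists beyond a good [l0] have sums within eps/3 of that of [l0], hence
    within 2 eps/3 of each other. *)
Lemma ex_Csum_dominated {T} (P : T -> Prop) (a : T -> C) (m : T -> R) :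
  summable_on P m -> (forall t, P t -> Cmod (a t) <= m t) -> ex_Csum P a.
Proof.
  intros Hm Ha.
  apply (proj1 (filterlim_locally_cauchy (U := C_R_CompleteNormedModule)
    (F := finite_subsets P) (Csum_list a))).
  intros [eps He]. assert (He3 : 0 < eps / 3) by lra.
  destruct (summable_on_tail P m (eps / 3) Hm He3) as (l0 & Hn0 & Hl0 & H0).
  exists (fun l => Cmod (Csum_list a l - Csum_list a l0)%C <= eps / 3). split.
  - exists l0; split; auto. intros l Hn Hl Hi.
    exact (Csum_list_tail P a m _ l0 Ha Hn0 H0 l Hn Hl Hi).
  - intros u v Hu Hv. apply ball_C_of_Cmod. simpl.
    replace (_ - _)%C with ((Csum_list a v - Csum_list a l0) - (Csum_list a u - Csum_list a l0))%C by ring.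
    eapply Rle_lt_trans; [apply Cmod_triangle|]. rewrite Cmod_opp. lra.
Qed.

(** The tail bound passes to the limit: otherwise some list containing [l0] would be both close to S
    and close to the sum over [l0]. *)
Lemma is_Csum_tail {T} (P : T -> Prop) (a : T -> C) (m : T -> R) S eps l0 :
  is_Csum P a S ->
  (forall t, P t -> Cmod (a t) <= m t) ->
  NoDup l0 -> List.Forall P l0 -> (forall r, NoDup (l0 ++ r) -> List.Forall P r -> Rsum_list m r <= eps) ->
  Cmod (S - Csum_list a l0)%C <= eps.
Proof.
  rewrite is_Csum_eps. intros HS Ha Hn0 Hl0 H0.
  apply Rnot_lt_le. intros Hlt.
  destruct (HS (Cmod (S - Csum_list a l0)%C - eps)) as (l1 & Hl1 & H1); [lra|].
  destruct (exists_NoDup_incl P (l0 ++ l1)) as (l & Hn & Hl & Hi); [apply Forall_app; auto|].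
  apply incl_app_inv in Hi. destruct Hi as [Hi0 Hi1].
  specialize (H1 l Hn Hl Hi1). simpl in H1.
  pose proof (Csum_list_tail P a m _ l0 Ha Hn0 H0 l Hn Hl Hi0) as H2.
  assert (Cmod (S - Csum_list a l0)%C <=
     Cmod (Csum_list a l - Csum_list a l0)%C + Cmod (Csum_list a l - S)%C); [|lra].
  rewrite <- (Cmod_opp (Csum_list a l - S)%C).
  replace (S - Csum_list a l0)%C with
    ((Csum_list a l - Csum_list a l0) + - (Csum_list a l - S))%C by ring.
  apply Cmod_triangle.
Qed.

Lemma is_deriveC_list_eps {T} (a : R -> T -> C) (a' : T -> C) (x eps : R) (l : list T) :
  (forall t, In t l -> is_deriveC (fun u => a u t) x (a' t)) -> 0 < eps ->
  exists d, 0 < d /\ forall u, Rabs (u - x) < d ->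
    Cmod (Csum_list (fun t => a u t - a x t - RtoC (u - x) * a' t)%C l) <= eps * Rabs (u - x).
Proof.
  revert eps; induction l as [|t l IH]; intros eps H He; simpl.
  - exists 1; split; [lra|]. intros u _. rewrite Cmod_0.
    apply Rmult_le_pos; [lra | apply Rabs_pos].
  - destruct (IH (eps / 2)) as (d1 & Hd1 & H1); [intros; apply H; now right | lra |].
    destruct (proj1 (is_deriveC_eps _ _ _) (H t (or_introl eq_refl)) (eps / 2)) as (d2 & Hd2 & H2); [lra|].
    exists (Rmin d1 d2); split; [now apply Rmin_pos|]. intros u Hu.
    eapply Rle_trans; [apply Cmod_triangle|].
    specialize (H1 u (Rlt_le_trans _ _ _ Hu (Rmin_l _ _))).
    specialize (H2 u (Rlt_le_trans _ _ _ Hu (Rmin_r _ _))). lra.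
Qed.

(** A Lipschitz bound at x with summable constants replaces any continuity of the derivatives. The
    remainders outside [l0] sum to at most 2 |u - x| eps/4, and the finitely many inside are
    differentiated directly. *)
Lemma is_deriveC_Csum {T} (P : T -> Prop) (m : T -> R) (a : R -> T -> C) (a' : T -> C) (x d : R) :
  summable_on P m -> 0 < d ->
  (forall t, P t -> is_deriveC (fun u => a u t) x (a' t)) ->
  (forall t, P t -> Cmod (a' t) <= m t) ->
  (forall t, P t -> Cmod (a x t) <= m t) ->
  (forall t u, P t -> Rabs (u - x) < d -> Cmod (a u t - a x t)%C <= m t * Rabs (u - x)) ->
  is_deriveC (fun u => Csum P (a u)) x (Csum P a').
Proof.
  intros Hm Hd Ha Hb Hx Hu. apply is_deriveC_eps. intros eps He.
  assert (He4 : 0 < eps / 4) by lra.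
  destruct (summable_on_tail P m (eps / 4) Hm He4) as (l0 & Hn0 & Hl0 & H0).
  destruct (is_deriveC_list_eps a a' x (eps / 2) l0) as (d1 & Hd1 & H1); [|lra|].
  { intros t Ht. apply Ha. rewrite Forall_forall in Hl0; auto. }
  exists (Rmin d d1); split; [now apply Rmin_pos|]. intros u Hux.
  assert (Hux1 := Rlt_le_trans _ _ _ Hux (Rmin_l _ _)).
  assert (Hux2 := Rlt_le_trans _ _ _ Hux (Rmin_r _ _)).
  pose proof (Rabs_pos (u - x)) as Hp.
  assert (Sx : ex_Csum P (a x)) by (now apply ex_Csum_dominated with m).
  assert (S' : ex_Csum P a') by (now apply ex_Csum_dominated with m).
  assert (Su : ex_Csum P (a u)).
  (* Summability at u follows from that at x and the Lipschitz bound, since |u - x| < d. *)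
  { apply ex_Csum_dominated with (fun t => (1 + d) * m t).
    - apply summable_on_scal; auto; lra.
    - intros t Ht. replace (a u t) with ((a u t - a x t) + a x t)%C by ring.
      eapply Rle_trans; [apply Cmod_triangle|].
      specialize (Hx t Ht). specialize (Hu t u Ht Hux1).
      assert (0 <= m t) by (apply Hm; auto).
      assert (m t * Rabs (u - x) <= m t * d) by (apply Rmult_le_compat_l; lra). lra. }
  apply Csum_correct in Sx, S', Su.
  set (r := fun t => (a u t - a x t - RtoC (u - x) * a' t)%C).
  assert (Sr : is_Csum P r (Csum P (a u) - Csum P (a x) - RtoC (u - x) * Csum P a')%C).
  { pose proof (is_Csum_plus _ _ _ _ _ Su (is_Csum_plus _ _ _ _ _
      (is_Csum_scal _ (- (1))%C _ _ Sx) (is_Csum_scal _ (- RtoC (u - x))%C _ _ S'))) as H.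
    replace (_ - _ - _)%C with
      (Csum P (a u) + (- (1) * Csum P (a x) + - RtoC (u - x) * Csum P a'))%C by ring.
    eapply is_Csum_ext; [|exact H]. intros t _. unfold r. ring. }
  assert (Hr : forall t, P t -> Cmod (r t) <= 2 * Rabs (u - x) * m t).
  { intros t Ht. unfold r. eapply Rle_trans; [apply Cmod_triangle|].
    rewrite Cmod_opp, Cmod_mult, Cmod_R. specialize (Hu t u Ht Hux1). specialize (Hb t Ht).
    assert (Rabs (u - x) * Cmod (a' t) <= Rabs (u - x) * m t) by (apply Rmult_le_compat_l; auto).
    lra. }
  assert (Ht : Cmod (Csum P (a u) - Csum P (a x) - RtoC (u - x) * Csum P a' - Csum_list r l0)%C
     <= 2 * Rabs (u - x) * (eps / 4)).
  { eapply is_Csum_tail; [exact Sr | exact Hr | auto | auto |].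
    intros l Hn Hl. rewrite Rsum_list_scal. apply Rmult_le_compat_l; [lra|]. now apply H0. }
  specialize (H1 u Hux2). fold r in H1.
  replace (_ - _ - _)%C with ((Csum P (a u) - Csum P (a x) - RtoC (u - x) * Csum P a' - Csum_list r l0)
     + Csum_list r l0)%C by ring.
  eapply Rle_trans; [apply Cmod_triangle|].
  unfold r in *. lra.
Qed.

(** * Complex power series and the hypergeometric series *)

(** Only real arguments occur, so a complex power series is a pair of real ones and the theory of
    [PSeries] applies to each component. *)
Definition CPS (u : nat -> C) (w : R) : C :=
  (PSeries (fun n => Re (u n)) w, PSeries (fun n => Im (u n)) w).

(** Radius of convergence at least 1, phrased through bounded terms so that termwise operations on
    the coefficients preserve it easily. *)
Definition radius_ge1 (u : nat -> C) : Prop :=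
  forall r, 0 < r < 1 -> exists M, forall n, Cmod (u n) * r ^ n <= M.

Lemma CV_radius_gt_of_bounded (a : nat -> R) (w : R) :
  Rabs w < 1 ->
  (forall r, 0 < r < 1 -> exists M, forall n, Rabs (a n) * r ^ n <= M) ->
  Rbar_lt (Rabs w) (CV_radius a).
Proof.
  intros Hw H. pose proof (Rabs_pos w).
  apply (Rbar_lt_le_trans _ ((Rabs w + 1) / 2)); [simpl; lra|].
  apply (CV_radius_bounded a). destruct (H ((Rabs w + 1) / 2)) as [M HM]; [lra|].
  exists M. intros n. rewrite Rabs_mult, (Rabs_pos_eq (_ ^ n)); [apply HM|].
  apply pow_le; lra.
Qed.

Lemma radius_ge1_Re (u : nat -> C) (w : R) : radius_ge1 u -> Rabs w < 1 ->
  Rbar_lt (Rabs w) (CV_radius (fun n => Re (u n))).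
Proof.
  intros H Hw. apply CV_radius_gt_of_bounded; auto. intros r Hr. destruct (H r Hr) as [M HM].
  exists M; intros n. eapply Rle_trans; [|apply HM].
  apply Rmult_le_compat_r; [apply pow_le; lra | apply re_le_Cmod].
Qed.

Lemma radius_ge1_Im (u : nat -> C) (w : R) : radius_ge1 u -> Rabs w < 1 ->
  Rbar_lt (Rabs w) (CV_radius (fun n => Im (u n))).
Proof.
  intros H Hw. apply CV_radius_gt_of_bounded; auto. intros r Hr. destruct (H r Hr) as [M HM].
  exists M; intros n. eapply Rle_trans; [|apply HM].
  apply Rmult_le_compat_r; [apply pow_le; lra | apply im_le_Cmod].
Qed.

(** Bernoulli's inequality for (1 + h)^n with h = 1/q - 1. *)
Lemma INR_pow_bounded (q : R) : 0 < q < 1 -> exists M, forall n, INR n * q ^ n <= M.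
Proof.
  intros Hq. exists (/ (/ q - 1)). intros n.
  assert (Hi : 1 < / q) by (rewrite <- Rinv_1; apply Rinv_lt_contravar; lra).
  pose proof (poly n (/ q - 1) ltac:(lra)) as H.
  replace (1 + (/ q - 1)) with (/ q) in H by ring.
  rewrite pow_inv in H by lra.
  assert (Hp : 0 < q ^ n) by (apply pow_lt; lra).
  apply (Rmult_le_reg_r (/ q - 1)); [lra|].
  rewrite Rinv_l by lra.
  apply (Rmult_le_compat_r (q ^ n)) in H; [|lra].
  rewrite Rinv_l in H by lra. lra.
Qed.

(** The factor n is absorbed by enlarging r to the midpoint r' of r and 1, since n (r / r')^n is
    bounded. *)
Lemma radius_ge1_INR (u : nat -> C) :
  radius_ge1 u -> radius_ge1 (fun n => RtoC (INR n) * u n)%C.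
Proof.
  intros H r Hr. set (r' := (r + 1) / 2).
  assert (Hr' : 0 < r' < 1 /\ r < r') by (unfold r'; lra).
  destruct (H r') as [M HM]; [lra|].
  destruct (INR_pow_bounded (r / r')) as [M' HM'].
  { split; [apply Rdiv_lt_0_compat; lra|]. apply (Rmult_lt_reg_r r'); [lra|].
    replace (r / r' * r') with r by (field; lra). lra. }
  exists (M * M'). intros n.
  rewrite Cmod_mult, Cmod_R, Rabs_pos_eq by apply pos_INR.
  replace (INR n * Cmod (u n) * r ^ n) with ((Cmod (u n) * r' ^ n) * (INR n * (r / r') ^ n)).
  - apply Rmult_le_compat; auto.
    + apply Rmult_le_pos; [apply Cmod_ge_0 | apply pow_le; lra].
    + apply Rmult_le_pos; [apply pos_INR | apply pow_le; left; apply Rdiv_lt_0_compat; lra].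
  - unfold Rdiv. rewrite Rpow_mult_distr, pow_inv by lra. field. apply pow_nonzero; lra.
Qed.

Lemma radius_ge1_plus (u v : nat -> C) :
  radius_ge1 u -> radius_ge1 v -> radius_ge1 (fun n => u n + v n)%C.
Proof.
  intros Hu Hv r Hr. destruct (Hu r Hr) as [M HM], (Hv r Hr) as [M' HM'].
  exists (M + M'). intros n. specialize (HM n); specialize (HM' n).
  assert (0 < r ^ n) by (apply pow_lt; lra).
  pose proof (Cmod_triangle (u n) (v n)). nra.
Qed.

Lemma radius_ge1_scal (c : C) (u : nat -> C) :
  radius_ge1 u -> radius_ge1 (fun n => c * u n)%C.
Proof.
  intros Hu r Hr. destruct (Hu r Hr) as [M HM].
  exists (Cmod c * M). intros n. rewrite Cmod_mult, Rmult_assoc.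
  apply Rmult_le_compat_l; [apply Cmod_ge_0 | apply HM].
Qed.

Lemma CPS_plus (u v : nat -> C) w : radius_ge1 u -> radius_ge1 v -> Rabs w < 1 ->
  CPS (fun n => u n + v n)%C w = (CPS u w + CPS v w)%C.
Proof.
  intros Hu Hv Hw. apply injective_projections; simpl.
  - rewrite <- PSeries_plus by (apply CV_radius_inside; now apply radius_ge1_Re). reflexivity.
  - rewrite <- PSeries_plus by (apply CV_radius_inside; now apply radius_ge1_Im). reflexivity.
Qed.

Lemma CPS_scal (c : C) (u : nat -> C) w : radius_ge1 u -> Rabs w < 1 ->
  CPS (fun n => c * u n)%C w = (c * CPS u w)%C.
Proof.
  intros Hu Hw. pose proof (CV_radius_inside _ _ (radius_ge1_Re u w Hu Hw)) as H1.
  pose proof (CV_radius_inside _ _ (radius_ge1_Im u w Hu Hw)) as H2.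
  apply injective_projections; simpl.
  - rewrite <- !PSeries_scal, <- PSeries_minus; try (apply ex_pseries_scal; auto; apply Rmult_comm).
    reflexivity.
  - rewrite <- !PSeries_scal, <- PSeries_plus; try (apply ex_pseries_scal; auto; apply Rmult_comm).
    reflexivity.
Qed.

Lemma CPS_ext (u v : nat -> C) w : (forall n, u n = v n) -> CPS u w = CPS v w.
Proof.
  intros H. unfold CPS. f_equal; apply PSeries_ext; intros n; now rewrite H.
Qed.

Lemma CPS_incr (u v : nat -> C) w :
  v O = 0%C -> (forall n, v (S n) = u n) -> CPS v w = (RtoC w * CPS u w)%C.
Proof.
  intros H0 HS. apply injective_projections; simpl.
  - rewrite Rmult_0_l, Rminus_0_r, <- PSeries_incr_1. apply PSeries_ext.
    intros [|n]; simpl; [now rewrite H0 | now rewrite HS].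
  - rewrite Rmult_0_l, Rplus_0_r, <- PSeries_incr_1. apply PSeries_ext.
    intros [|n]; simpl; [now rewrite H0 | now rewrite HS].
Qed.

Lemma CPS_0 (u : nat -> C) : CPS u 0 = u O.
Proof. unfold CPS. rewrite !PSeries_0. now destruct (u O). Qed.

Lemma is_deriveC_CPS (u : nat -> C) w : radius_ge1 u -> Rabs w < 1 ->
  is_deriveC (CPS u) w (CPS (fun n => RtoC (INR (S n)) * u (S n))%C w).
Proof.
  intros Hu Hw. apply is_deriveC_Re_Im. split.
  - eapply is_deriveR_eq; [apply is_derive_PSeries; now apply radius_ge1_Re|].
    apply PSeries_ext. intros n. unfold PS_derive, Re. simpl. ring.
  - eapply is_deriveR_eq; [apply is_derive_PSeries; now apply radius_ge1_Im|].
    apply PSeries_ext. intros n. unfold PS_derive, Im. simpl. ring.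
Qed.

(** The operator theta = w d/dw is diagonal on coefficients, so recurrences translate into
    differential equations without shifting indices. *)
Lemma is_deriveC_CPS_theta (u : nat -> C) w : radius_ge1 u -> 0 < w < 1 ->
  is_deriveC (CPS u) w (CPS (fun n => RtoC (INR n) * u n)%C w / RtoC w)%C.
Proof.
  intros Hu Hw. eapply is_deriveC_eq.
  - apply is_deriveC_CPS; auto. rewrite Rabs_pos_eq; lra.
  - rewrite (CPS_incr (fun n => RtoC (INR (S n)) * u (S n))%C (fun n => RtoC (INR n) * u n)%C).
    + field. intros E; inversion E; lra.
    + simpl. ring.
    + reflexivity.
Qed.

Lemma is_series_CPS (u : nat -> C) w : radius_ge1 u -> Rabs w < 1 ->
  is_series (V := C_R_NormedModule) (fun n => u n * RtoC (w ^ n))%C (CPS u w).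
Proof.
  intros Hu Hw.
  assert (Hs : forall n, sum_n (G := C_R_NormedModule) (fun n => u n * RtoC (w ^ n))%C n =
    (sum_n (fun k => scal (w ^ k) (Re (u k))) n, sum_n (fun k => scal (w ^ k) (Im (u k))) n)).
  { induction n as [|n IH].
    - rewrite !sum_O. apply injective_projections; simpl; unfold scal; simpl; unfold mult; simpl;
      unfold Re, Im; ring.
    - rewrite !sum_Sn, IH. apply injective_projections; simpl; unfold plus, scal; simpl;
      unfold mult; simpl; unfold Re, Im; ring. }
  pose proof (PSeries_correct _ _ (CV_radius_inside _ _ (radius_ge1_Re u w Hu Hw))) as H1.
  pose proof (PSeries_correct _ _ (CV_radius_inside _ _ (radius_ge1_Im u w Hu Hw))) as H2.
  unfold is_pseries, is_series in *.
  apply (proj2 (filterlim_locally (U := C_R_CompleteNormedModule) _ _)). intros eps.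
  pose proof (proj1 (filterlim_locally _ _) H1 eps) as K1.
  pose proof (proj1 (filterlim_locally _ _) H2 eps) as K2.
  generalize (filter_and _ _ K1 K2). apply filter_imp. intros n [B1 B2].
  rewrite Hs. split.
  - eapply (eq_ind _ (fun v => ball _ eps v)); [exact B1|].
    apply sum_n_ext. intros k. now rewrite pow_n_pow.
  - eapply (eq_ind _ (fun v => ball _ eps v)); [exact B2|].
    apply sum_n_ext. intros k. now rewrite pow_n_pow.
Qed.

(** * The hypergeometric coefficients and the hypergeometric equation *)

Definition hypcoef (a b c : C) (n : nat) : C :=
  (pochhammer a n * pochhammer b n / pochhammer c n / RtoC (INR (fact n)))%C.

Lemma Cplus_INR_nonzero (c : C) n : 0 < Re c -> (c + RtoC (INR n))%C <> 0%C.
Proof.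
  intros Hc E. apply (f_equal Re) in E. simpl in E. unfold Re in *. pose proof (pos_INR n). lra.
Qed.

Lemma pochhammer_nonzero (c : C) n : 0 < Re c -> pochhammer c n <> 0%C.
Proof.
  intros Hc. induction n as [|n IH]; simpl.
  - intros E; inversion E; lra.
  - apply Cmult_neq_0; auto. now apply Cplus_INR_nonzero.
Qed.

Lemma RtoC_nonzero (x : R) : x <> 0 -> RtoC x <> 0%C.
Proof. intros H E. inversion E. auto. Qed.

Lemma hypcoef_S (a b c : C) n : 0 < Re c ->
  (RtoC (INR (S n)) * (c + RtoC (INR n)) * hypcoef a b c (S n) =
   (a + RtoC (INR n)) * (b + RtoC (INR n)) * hypcoef a b c n)%C.
Proof.
  intros Hc. unfold hypcoef. rewrite fact_simpl, mult_INR, RtoC_mult. simpl pochhammer.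
  field. repeat split; first [now apply pochhammer_nonzero | now apply Cplus_INR_nonzero |
    apply RtoC_nonzero, not_0_INR, fact_neq_0 | apply RtoC_nonzero, not_0_INR; lia].
Qed.

Lemma eventually_bounded (v : nat -> R) (N : nat) :
  (forall n, (N <= n)%nat -> v (S n) <= v n) -> exists M, forall n, v n <= M.
Proof.
  intros H.
  assert (H1 : exists M, forall n, (n <= N)%nat -> v n <= M).
  { clear H. induction N as [|N [M HM]].
    - exists (v O). intros n Hn. replace n with O by lia. lra.
    - exists (Rmax M (v (S N))). intros n Hn. destruct (Nat.eq_dec n (S N)) as [->|Hne].
      + apply Rmax_r.
      + eapply Rle_trans; [apply HM; lia | apply Rmax_l]. }
  destruct H1 as [M HM]. exists M. intros n.
  destruct (Nat.le_ge_cases n N) as [Hn|Hn]; [auto|].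
  induction Hn as [|n Hn IH]; [auto|]. specialize (H n Hn). lra.
Qed.

(** Ratio test: for large n the recurrence gives |u (n+1)| r <= |u n|, because r (|a| + n) (|b| + n)
    <= (n + 1) n. *)
Lemma radius_ge1_hypcoef (a b c : C) : 0 < Re c -> radius_ge1 (hypcoef a b c).
Proof.
  intros Hc r Hr.
  pose proof (Cmod_ge_0 a) as Ha; pose proof (Cmod_ge_0 b) as Hb.
  (* N is large enough for (1 - r) n to dominate all lower-order terms of (|a| + n) (|b| + n). *)
  destruct (archimed_cor1 ((1 - r) / (Cmod a + Cmod b + Cmod a * Cmod b + 1))) as (N & HN & HN0).
  { apply Rdiv_lt_0_compat; nra. }
  apply (eventually_bounded _ N). intros n Hn.
  assert (Hn1 : 1 <= INR n) by (apply (le_INR 1); lia).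
  assert (HK : Cmod a + Cmod b + Cmod a * Cmod b <= (1 - r) * INR n).
  { apply (Rmult_lt_compat_r (INR N * (Cmod a + Cmod b + Cmod a * Cmod b + 1))) in HN.
    2: { apply Rmult_lt_0_compat; [apply lt_0_INR; lia | nra]. }
    replace (/ INR N * _) with (Cmod a + Cmod b + Cmod a * Cmod b + 1) in HN
      by (field; apply not_0_INR; lia).
    replace ((1 - r) / _ * _) with ((1 - r) * INR N) in HN by (field; nra).
    apply le_INR in Hn. nra. }
  pose proof (f_equal Cmod (hypcoef_S a b c n Hc)) as E.
  rewrite !Cmod_mult, Cmod_R, Rabs_pos_eq in E by apply pos_INR.
  assert (H1 : INR n <= Cmod (c + RtoC (INR n))%C).
  { eapply Rle_trans; [|apply re_le_Cmod]. rewrite Rabs_pos_eq; unfold Re in *; simpl; lra. }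
  assert (H2 : Cmod (a + RtoC (INR n))%C <= Cmod a + INR n).
  { eapply Rle_trans; [apply Cmod_triangle|]. rewrite Cmod_R, Rabs_pos_eq; lra. }
  assert (H3 : Cmod (b + RtoC (INR n))%C <= Cmod b + INR n).
  { eapply Rle_trans; [apply Cmod_triangle|]. rewrite Cmod_R, Rabs_pos_eq; lra. }
  assert (H4 : Cmod (a + RtoC (INR n))%C * Cmod (b + RtoC (INR n))%C
      <= (Cmod a + INR n) * (Cmod b + INR n)).
  { apply Rmult_le_compat; auto; apply Cmod_ge_0. }
  set (U := Cmod (hypcoef a b c n)) in *. set (U' := Cmod (hypcoef a b c (S n))) in *.
  assert (HU : 0 <= U) by apply Cmod_ge_0. assert (HU' : 0 <= U') by apply Cmod_ge_0.
  assert (H5 : r * ((Cmod a + INR n) * (Cmod b + INR n)) <= INR (S n) * INR n).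
  { rewrite S_INR.
    assert (r * ((Cmod a + INR n) * (Cmod b + INR n)) <= r * (INR n * INR n) +
      (Cmod a + Cmod b + Cmod a * Cmod b) * INR n); [|nra].
    assert (r * ((Cmod a + Cmod b) * INR n + Cmod a * Cmod b) <= 1 * ((Cmod a + Cmod b + Cmod a * Cmod b) * INR n)).
    { apply Rmult_le_compat; try nra. assert (0 <= Cmod a * Cmod b) by nra. nra. }
    nra. }
  assert (H6 : U' * r <= U).
  { apply (Rmult_le_reg_l (INR (S n) * INR n)).
    { apply Rmult_lt_0_compat; [apply lt_0_INR; lia | lra]. }
    assert (INR (S n) * INR n * U' <= INR (S n) * Cmod (c + RtoC (INR n))%C * U').
    { apply Rmult_le_compat_r; auto. apply Rmult_le_compat_l; auto. apply pos_INR. }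
    assert (INR (S n) * INR n * U' <= (Cmod a + INR n) * (Cmod b + INR n) * U).
    { eapply Rle_trans; [eassumption|]. rewrite E. apply Rmult_le_compat_r; auto. }
    assert (r * ((Cmod a + INR n) * (Cmod b + INR n)) * U <= INR (S n) * INR n * U)
      by (apply Rmult_le_compat_r; auto).
    apply (Rmult_le_compat_l r) in H0; nra. }
  simpl. assert (0 < r ^ n) by (apply pow_lt; lra). nra.
Qed.

(** [hypF], [hypF_theta] and [hypF_theta2] are F, theta F and theta^2 F for theta = w d/dw. *)
Definition hypF (a b c : C) (w : R) : C := CPS (hypcoef a b c) w.
Definition hypF_theta (a b c : C) (w : R) : C :=
  CPS (fun n => RtoC (INR n) * hypcoef a b c n)%C w.
Definition hypF_theta2 (a b c : C) (w : R) : C :=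
  CPS (fun n => RtoC (INR n) * (RtoC (INR n) * hypcoef a b c n))%C w.

Lemma hyp2F1_hypF (a b c : C) w : 0 < Re c -> Rabs w < 1 ->
  hyp2F1 a b c (RtoC w) = hypF a b c w.
Proof.
  intros Hc Hw. unfold hyp2F1, is_series.
  apply (iota_filterlim_locally (V := C_R_CompleteNormedModule)).
  eapply filterlim_ext; [|exact (is_series_CPS _ w (radius_ge1_hypcoef a b c Hc) Hw)].
  intros n. apply (sum_n_ext (G := C_R_NormedModule)). intros k.
  unfold hypcoef. rewrite RtoC_pow.
  (* The equality is stated in the carrier of a normed module; it is retyped so that [field]
     recognises C. *)
  match goal with |- ?x = ?y => change (@eq C x y) end.
  field. split; first [now apply pochhammer_nonzero |
    apply RtoC_nonzero, not_0_INR, fact_neq_0].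
Qed.

(** From (b)_n (b + n) = b (b + 1)_n. This is what collapses the derivative of w^b F(a,b;c;w) to a
    single series. *)
Lemma hypF_theta_contiguous (a b c : C) w : 0 < Re c -> Rabs w < 1 ->
  (hypF_theta a b c w + b * hypF a b c w = b * hypF a (b + 1) c w)%C.
Proof.
  intros Hc Hw. unfold hypF_theta, hypF.
  pose proof (radius_ge1_hypcoef a b c Hc) as H.
  rewrite <- CPS_scal, <- CPS_scal, <- CPS_plus by
    auto using radius_ge1_scal, radius_ge1_INR, radius_ge1_hypcoef.
  apply CPS_ext. intros n. unfold hypcoef.
  assert (E : forall m, (pochhammer b m * (b + RtoC (INR m)) = b * pochhammer (b + 1) m)%C).
  { induction m as [|m IH]; [simpl; ring|].
    change (pochhammer b (S m)) with (pochhammer b m * (b + RtoC (INR m)))%C. rewrite IH.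
    simpl pochhammer. rewrite S_INR, RtoC_plus. ring. }
  transitivity (pochhammer a n * (pochhammer b n * (b + RtoC (INR n))) / pochhammer c n / RtoC (INR (fact n)))%C.
  - unfold Cdiv; ring.
  - rewrite E. unfold Cdiv; ring.
Qed.

(** The equation theta (theta + c - 1) F = w (theta + a) (theta + b) F; comparing coefficients of
    w^(n+1) gives [hypcoef_S]. *)
Lemma hypF_ode (a b c : C) w : 0 < Re c -> Rabs w < 1 ->
  (hypF_theta2 a b c w + (c - 1) * hypF_theta a b c w =
   RtoC w * (hypF_theta2 a b c w + (a + b) * hypF_theta a b c w + a * b * hypF a b c w))%C.
Proof.
  intros Hc Hw. unfold hypF_theta2, hypF_theta, hypF.
  pose proof (radius_ge1_hypcoef a b c Hc) as H0.
  pose proof (radius_ge1_INR _ H0) as H1. pose proof (radius_ge1_INR _ H1) as H2.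
  rewrite <- !CPS_scal, <- !CPS_plus by auto using radius_ge1_scal, radius_ge1_plus.
  apply CPS_incr.
  - simpl. ring.
  - intros n.
    transitivity (RtoC (INR (S n)) * (c + RtoC (INR n)) * hypcoef a b c (S n))%C.
    + rewrite S_INR, RtoC_plus. ring.
    + rewrite hypcoef_S by auto. ring.
Qed.

(** * The Euler transformation with exponent 1/2 *)

(** First-order form of the hypergeometric equation: G is theta F and H is theta G. It is a
    condition on functions over (0,1), so that sqrt (1 - w) F, which is not given as a power series,
    can satisfy it too. *)
Definition hyp_system (a b c : C) (F G : R -> C) : Prop :=
  forall w, 0 < w < 1 ->
    is_deriveC F w (G w / RtoC w)%C /\
    exists H : C, is_deriveC G w (H / RtoC w)%C /\
      (H + (c - 1) * G w = RtoC w * (H + (a + b) * G w + a * b * F w))%C.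

Lemma hyp_system_hypF (a b c : C) : 0 < Re c ->
  hyp_system a b c (hypF a b c) (hypF_theta a b c).
Proof.
  intros Hc w Hw. pose proof (radius_ge1_hypcoef a b c Hc) as H0. split.
  - now apply is_deriveC_CPS_theta.
  - exists (hypF_theta2 a b c w). split.
    + apply is_deriveC_CPS_theta; auto. now apply radius_ge1_INR.
    + apply hypF_ode; auto. rewrite Rabs_pos_eq; lra.
Qed.

Lemma is_deriveC_minus (f g : R -> C) (x : R) (l m : C) :
  is_deriveC f x l -> is_deriveC g x m -> is_deriveC (fun t => f t - g t)%C x (l - m)%C.
Proof. exact (@is_derive_minus R_AbsRing C_R_NormedModule f g x l m). Qed.

Lemma hyp_system_minus (a b c : C) (F G F' G' : R -> C) :
  hyp_system a b c F G -> hyp_system a b c F' G' ->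
  hyp_system a b c (fun w => F w - F' w)%C (fun w => G w - G' w)%C.
Proof.
  intros H H' w Hw. destruct (H w Hw) as (H1 & K & H2 & E).
  destruct (H' w Hw) as (H1' & K' & H2' & E').
  assert (Hw0 : RtoC w <> 0%C) by (apply RtoC_nonzero; lra).
  split.
  - eapply is_deriveC_eq; [apply is_deriveC_minus; eassumption | field; auto].
  - exists (K - K')%C. split.
    + eapply is_deriveC_eq; [apply is_deriveC_minus; eassumption | field; auto].
    + transitivity ((K + (c - 1) * G w) - (K' + (c - 1) * G' w))%C; [ring|].
      rewrite E, E'. ring.
Qed.

Lemma is_derive_sqrt1m (w : R) : w < 1 ->
  is_derive (fun t => sqrt (1 - t)) w (- (sqrt (1 - w) / (2 * (1 - w)))).
Proof.
  intros Hw. eapply is_deriveR_eq.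
  - apply (is_derive_sqrt (fun t => 1 - t) w (0 - 1)); [|lra].
    apply (is_deriveR_minus (fun _ => 1) (fun t => t)).
    + exact (is_derive_const (1 : R_NormedModule) w).
    + exact (is_derive_id w).
  - assert (Hs : 0 < sqrt (1 - w)) by (apply sqrt_lt_R0; lra).
    replace (2 * (1 - w)) with (2 * (sqrt (1 - w) * sqrt (1 - w))) by (rewrite sqrt_sqrt; lra).
    field. lra.
Qed.

Lemma is_derive_half_w_over_1m (w : R) : w < 1 -> is_derive (fun t => t / (2 * (1 - t))) w (1 / (2 * (1 - w) ^ 2)).
Proof.
  intros Hw. eapply is_deriveR_eq.
  - apply (is_derive_div (fun t => t) (fun t => 2 * (1 - t)) w 1 (2 * (0 - 1))).
    + exact (is_derive_id w).
    + apply is_deriveR_scal. apply (is_deriveR_minus (fun _ => 1) (fun t => t)).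
      * exact (is_derive_const (1 : R_NormedModule) w).
      * exact (is_derive_id w).
    + lra.
  - field. lra.
Qed.

(** The exponents at w = 1 are 0 and c - a - b = -1/2. Multiplication by sqrt (1 - w) turns them
    into 1/2 and 0, those of the equation with parameters a - 1/2, b - 1/2, c. The second component
    is theta of the first, as theta sqrt (1 - w) = - w / (2 (1 - w)) sqrt (1 - w). *)
Lemma hyp_system_sqrt (a b c : C) (F G : R -> C) :
  (c = a + b - 1 / 2)%C ->
  hyp_system a b c F G ->
  hyp_system (a - 1 / 2) (b - 1 / 2) c
    (fun w => RtoC (sqrt (1 - w)) * F w)%C
    (fun w => RtoC (sqrt (1 - w)) * (G w - RtoC (w / (2 * (1 - w))) * F w))%C.
Proof.
  intros Hc H w Hw. destruct (H w Hw) as (H1 & K & H2 & E).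
  assert (Hw0 : RtoC w <> 0%C) by (apply RtoC_nonzero; lra).
  assert (Hw1 : (1 - RtoC w)%C <> 0%C).
  { rewrite <- RtoC_minus. apply RtoC_nonzero; lra. }
  (* Solving for theta G lets the final identity be closed by substitution and [field]. *)
  assert (EK : K = (/ (1 - RtoC w) * (RtoC w * ((a + b) * G w + a * b * F w) - (c - 1) * G w))%C).
  { replace (RtoC w * ((a + b) * G w + a * b * F w) - (c - 1) * G w)%C with ((1 - RtoC w) * K)%C.
    - field; auto.
    - transitivity ((K + (c - 1) * G w) - RtoC w * K - (c - 1) * G w)%C; [ring|]. rewrite E. ring. }
  pose proof (is_deriveC_RtoC _ _ _ (is_derive_sqrt1m w ltac:(lra))) as Hs.
  pose proof (is_deriveC_RtoC _ _ _ (is_derive_half_w_over_1m w ltac:(lra))) as Hg.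
  assert (E1 : RtoC (w / (2 * (1 - w))) = (RtoC w / (2 * (1 - RtoC w)))%C).
  { rewrite RtoC_div, RtoC_mult, RtoC_minus by lra. reflexivity. }
  assert (E2 : RtoC (- (sqrt (1 - w) / (2 * (1 - w)))) = (- (RtoC (sqrt (1 - w)) / (2 * (1 - RtoC w))))%C).
  { rewrite RtoC_opp, RtoC_div, RtoC_mult, RtoC_minus by lra. reflexivity. }
  assert (E3 : RtoC (1 / (2 * (1 - w) ^ 2)) = (1 / (2 * ((1 - RtoC w) * (1 - RtoC w))))%C).
  { rewrite RtoC_div, RtoC_mult, RtoC_pow by (apply Rgt_not_eq; nra). rewrite RtoC_minus. simpl. now rewrite Cmult_1_r. }
  assert (Hw2 : RtoC 2 <> 0%C) by (apply RtoC_nonzero; lra).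
  set (r := RtoC (sqrt (1 - w))) in *. set (W := RtoC w) in *.
  split.
  - eapply is_deriveC_eq; [apply is_deriveC_mult; eassumption|]. cbv beta.
    rewrite E1, E2. fold r. field. auto.
  - exists (r * (K - W / (2 * ((1 - W) * (1 - W))) * F w - W / (2 * (1 - W)) * G w
          - W / (2 * (1 - W)) * (G w - W / (2 * (1 - W)) * F w)))%C. split.
    + eapply is_deriveC_eq.
      { apply is_deriveC_mult; [eassumption|]. apply is_deriveC_minus; [eassumption|].
        apply is_deriveC_mult; eassumption. }
      cbv beta. rewrite E1, E2, E3. fold r. field. auto.
    + rewrite E1, EK, Hc. field. auto.
Qed.

Lemma Cmod_Re_conj_mult (x y : C) : 2 * (Re x * Re y + Im x * Im y) <= 2 * (Cmod x * Cmod y).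
Proof.
  pose proof (re_le_Cmod (Cconj x * y)%C) as H.
  rewrite Cmod_mult, Cmod_conj in H. unfold Re, Im in *; simpl in *.
  pose proof (Rle_abs (fst x * fst y - - snd x * snd y)). lra.
Qed.

Lemma is_derive_Cmod_sqr (f : R -> C) (x : R) (l : C) :
  is_deriveC f x l ->
  is_derive (fun t => Cmod (f t) ^ 2) x (2 * (Re (f x) * Re l + Im (f x) * Im l)).
Proof.
  rewrite is_deriveC_Re_Im. intros [H1 H2].
  apply (is_derive_ext (fun t => Re (f t) * Re (f t) + Im (f t) * Im (f t))).
  { intros t. symmetry. apply Cmod_sqr. }
  eapply is_deriveR_eq.
  - apply is_deriveR_plus; apply is_deriveR_mult; eassumption.
  - cbv beta. ring.
Qed.

(* With N = |F|^2 + |G|^2 the system gives w N' <= N + K w N, because the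
   singular coefficient 1 - c has nonpositive real part; hence exp(-K w) N / w is
   nonincreasing, and it tends to 0 at the origin. *)
Lemma hyp_system_zero (a b c : C) (F G : R -> C) (L d : R) :
  1 <= Re c -> hyp_system a b c F G -> 0 < d ->
  (forall w, 0 < w < d -> Cmod (F w) <= L * w /\ Cmod (G w) <= L * w) ->
  forall w, 0 < w < 1 -> F w = 0%C.
Proof.
  intros Hc H Hd H0 w0 Hw0.
  set (N := fun w => Cmod (F w) ^ 2 + Cmod (G w) ^ 2).
  (* The coefficients are those of [Y] below, the regular part of theta G; the denominator uses 1 /
     (1 - w) <= 1 / (1 - w0) on (0, w0]. *)
  set (K := 2 * (Cmod (a + b)%C + Cmod (a * b)%C + Cmod (c - 1)%C) / (1 - w0)).
  set (h := fun w => N w * (/ w * exp (- K * w))).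
  assert (HK0 : 0 <= Cmod (a + b)%C + Cmod (a * b)%C + Cmod (c - 1)%C).
  { pose proof (Cmod_ge_0 (a + b)%C); pose proof (Cmod_ge_0 (a * b)%C);
    pose proof (Cmod_ge_0 (c - 1)%C); lra. }
  assert (Hder : forall w, 0 < w <= w0 -> exists N',
     is_derive h w (N' * (/ w * exp (- K * w)) +
        N w * (- / (w * w) * exp (- K * w) + / w * (- K * exp (- K * w)))) /\
     w * N' <= N w + K * w * N w).
  { intros w Hw. destruct (H w) as (H1 & X & H2 & E); [lra|].
    exists (2 * (Re (F w) * Re (G w / RtoC w)%C + Im (F w) * Im (G w / RtoC w)%C)
          + 2 * (Re (G w) * Re (X / RtoC w)%C + Im (G w) * Im (X / RtoC w)%C)).
    split.
    - apply (is_deriveR_mult N (fun t => / t * exp (- K * t))).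
      + apply (is_deriveR_plus (fun t => Cmod (F t) ^ 2) (fun t => Cmod (G t) ^ 2));
          now apply is_derive_Cmod_sqr.
      + apply (is_deriveR_mult (fun t => / t) (fun t => exp (- K * t))).
        * eapply is_deriveR_eq; [apply (is_derive_inv (fun t => t) w 1)|].
          { exact (is_derive_id w). } { lra. } field; lra.
        * eapply is_deriveR_eq;
            [apply (is_deriveR_comp exp (fun t => - K * t) w (exp (- K * w)) (- K * 1))|ring].
          { apply (is_derive_exp (- K * w)). } apply is_deriveR_scal. exact (is_derive_id w).
    - assert (Hdiv : forall z : C, Re (z / RtoC w)%C = Re z / w /\ Im (z / RtoC w)%C = Im z / w).
      { intros z. unfold Re, Im; simpl; split; field; lra. }
      rewrite !(proj1 (Hdiv _)), !(proj2 (Hdiv _)).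
      replace (w * _) with (2 * (Re (F w) * Re (G w) + Im (F w) * Im (G w))
        + 2 * (Re (G w) * Re X + Im (G w) * Im X)) by (field; lra).
      assert (Hw1 : (1 - RtoC w)%C <> 0%C).
      { rewrite <- RtoC_minus. apply RtoC_nonzero; lra. }
      set (Y := ((a + b) * G w + a * b * F w - (c - 1) * G w)%C).
      (* Splits theta G into the singular part - (c - 1) G and a regular part carrying a factor
         w. *)
      assert (EX : X = (RtoC (w / (1 - w)) * Y - (c - 1) * G w)%C).
      { rewrite RtoC_div, RtoC_minus by lra.
        replace X with (/ (1 - RtoC w) * ((X + (c - 1) * G w) - RtoC w * X - (c - 1) * G w))%C
          by (field; auto).
        rewrite E. unfold Y. field. auto. }
      assert (HY : Cmod Y <= Cmod (a + b)%C * Cmod (G w) + Cmod (a * b)%C * Cmod (F w)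
                      + Cmod (c - 1)%C * Cmod (G w)).
      { unfold Y. eapply Rle_trans; [apply Cmod_triangle|]. rewrite Cmod_opp, <- !Cmod_mult.
        apply Rplus_le_compat_r. apply Cmod_triangle. }
      pose proof (Cmod_Re_conj_mult (F w) (G w)) as P1.
      pose proof (Cmod_Re_conj_mult (G w) Y) as P2.
      assert (EXr : 2 * (Re (G w) * Re X + Im (G w) * Im X) =
         w / (1 - w) * (2 * (Re (G w) * Re Y + Im (G w) * Im Y))
         - 2 * (Re c - 1) * Cmod (G w) ^ 2).
      { rewrite Cmod_sqr, EX. unfold Re, Im; simpl. ring. }
      rewrite EXr. unfold N.
      pose proof (Cmod_ge_0 (F w)) as HF. pose proof (Cmod_ge_0 (G w)) as HG.
      set (f := Cmod (F w)) in *. set (g := Cmod (G w)) in *.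
      assert (Hwr : w / (1 - w) <= w / (1 - w0)).
      { unfold Rdiv. apply Rmult_le_compat_l; [lra|]. apply Rinv_le_contravar; lra. }
      assert (Hwr0 : 0 <= w / (1 - w)) by (apply Rle_div_r; lra).
      assert (Q1 : 2 * (g * Cmod Y) <= 2 * (Cmod (a + b)%C + Cmod (a * b)%C + Cmod (c - 1)%C) * (f ^ 2 + g ^ 2)).
      { pose proof (Cmod_ge_0 (a + b)%C); pose proof (Cmod_ge_0 (a * b)%C);
        pose proof (Cmod_ge_0 (c - 1)%C).
        assert (g * Cmod Y <= g * (Cmod (a + b)%C * g + Cmod (a * b)%C * f
                      + Cmod (c - 1)%C * g)) by (apply Rmult_le_compat_l; auto).
        assert (g * f <= f ^ 2 + g ^ 2) by nra. assert (g * g <= f ^ 2 + g ^ 2) by nra.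
        assert (Cmod (a * b)%C * (g * f) <= Cmod (a * b)%C * (f ^ 2 + g ^ 2)) by (apply Rmult_le_compat_l; auto).
        assert (Cmod (a + b)%C * (g * g) <= Cmod (a + b)%C * (f ^ 2 + g ^ 2)) by (apply Rmult_le_compat_l; auto).
        assert (Cmod (c - 1)%C * (g * g) <= Cmod (c - 1)%C * (f ^ 2 + g ^ 2)) by (apply Rmult_le_compat_l; auto).
        lra. }
      assert (Q2 : w / (1 - w) * (2 * (Re (G w) * Re Y + Im (G w) * Im Y)) <= K * w * (f ^ 2 + g ^ 2)).
      { apply (Rle_trans _ (w / (1 - w) * (2 * (Cmod (a + b)%C + Cmod (a * b)%C + Cmod (c - 1)%C) * (f ^ 2 + g ^ 2)))).
        - apply Rmult_le_compat_l; lra.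
        - replace (K * w * (f ^ 2 + g ^ 2)) with (w / (1 - w0) * (2 * (Cmod (a + b)%C + Cmod (a * b)%C + Cmod (c - 1)%C) * (f ^ 2 + g ^ 2)))
            by (unfold K; field; lra).
          apply Rmult_le_compat_r; auto. apply Rmult_le_pos; [lra | nra]. }
      assert (Q3 : 2 * (f * g) <= f ^ 2 + g ^ 2) by (pose proof (pow2_ge_0 (f - g)); lra).
      assert (Q4 : 0 <= 2 * (Re c - 1) * g ^ 2) by (apply Rmult_le_pos; [lra | apply pow2_ge_0]).
      lra. }
  assert (Hmono : forall e, 0 < e < w0 -> h w0 <= h e).
  { intros e He.
    destruct (MVT_gen h e w0 (fun w => Derive h w)) as (t & Ht & Et).
    - intros t. rewrite Rmin_left, Rmax_right by lra. intros Ht.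
      destruct (Hder t) as (N' & HN & _); [lra|]. apply Derive_correct. eexists; exact HN.
    - intros t. rewrite Rmin_left, Rmax_right by lra. intros Ht.
      destruct (Hder t) as (N' & HN & _); [lra|]. apply continuity_pt_filterlim.
      refine (@ex_derive_continuous R_AbsRing R_NormedModule _ _ _). eexists; exact HN.
    - rewrite Rmin_left, Rmax_right in Ht by lra.
      destruct (Hder t) as (N' & HN & HN'); [lra|].
      rewrite (is_derive_unique _ _ _ HN) in Et.
      replace (N' * (/ t * exp (- K * t)) +
        N t * (- / (t * t) * exp (- K * t) + / t * (- K * exp (- K * t))))
        with (exp (- K * t) * / (t * t) * (t * N' - (N t + K * t * N t))) in Et by (field; lra).
      assert (0 < exp (- K * t) * / (t * t)).
      { apply Rmult_lt_0_compat; [apply exp_pos|]. apply Rinv_0_lt_compat; nra. }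
      assert (exp (- K * t) * / (t * t) * (t * N' - (N t + K * t * N t)) <= 0) by nra.
      nra. }
  (* The hypothesis at the origin gives N e <= 2 (L e)^2, so dividing by e still leaves a quantity
     that tends to 0. *)
  assert (HL : forall e, 0 < e -> e < w0 -> e < d -> h w0 <= 2 * L ^ 2 * e).
  { intros e He He1 He2. eapply Rle_trans; [apply (Hmono e); lra|].
    unfold h, N. destruct (H0 e) as [A1 A2]; [lra|].
    assert (Hexp : exp (- K * e) <= 1).
    { rewrite <- exp_0.
      destruct (Req_dec (K * e) 0) as [Hz|Hz]; [right; f_equal; lra|].
      left. apply exp_increasing. assert (0 <= K); [|nra].
      unfold K, Rdiv. apply Rmult_le_pos; [lra|]. left; apply Rinv_0_lt_compat; lra. }
    pose proof (Cmod_ge_0 (F e)). pose proof (Cmod_ge_0 (G e)).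
    assert (Cmod (F e) ^ 2 <= (L * e) ^ 2) by (apply pow_incr; lra).
    assert (Cmod (G e) ^ 2 <= (L * e) ^ 2) by (apply pow_incr; lra).
    replace (2 * L ^ 2 * e) with ((2 * (L * e) ^ 2) * (/ e * 1)) by (field; lra).
    assert (0 < / e) by (apply Rinv_0_lt_compat; lra).
    apply Rmult_le_compat.
    - nra.
    - apply Rmult_le_pos; [lra | left; apply exp_pos].
    - lra.
    - apply Rmult_le_compat_l; lra. }
  assert (Hh : h w0 <= 0).
  { apply Rnot_lt_le. intros Hlt.
    assert (HLp : 0 < 2 * L ^ 2 + 1) by nra.
    set (e := Rmin (Rmin (w0 / 2) (d / 2)) (h w0 / (2 * (2 * L ^ 2 + 1)))).
    assert (He : 0 < e).
    { unfold e. repeat apply Rmin_pos; try lra. apply Rdiv_lt_0_compat; lra. }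
    assert (He1 : e <= w0 / 2) by (unfold e; eapply Rle_trans; [apply Rmin_l | apply Rmin_l]).
    assert (He2 : e <= d / 2) by (unfold e; eapply Rle_trans; [apply Rmin_l | apply Rmin_r]).
    assert (He3 : e <= h w0 / (2 * (2 * L ^ 2 + 1))) by (unfold e; apply Rmin_r).
    specialize (HL e He ltac:(lra) ltac:(lra)).
    apply (Rmult_le_compat_l (2 * L ^ 2 + 1)) in He3; [|lra].
    replace ((2 * L ^ 2 + 1) * (h w0 / _)) with (h w0 / 2) in He3 by (field; lra).
    nra. }
  assert (HN0 : N w0 <= 0).
  { unfold h in Hh. assert (0 < / w0 * exp (- K * w0)).
    { apply Rmult_lt_0_compat; [apply Rinv_0_lt_compat; lra | apply exp_pos]. }
    nra. }
  apply Cmod_eq_0. unfold N in HN0. pose proof (Cmod_ge_0 (F w0)).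
  pose proof (pow2_ge_0 (Cmod (G w0))). nra.
Qed.

(** Supplies the first-order vanishing at the origin that [hyp_system_zero] asks for. *)
Lemma is_deriveC_linear_bound (f : R -> C) (l : C) :
  f 0 = 0%C -> is_deriveC f 0 l ->
  exists d, 0 < d /\ forall w, 0 < w < d -> Cmod (f w) <= (Cmod l + 1) * w.
Proof.
  intros H0 H. destruct (proj1 (is_deriveC_eps _ _ _) H 1) as (d & Hd & Hd'); [lra|].
  exists d; split; auto. intros w Hw. specialize (Hd' w).
  rewrite Rminus_0_r, H0, Rabs_pos_eq in Hd' by lra. specialize (Hd' ltac:(lra)).
  replace (f w) with ((f w - 0 - RtoC w * l) + RtoC w * l)%C by ring.
  eapply Rle_trans; [apply Cmod_triangle|]. rewrite Cmod_mult, Cmod_R, Rabs_pos_eq by lra. lra.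
Qed.

Lemma hypF_0 (a b c : C) : hypF a b c 0 = 1%C.
Proof.
  unfold hypF. rewrite CPS_0. unfold hypcoef. simpl.
  apply injective_projections; simpl; field.
Qed.

Lemma hypF_theta_0 (a b c : C) : hypF_theta a b c 0 = 0%C.
Proof. unfold hypF_theta. rewrite CPS_0. simpl. ring. Qed.

Lemma ex_deriveC_hypF (a b c : C) w : 0 < Re c -> Rabs w < 1 ->
  exists l, is_deriveC (hypF a b c) w l.
Proof. intros Hc Hw. eexists. apply is_deriveC_CPS; auto. now apply radius_ge1_hypcoef. Qed.

Lemma ex_deriveC_hypF_theta (a b c : C) w : 0 < Re c -> Rabs w < 1 ->
  exists l, is_deriveC (hypF_theta a b c) w l.
Proof.
  intros Hc Hw. eexists. apply is_deriveC_CPS; auto.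
  now apply radius_ge1_INR, radius_ge1_hypcoef.
Qed.

(** Case c - a - b = -1/2 of F(a,b;c;w) = (1 - w)^(c-a-b) F(c-a,c-b;c;w), with the new parameters in
    the other order. Both sides solve the same system, equal 1 at 0 and have theta-derivative 0
    there, so [hyp_system_zero] applies to their difference. *)
Lemma hypF_euler_half (a b c : C) w : 1 <= Re c -> (c = a + b - 1 / 2)%C -> 0 < w < 1 ->
  (RtoC (sqrt (1 - w)) * hypF a b c w = hypF (a - 1 / 2) (b - 1 / 2) c w)%C.
Proof.
  intros Hc E Hw. assert (Hc0 : 0 < Re c) by lra.
  assert (H10 : Rabs 0 < 1) by (rewrite Rabs_R0; lra).
  destruct (ex_deriveC_hypF a b c 0 Hc0 H10) as [l1 D1].
  destruct (ex_deriveC_hypF_theta a b c 0 Hc0 H10) as [l2 D2].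
  destruct (ex_deriveC_hypF (a - 1 / 2) (b - 1 / 2) c 0 Hc0 H10) as [l3 D3].
  destruct (ex_deriveC_hypF_theta (a - 1 / 2) (b - 1 / 2) c 0 Hc0 H10) as [l4 D4].
  pose proof (is_deriveC_RtoC _ _ _ (is_derive_sqrt1m 0 ltac:(lra))) as Ds.
  pose proof (is_deriveC_RtoC _ _ _ (is_derive_half_w_over_1m 0 ltac:(lra))) as Dg.
  pose proof (is_deriveC_minus _ _ _ _ _ (is_deriveC_mult _ _ _ _ _ Ds D1) D3) as DF.
  pose proof (is_deriveC_minus _ _ _ _ _ (is_deriveC_mult _ _ _ _ _ Ds
     (is_deriveC_minus _ _ _ _ _ D2 (is_deriveC_mult _ _ _ _ _ Dg D1))) D4) as DG.
  cbv beta in DF, DG.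
  assert (S1 : sqrt (1 - 0) = 1) by (rewrite Rminus_0_r; apply sqrt_1).
  match type of DF with is_derive ?f _ _ => assert (F0 : f 0 = 0%C) end.
  { cbv beta. rewrite !hypF_0, S1. ring. }
  match type of DG with is_derive ?f _ _ => assert (G0 : f 0 = 0%C) end.
  { cbv beta. rewrite !hypF_theta_0, hypF_0, S1. unfold Rdiv. rewrite Rmult_0_l. ring. }
  destruct (is_deriveC_linear_bound _ _ F0 DF) as (d1 & Hd1 & B1).
  destruct (is_deriveC_linear_bound _ _ G0 DG) as (d2 & Hd2 & B2).
  (* The two linear bounds carry different constants, read off from their types; L = k1 + k2 + 1
     serves for both components. *)
  match type of B1 with forall w, _ -> _ <= (?k1 + 1) * w =>
  match type of B2 with forall w, _ -> _ <= (?k2 + 1) * w =>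
    pose proof (hyp_system_zero (a - 1 / 2) (b - 1 / 2) c _ _ (k1 + k2 + 1) (Rmin d1 d2) Hc
      (hyp_system_minus _ _ _ _ _ _ _ (hyp_system_sqrt a b c _ _ E (hyp_system_hypF a b c Hc0))
        (hyp_system_hypF _ _ c Hc0)) (Rmin_pos _ _ Hd1 Hd2)) as Z;
    assert (Hk1 : 0 <= k1) by apply Cmod_ge_0; assert (Hk2 : 0 <= k2) by apply Cmod_ge_0
  end end.
  cbv beta in Z.
  assert (Z0 : (RtoC (sqrt (1 - w)) * hypF a b c w - hypF (a - 1 / 2) (b - 1 / 2) c w = 0)%C).
  { apply Z; auto. intros v Hv.
    pose proof (Rmin_l d1 d2); pose proof (Rmin_r d1 d2).
    specialize (B1 v ltac:(lra)); specialize (B2 v ltac:(lra)). cbv beta in B1, B2. split.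
    - eapply Rle_trans; [exact B1|]. nra.
    - eapply Rle_trans; [exact B2|]. nra. }
  replace (RtoC (sqrt (1 - w)) * hypF a b c w)%C with
    ((RtoC (sqrt (1 - w)) * hypF a b c w - hypF (a - 1 / 2) (b - 1 / 2) c w)
      + hypF (a - 1 / 2) (b - 1 / 2) c w)%C by ring.
  rewrite Z0. ring.
Qed.

(** * The profile functions *)

Lemma R_complete_lim_full (F : (R -> Prop) -> Prop) : (forall A, F A) -> R_complete_lim F = 0.
Proof.
  intros H. unfold R_complete_lim.
  rewrite (is_lub_Rbar_unique _ p_infty); [reflexivity|].
  split; [intros x _; exact I|].
  intros [b| |] Hb; simpl; auto.
  - specialize (Hb (b + 1) (H _)). simpl in Hb. lra.
  - exact (Hb 0 (H _)).
Qed.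

(* [iota] of an empty predicate is the limit of the improper filter, which is 0. *)
Lemma iota_empty (P : C -> Prop) :
  (forall x, ~ P x) -> iota (T := C_R_CompleteNormedModule) P = RtoC 0.
Proof.
  intros H. unfold iota.
  apply injective_projections; simpl; apply R_complete_lim_full; intros A x Hx; now destruct (H x).
Qed.

(** If [P] is empty so is [P'], and both sides take the default value 0, which is real. *)
Lemma Cconj_iota (P P' : C -> Prop) :
  (forall x y, P x -> P y -> x = y) -> (forall x, P x <-> P' (Cconj x)) ->
  Cconj (iota (T := C_R_CompleteNormedModule) P) = iota (T := C_R_CompleteNormedModule) P'.
Proof.
  intros Hu HP. destruct (classic (exists x, P x)) as [[x Hx]|Hn].
  - rewrite (iota_unique (V := C_R_CompleteNormedModule) P x); [|intros; now apply Hu|auto].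
    symmetry. apply (iota_unique (V := C_R_CompleteNormedModule)).
    + intros y Hy. rewrite <- (Cconj_conj y) in Hy |- *. f_equal. apply Hu; auto. now apply HP.
    + now apply HP.
  - rewrite !iota_empty.
    + apply injective_projections; simpl; ring.
    + intros x Hx. apply Hn. exists (Cconj x). apply HP. now rewrite Cconj_conj.
    + intros x Hx. apply Hn. now exists x.
Qed.

Lemma is_RInt_Cconj (f : R -> C) a b (l : C) :
  is_RInt (V := C_R_NormedModule) f a b l ->
  is_RInt (V := C_R_NormedModule) (fun t => Cconj (f t)) a b (Cconj l).
Proof.
  intros H. apply (is_RInt_fct_extend_pair (U := R_NormedModule) (V := R_NormedModule)).
  - exact (is_RInt_fct_extend_fst (U := R_NormedModule) (V := R_NormedModule) f a b l H).
  - apply (is_RInt_opp (V := R_NormedModule)).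
    exact (is_RInt_fct_extend_snd (U := R_NormedModule) (V := R_NormedModule) f a b l H).
Qed.

Lemma is_RInt_gen_Cconj (f : R -> C) Fa Fb (l : C) {HFa : Filter Fa} {HFb : Filter Fb} :
  is_RInt_gen (V := C_R_NormedModule) f Fa Fb l ->
  is_RInt_gen (V := C_R_NormedModule) (fun t => Cconj (f t)) Fa Fb (Cconj l).
Proof.
  unfold is_RInt_gen, filterlimi, filter_le, filtermapi. intros H P [eps HP].
  assert (Hl : locally (T := C_R_NormedModule) l (fun y => P (Cconj y))).
  { exists eps. intros y [B1 B2]. apply HP. split; [exact B1|].
    change (Rabs (- snd y - - snd l) < eps). change (Rabs (snd y - snd l) < eps) in B2.
    rewrite <- Rabs_Ropp. now replace (- (- snd y - - snd l)) with (snd y - snd l) by ring. }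
  generalize (H _ Hl). apply filter_imp. intros ab (y & Hy & HPy).
  exists (Cconj y); split; auto. now apply is_RInt_Cconj.
Qed.

(** Conjugation maps the integrand at s to the one at the conjugate of s; by [Cconj_iota] the
    identity holds whether or not the integral converges. *)
Lemma CGamma_conj (s : C) : Cconj (CGamma s) = CGamma (Cconj s).
Proof.
  assert (E : forall s t, Cconj (Rcpow t (s - 1) * RtoC (exp (- t)))%C =
                    (Rcpow t (Cconj s - 1) * RtoC (exp (- t)))%C).
  { intros s' t. rewrite Cmult_conj, Rcpow_conj, Cminus_conj.
    f_equal; [do 2 f_equal|]; apply injective_projections; simpl; ring. }
  assert (H : forall s l, is_RInt_gen (V := C_R_CompleteNormedModule)
       (fun t : R => (Rcpow t (s - 1) * RtoC (exp (- t)))%C) (at_right 0) (Rbar_locally p_infty) l ->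
     is_RInt_gen (V := C_R_CompleteNormedModule)
       (fun t : R => (Rcpow t (Cconj s - 1) * RtoC (exp (- t)))%C) (at_right 0)
       (Rbar_locally p_infty) (Cconj l)).
  { intros s' l Hl. apply is_RInt_gen_Cconj in Hl; try typeclasses eauto.
    revert Hl. apply is_RInt_gen_ext. apply filter_forall. intros ab t _. apply E. }
  unfold CGamma, RInt_gen. apply Cconj_iota.
  - intros x y Hx Hy. apply is_RInt_gen_unique in Hx, Hy. congruence.
  - intros x. split; [apply H|]. intros Hx. apply H in Hx.
    now rewrite !Cconj_conj in Hx.
Qed.

Lemma Cinv_conj_total (z : C) : Cconj (/ z) = (/ Cconj z)%C.
Proof.
  apply injective_projections; simpl.
  - f_equal. f_equal. ring.
  - unfold Rdiv. rewrite Ropp_involutive. replace (- snd z * (- snd z * 1)) with (snd z * (snd z * 1)) by ring. ring.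
Qed.

Lemma Cinv_0 : (/ 0)%C = 0%C.
Proof. apply injective_projections; simpl; unfold Rdiv; ring. Qed.

Lemma RtoC_conj (x : R) : Cconj (RtoC x) = RtoC x.
Proof. apply injective_projections; simpl; ring. Qed.

Lemma pochhammer_conj (a : C) n : Cconj (pochhammer a n) = pochhammer (Cconj a) n.
Proof.
  induction n as [|n IH]; simpl; [apply RtoC_conj|].
  now rewrite Cmult_conj, Cplus_conj, RtoC_conj, IH.
Qed.

Lemma hypF_conj (a b c : C) w : Cconj (hypF a b c w) = hypF (Cconj a) (Cconj b) (Cconj c) w.
Proof.
  assert (E : forall n, hypcoef (Cconj a) (Cconj b) (Cconj c) n = Cconj (hypcoef a b c n)).
  { intros n. unfold hypcoef, Cdiv.
    now rewrite !Cmult_conj, !Cinv_conj_total, !pochhammer_conj, RtoC_conj. }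
  unfold hypF. rewrite (CPS_ext _ _ w E). unfold CPS, Cconj; simpl. f_equal.
  rewrite <- PSeries_opp. reflexivity.
Qed.

Lemma hypF_sym (a b c : C) w : hypF a b c w = hypF b a c w.
Proof. apply CPS_ext. intros n. unfold hypcoef, Cdiv. ring. Qed.

(** * The shape w^b F(a,b;c;w) shared by both profiles *)

Definition hprofile (a b c : C) (w : R) : C := (Rcpow w b * hypF a b c w)%C.
Definition dhprofile (a b c : C) (w : R) : C :=
  (b / RtoC w * (Rcpow w b * hypF a (b + 1) c w))%C.

(** In phi and in phi_star alike, the exponent of w equals the second hypergeometric parameter;
    hence theta acts on the series as theta + b, and [hypF_theta_contiguous] applies. *)
Lemma is_deriveC_hprofile (a b c : C) w : 0 < Re c -> 0 < w < 1 ->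
  is_deriveC (hprofile a b c) w (dhprofile a b c w).
Proof.
  intros Hc Hw. unfold hprofile, dhprofile.
  destruct (hyp_system_hypF a b c Hc w Hw) as [H _].
  assert (Hw0 : RtoC w <> 0%C) by (apply RtoC_nonzero; lra).
  eapply is_deriveC_eq.
  - apply is_deriveC_mult; [apply is_deriveC_Rcpow; lra | exact H].
  - cbv beta. transitivity (/ RtoC w * Rcpow w b * (hypF_theta a b c w + b * hypF a b c w))%C.
    + field. auto.
    + rewrite hypF_theta_contiguous by (auto; rewrite Rabs_pos_eq; lra). field. auto.
Qed.

Lemma hypF_bounded (a b c : C) w0 : 0 < Re c -> 0 <= w0 < 1 ->
  exists M, 0 <= M /\ forall w, 0 <= w <= w0 -> Cmod (hypF a b c w) <= M.
Proof.
  intros Hc Hw0.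
  destruct (bounded_continuity (V := C_R_NormedModule) (hypF a b c) 0 w0) as [M HM].
  - intros w Hw. destruct (ex_deriveC_hypF a b c w Hc) as [l Hl].
    + rewrite Rabs_pos_eq; lra.
    + apply (ex_derive_continuous (V := C_R_NormedModule)). now exists l.
  - assert (H : forall w, 0 <= w <= w0 -> Cmod (hypF a b c w) < M).
    { intros w Hw. rewrite Cmod_norm. exact (HM w Hw). }
    exists M; split.
    + pose proof (H 0 ltac:(lra)). pose proof (Cmod_ge_0 (hypF a b c 0)). lra.
    + intros w Hw. left. now apply H.
Qed.

(** Decay is measured in powers of sqrt w because sqrt w = sqrt D y / |q|, which turns it into
    integral powers of |q|. *)
Lemma Cmod_Rcpow_le (w : R) (b : C) (j : nat) :
  0 < w <= 1 -> INR j / 2 <= Re b -> Cmod (Rcpow w b) <= sqrt w ^ j.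
Proof.
  intros Hw Hb. rewrite Cmod_Rcpow, <- Rpower_pow by (apply sqrt_lt_R0; lra).
  rewrite <- Rpower_sqrt, Rpower_mult by lra. unfold Rpower.
  assert (Hln : ln w <= 0).
  { rewrite <- ln_1. destruct (Req_dec w 1) as [->|]; [lra | left; apply ln_increasing; lra]. }
  assert (H : Re b * ln w <= / 2 * INR j * ln w) by nra.
  destruct H as [H|H]; [left; now apply exp_increasing | rewrite H; lra].
Qed.

(** The series are continuous, hence bounded, on [0, w0]; w0 < 1 keeps away from the possible
    singularity at 1. The derivative is weighted by w since it will be multiplied by dw = O(w). *)
Lemma hprofile_bounds (a b c : C) (w0 : R) (j : nat) :
  0 < Re c -> 0 <= w0 < 1 -> INR j / 2 <= Re b ->
  exists M, 0 <= M /\ forall w, 0 < w <= w0 ->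
    Cmod (hprofile a b c w) <= M * sqrt w ^ j /\ Cmod (dhprofile a b c w) * w <= M * sqrt w ^ j.
Proof.
  intros Hc Hw0 Hb.
  destruct (hypF_bounded a b c w0 Hc Hw0) as (M1 & HM1 & H1).
  destruct (hypF_bounded a (b + 1) c w0 Hc Hw0) as (M2 & HM2 & H2).
  pose proof (Cmod_ge_0 b) as Hb0.
  exists (M1 + Cmod b * M2). split; [nra|]. intros w Hw.
  pose proof (Cmod_Rcpow_le w b j ltac:(lra) Hb) as HR.
  pose proof (Cmod_ge_0 (Rcpow w b)) as HR0.
  specialize (H1 w ltac:(lra)). specialize (H2 w ltac:(lra)).
  pose proof (Cmod_ge_0 (hypF a b c w)). pose proof (Cmod_ge_0 (hypF a (b + 1) c w)).
  assert (Hs : 0 <= sqrt w ^ j) by (apply pow_le, sqrt_pos).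
  unfold hprofile, dhprofile. split.
  - rewrite Cmod_mult.
    assert (Cmod (Rcpow w b) * Cmod (hypF a b c w) <= sqrt w ^ j * M1)
      by (apply Rmult_le_compat; auto).
    assert (0 <= Cmod b * M2 * sqrt w ^ j) by (apply Rmult_le_pos; nra). lra.
  - rewrite !Cmod_mult, Cmod_div, Cmod_R, (Rabs_pos_eq w) by (try (apply RtoC_nonzero); lra).
    replace (_ * w) with (Cmod b * (Cmod (Rcpow w b) * Cmod (hypF a (b + 1) c w))) by (field; lra).
    assert (Cmod (Rcpow w b) * Cmod (hypF a (b + 1) c w) <= sqrt w ^ j * M2)
      by (apply Rmult_le_compat; auto).
    assert (Cmod b * (Cmod (Rcpow w b) * Cmod (hypF a (b + 1) c w)) <= Cmod b * (sqrt w ^ j * M2))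
      by (apply Rmult_le_compat_l; auto).
    assert (0 <= M1 * sqrt w ^ j) by (apply Rmult_le_pos; nra). lra.
Qed.

Definition phi_const (k : Z) (s : C) (D : Z) : C :=
  let h := IZR k / 2 in
  (CGamma (s + RtoC h - RtoC (1/4)) * RtoC (Rpower (IZR D) (h + 1/4))
   / (RtoC 6 * CGamma (RtoC 2 * s) * RtoC (Rpower (4 * PI) (h - 1/4))))%C.

Definition phi_star_const (k : Z) (s : C) (D : Z) : C :=
  let h := IZR k / 2 in
  (CGamma (s + RtoC h - RtoC (1/4)) * RtoC (Rpower (4 * PI * IZR D) (3/4 - h))
   / (RtoC 12 * RtoC (sqrt PI) * CGamma (RtoC 2 * s)))%C.

Lemma Rpower_neq_0 (x y : R) : Rpower x y <> 0.
Proof. apply Rgt_not_eq, exp_pos. Qed.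

(** Since (4 pi)^(1/2) = 2 sqrt pi, the factors 6 and 12 sqrt pi and the powers of 4 pi agree; the
    power of D left over is (h + 1/4) - (3/4 - h) = k - 1/2. *)
Lemma phi_const_star (k D : Z) (s : C) : (0 < D)%Z ->
  phi_const k s D = (RtoC (Rpower (IZR D) (IZR k - 1 / 2)) * phi_star_const k s D)%C.
Proof.
  intros HD. apply IZR_lt in HD. unfold phi_const, phi_star_const. cbv zeta.
  set (h := IZR k / 2).
  replace (IZR k - 1 / 2) with (2 * h - 1 / 2) by (unfold h; field).
  (* If [CGamma (2 * s)] were 0, both constants would be 0 by the convention [/ 0 = 0]. *)
  destruct (classic (CGamma (RtoC 2 * s) = 0%C)) as [E|E].
  { rewrite E. unfold Cdiv.
    replace (6 * 0 * Rpower (4 * PI) (h - 1 / 4))%C with (RtoC 0) by ring.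
    replace (12 * sqrt PI * 0)%C with (RtoC 0) by ring. rewrite Cinv_0. ring. }
  pose proof PI_RGT_0 as HPI.
  assert (HsP : 0 < sqrt PI) by (now apply sqrt_lt_R0).
  assert (H1 : Rpower (4 * PI * IZR D) (3 / 4 - h) =
     Rpower (4 * PI) (3 / 4 - h) * Rpower (IZR D) (3 / 4 - h)).
  { symmetry. apply Rpower_mult_distr; lra. }
  assert (H2 : Rpower (4 * PI) (3 / 4 - h) = 2 * sqrt PI * / Rpower (4 * PI) (h - 1 / 4)).
  { rewrite <- Rpower_Ropp. replace (2 * sqrt PI) with (Rpower (4 * PI) (/ 2)).
    - rewrite <- Rpower_plus. f_equal. field.
    - rewrite Rpower_sqrt by lra. rewrite sqrt_mult by lra. f_equal.
      replace 4 with (2 * 2) by ring. apply sqrt_square; lra. }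
  assert (H3 : Rpower (IZR D) (2 * h - 1 / 2) * Rpower (IZR D) (3 / 4 - h) = Rpower (IZR D) (h + 1 / 4)).
  { rewrite <- Rpower_plus. f_equal. field. }
  rewrite H1, H2, <- H3, !RtoC_mult, RtoC_inv by apply Rpower_neq_0.
  assert (RtoC (Rpower (4 * PI) (h - 1 / 4)) <> 0%C) by (apply RtoC_nonzero, Rpower_neq_0).
  assert (RtoC (sqrt PI) <> 0%C) by (apply RtoC_nonzero; lra).
  replace (RtoC 12) with (RtoC 6 * RtoC 2)%C by (rewrite <- RtoC_mult; f_equal; ring).
  assert (RtoC 6 <> 0%C) by (apply RtoC_nonzero; lra).
  assert (RtoC 2 <> 0%C) by (apply RtoC_nonzero; lra).
  field. auto.
Qed.

Lemma Re_2s (s : C) : Re (RtoC 2 * s)%C = 2 * Re s.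
Proof. unfold Re; simpl; ring. Qed.

Lemma phi_hprofile (k D : Z) (s : C) w : 0 < Re s -> 0 < w < 1 ->
  phi k s D w = (phi_const k s D * hprofile (s + RtoC (IZR k / 2) - RtoC (1/4))
     (s - RtoC (IZR k / 2) - RtoC (1/4)) (RtoC 2 * s) w)%C.
Proof.
  intros Hs Hw. unfold phi, phi_const, hprofile. cbv zeta.
  rewrite hyp2F1_hypF; [ring | rewrite Re_2s; lra | rewrite Rabs_pos_eq; lra].
Qed.

Lemma phi_star_hprofile (k D : Z) (s : C) w : 0 < Re s -> 0 < w < 1 ->
  phi_star k s D w = (phi_star_const k s D * hprofile (s - RtoC (IZR k / 2) + RtoC (1/4))
     (s + RtoC (IZR k / 2) - RtoC (3/4)) (RtoC 2 * s) w)%C.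
Proof.
  intros Hs Hw. unfold phi_star, phi_star_const, hprofile. cbv zeta.
  rewrite hyp2F1_hypF; [|rewrite Re_2s; lra | rewrite Rabs_pos_eq; lra].
  replace (RtoC (IZR k / 2) - RtoC (3 / 4) + s)%C with (s + RtoC (IZR k / 2) - RtoC (3 / 4))%C by ring.
  ring.
Qed.

Definition dphi (k : Z) (s : C) (D : Z) (w : R) : C :=
  (phi_const k s D * dhprofile (s + RtoC (IZR k / 2) - RtoC (1/4))
     (s - RtoC (IZR k / 2) - RtoC (1/4)) (RtoC 2 * s) w)%C.

Definition dphi_star (k : Z) (s : C) (D : Z) (w : R) : C :=
  (phi_star_const k s D * dhprofile (s - RtoC (IZR k / 2) + RtoC (1/4))
     (s + RtoC (IZR k / 2) - RtoC (3/4)) (RtoC 2 * s) w)%C.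

Lemma locally_01 (w : R) : 0 < w < 1 -> locally w (fun v => 0 < v < 1).
Proof.
  intros Hw. apply (open_and (fun v => 0 < v) (fun v => v < 1)); auto using open_gt, open_lt.
Qed.

Lemma is_deriveC_phi (k D : Z) (s : C) w : 0 < Re s -> 0 < w < 1 ->
  is_deriveC (phi k s D) w (dphi k s D w).
Proof.
  intros Hs Hw. eapply is_derive_ext_loc.
  - generalize (locally_01 w Hw). apply filter_imp. intros v Hv. symmetry. now apply phi_hprofile.
  - apply is_deriveC_scal. apply is_deriveC_hprofile; auto. rewrite Re_2s; lra.
Qed.

Lemma is_deriveC_phi_star (k D : Z) (s : C) w : 0 < Re s -> 0 < w < 1 ->
  is_deriveC (phi_star k s D) w (dphi_star k s D w).
Proof.
  intros Hs Hw. eapply is_derive_ext_loc.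
  - generalize (locally_01 w Hw). apply filter_imp. intros v Hv. symmetry. now apply phi_star_hprofile.
  - apply is_deriveC_scal. apply is_deriveC_hprofile; auto. rewrite Re_2s; lra.
Qed.

Lemma RtoC_quarters : RtoC (1 / 4) = (1 / 4)%C /\ RtoC (3 / 4) = (3 / 4)%C.
Proof. rewrite !RtoC_div by lra. auto. Qed.

Lemma C_num_nonzero : RtoC 2 <> 0%C /\ RtoC 4 <> 0%C.
Proof. split; apply RtoC_nonzero; lra. Qed.

Lemma Rcpow_shift (w : R) (b : C) (e : R) :
  Rcpow w (b + RtoC e) = (Rcpow w b * RtoC (Rpower w e))%C.
Proof. now rewrite Rcpow_add, Rcpow_RtoC. Qed.

(** The Euler transformation turns F(a,b+1) into the series of phi_star. The constants contribute
    D^(k-1/2) and the exponents of w contribute w^(1/2-k), together (D / w)^(k-1/2). *)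
Lemma dphi_relation (k D : Z) (s : C) w : (0 < D)%Z -> 1 / 2 <= Re s -> 0 < w < 1 ->
  (RtoC (sqrt (1 - w) * w) * dphi k s D w =
   (s - RtoC (IZR k / 2) - RtoC (1/4)) * RtoC (Rpower (IZR D / w) (IZR k - 1/2))
     * phi_star k s D w)%C.
Proof.
  intros HD Hs Hw. rewrite phi_star_hprofile by lra.
  unfold dphi, dhprofile, hprofile. rewrite phi_const_star by auto.
  apply IZR_lt in HD.
  destruct RtoC_quarters as [Eq1 Eq3]. destruct C_num_nonzero as [N2 N4].
  pose proof (hypF_euler_half (s + RtoC (IZR k / 2) - RtoC (1/4))
     (s - RtoC (IZR k / 2) - RtoC (1/4) + 1) (RtoC 2 * s) w) as HE.
  rewrite Re_2s in HE. specialize (HE ltac:(lra)).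
  assert (Ec : (RtoC 2 * s = s + RtoC (IZR k / 2) - RtoC (1/4) +
     (s - RtoC (IZR k / 2) - RtoC (1/4) + 1) - 1 / 2)%C) by (rewrite Eq1; field; auto).
  specialize (HE Ec Hw).
  replace (s + RtoC (IZR k / 2) - RtoC (1 / 4) - 1 / 2)%C with
    (s + RtoC (IZR k / 2) - RtoC (3 / 4))%C in HE by (rewrite Eq1, Eq3; field; auto).
  replace (s - RtoC (IZR k / 2) - RtoC (1 / 4) + 1 - 1 / 2)%C with
    (s - RtoC (IZR k / 2) + RtoC (1 / 4))%C in HE by (rewrite Eq1; field; auto).
  rewrite (hypF_sym (s + RtoC (IZR k / 2) - RtoC (3 / 4))) in HE. rewrite <- HE.
  replace (s + RtoC (IZR k / 2) - RtoC (3 / 4))%C with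
    (s - RtoC (IZR k / 2) - RtoC (1 / 4) + RtoC (IZR k - 1 / 2))%C.
  2: { replace (IZR k - 1 / 2) with (IZR k / 2 + IZR k / 2 - 1 / 4 - 1 / 4) by field.
       replace (3 / 4) with (1 - 1 / 4) by field.
       rewrite !RtoC_minus, RtoC_plus, Eq1. field; auto. }
  rewrite Rcpow_shift.
  assert (EP : Rpower (IZR D) (IZR k - 1 / 2) = Rpower (IZR D / w) (IZR k - 1/2) * Rpower w (IZR k - 1/2)).
  { rewrite Rpower_mult_distr; [f_equal; field; lra | apply Rdiv_lt_0_compat; lra | lra]. }
  rewrite EP, !RtoC_mult.
  assert (RtoC w <> 0%C) by (apply RtoC_nonzero; lra).
  field. auto.
Qed.

(** Mirror image of [dphi_relation]: the same power of D / w now stands on the side of the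
    derivative. *)
Lemma dphi_star_relation (k D : Z) (s : C) w : (0 < D)%Z -> 1 / 2 <= Re s -> 0 < w < 1 ->
  (RtoC (sqrt (1 - w) * w * Rpower (IZR D / w) (IZR k - 1/2)) * dphi_star k s D w =
   (s + RtoC (IZR k / 2) - RtoC (3/4)) * phi k s D w)%C.
Proof.
  intros HD Hs Hw. rewrite phi_hprofile by lra.
  unfold dphi_star, dhprofile, hprofile. rewrite phi_const_star by auto.
  apply IZR_lt in HD.
  destruct RtoC_quarters as [Eq1 Eq3]. destruct C_num_nonzero as [N2 N4].
  pose proof (hypF_euler_half (s - RtoC (IZR k / 2) + RtoC (1/4))
     (s + RtoC (IZR k / 2) - RtoC (3/4) + 1) (RtoC 2 * s) w) as HE.
  rewrite Re_2s in HE. specialize (HE ltac:(lra)).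
  assert (Ec : (RtoC 2 * s = s - RtoC (IZR k / 2) + RtoC (1/4) +
     (s + RtoC (IZR k / 2) - RtoC (3/4) + 1) - 1 / 2)%C) by (rewrite Eq1, Eq3; field; auto).
  specialize (HE Ec Hw).
  replace (s - RtoC (IZR k / 2) + RtoC (1 / 4) - 1 / 2)%C with
    (s - RtoC (IZR k / 2) - RtoC (1 / 4))%C in HE by (rewrite Eq1; field; auto).
  replace (s + RtoC (IZR k / 2) - RtoC (3 / 4) + 1 - 1 / 2)%C with
    (s + RtoC (IZR k / 2) - RtoC (1 / 4))%C in HE by (rewrite Eq1, Eq3; field; auto).
  rewrite (hypF_sym (s - RtoC (IZR k / 2) - RtoC (1 / 4))) in HE. rewrite <- HE.
  replace (Rcpow w (s + RtoC (IZR k / 2) - RtoC (3 / 4)))%C with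
    (Rcpow w (s - RtoC (IZR k / 2) - RtoC (1 / 4)) * RtoC (Rpower w (IZR k - 1 / 2)))%C.
  2: { rewrite <- Rcpow_shift. f_equal.
       replace (IZR k - 1 / 2) with (IZR k / 2 + IZR k / 2 - 1 / 4 - 1 / 4) by field.
       replace (3 / 4) with (1 - 1 / 4) by field.
       rewrite !RtoC_minus, RtoC_plus, Eq1. field; auto. }
  assert (EP : Rpower (IZR D) (IZR k - 1 / 2) = Rpower (IZR D / w) (IZR k - 1/2) * Rpower w (IZR k - 1/2)).
  { rewrite Rpower_mult_distr; [f_equal; field; lra | apply Rdiv_lt_0_compat; lra | lra]. }
  rewrite EP, !RtoC_mult.
  assert (RtoC w <> 0%C) by (apply RtoC_nonzero; lra).
  field. auto.
Qed.

Lemma phi_const_conj (k D : Z) (s : C) : Cconj (phi_const k s D) = phi_const k (Cconj s) D.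
Proof.
  unfold phi_const, Cdiv. cbv zeta.
  now rewrite !Cmult_conj, Cinv_conj_total, !Cmult_conj, !CGamma_conj, Cminus_conj, Cplus_conj,
    Cmult_conj, !RtoC_conj.
Qed.

Lemma phi_star_const_conj (k D : Z) (s : C) :
  Cconj (phi_star_const k s D) = phi_star_const k (Cconj s) D.
Proof.
  unfold phi_star_const, Cdiv. cbv zeta.
  now rewrite !Cmult_conj, Cinv_conj_total, !Cmult_conj, !CGamma_conj, Cminus_conj, Cplus_conj,
    Cmult_conj, !RtoC_conj.
Qed.

Lemma phi_conj (k D : Z) (s : C) w : 0 < Re s -> 0 < w < 1 ->
  Cconj (phi k s D w) = phi k (Cconj s) D w.
Proof.
  intros Hs Hw. rewrite !phi_hprofile by (rewrite ?re_conj; auto).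
  unfold hprofile. rewrite !Cmult_conj, phi_const_conj, Rcpow_conj, hypF_conj.
  now rewrite !Cminus_conj, Cplus_conj, Cmult_conj, !RtoC_conj.
Qed.

Lemma phi_star_conj (k D : Z) (s : C) w : 0 < Re s -> 0 < w < 1 ->
  Cconj (phi_star k s D w) = phi_star k (Cconj s) D w.
Proof.
  intros Hs Hw. rewrite !phi_star_hprofile by (rewrite ?re_conj; auto).
  unfold hprofile. rewrite !Cmult_conj, phi_star_const_conj, Rcpow_conj, hypF_conj.
  now rewrite !Cminus_conj, !Cplus_conj, !Cminus_conj, Cmult_conj, !RtoC_conj.
Qed.

(** * Summability over forms of discriminant D *)

Module DivisorBound.
Import ssreflect ssrfun ssrbool eqtype ssrnat seq div prime zify.

Local Open Scope nat_scope.

(** A divisor d of mn is gcd(d,m) times d / gcd(d,m), a divisor of m times a divisor of n. *)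
Lemma size_divisors_mul m n : 0 < m -> 0 < n ->
  size (divisors (m * n)) <= size (divisors m) * size (divisors n).
Proof.
move=> m0 n0; rewrite -(size_allpairs muln).
apply: uniq_leq_size; first exact: divisors_uniq.
move=> d; rewrite -dvdn_divisors ?muln_gt0 ?m0 // => dmn.
have g0 : 0 < gcdn d m by rewrite gcdn_gt0 m0 orbT.
rewrite -(divnK (dvdn_gcdl d m)) mulnC.
apply: allpairs_f; rewrite -dvdn_divisors // ?dvdn_gcdr //.
rewrite -(dvdn_pmul2l g0) mulnC (divnK (dvdn_gcdl d m)) muln_gcdl dvdn_gcd.
by rewrite dvdn_mulr.
Qed.

Lemma size_divisors_pfactor p e : prime p -> size (divisors (p ^ e)) <= e.+1.
Proof.
move=> pp; have <- : size [seq p ^ i | i <- iota 0 e.+1] = e.+1 by rewrite size_map size_iota.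
apply: uniq_leq_size; first exact: divisors_uniq.
move=> d; rewrite -dvdn_divisors ?expn_gt0 ?prime_gt0 // => /(dvdn_pfactor _ _ pp) [m me ->].
by apply: map_f; rewrite mem_iota.
Qed.

(** The quotient (e+1)^4 / 2^e is largest at e = 5, where it is 40.5; 64 is a convenient bound.
    Small e are computed, and from there on the left side at most doubles at each step. *)
Lemma pow4_le_exp2 e : e.+1 ^ 4 <= 64 * 2 ^ e.
Proof.
case: (leqP e 6) => [|e6]; first by do 7?case: e => [|e] //.
elim: e e6 => // e IH; rewrite ltnS leq_eqVlt => /orP[/eqP <- //|e6].
rewrite [2 ^ _]expnS mulnCA; apply: leq_trans (_ : 2 * e.+1 ^ 4 <= _); last by rewrite leq_mul2l IH.
rewrite (expnM e.+2 2 2) (expnM e.+1 2 2).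
(* Squaring gives 9 u^2 <= 16 v^2, hence u^2 <= 2 v^2. *)
have : 3 * e.+2 ^ 2 <= 4 * e.+1 ^ 2 by rewrite !expnS !expn0; nia.
move: (e.+2 ^ 2) (e.+1 ^ 2) => u v; rewrite !expnS !expn0; nia.
Qed.

(** Peels the full power of p off n at the cost of a factor K. The remaining m has no prime factor
    beyond those of n, and p is no longer among them, so this can be iterated over primes. *)
Lemma divisors_pow4_coprime_part p n K : prime p -> 0 < n ->
  (forall e, e.+1 ^ 4 <= K * p ^ e) ->
  exists m, [/\ 0 < m, coprime p m, m %| n, (p %| n -> m < n) &
   forall L, size (divisors m) ^ 4 <= L * m -> size (divisors n) ^ 4 <= K * L * n].
Proof.
move=> pp n0 HK; have [m co En] := pfactor_coprime pp n0.
have m0 : 0 < m by move: n0; rewrite En muln_gt0 => /andP[].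
exists m; split => //; first by rewrite En dvdn_mulr.
  move=> pn; rewrite [ltnRHS]En -[ltnLHS]muln1 ltn_pmul2l // -(expn0 p) ltn_exp2l ?prime_gt1 //.
  by rewrite logn_gt0 mem_primes pp n0.
move=> L HL; rewrite En.
apply: leq_trans (_ : (size (divisors m) * (logn p n).+1) ^ 4 <= _).
  rewrite leq_exp2r //; apply: leq_trans (size_divisors_mul _ _ m0 _) _.
    by rewrite expn_gt0 prime_gt0.
  by rewrite leq_mul2l size_divisors_pfactor ?orbT.
rewrite expnMn (mulnC K) -mulnA (mulnCA K) mulnA.
by apply: leq_mul => //; rewrite mulnC.
Qed.

(* Since (e+1)^4 <= 16^e, primes p >= 16 cost nothing; each smaller prime costs
   at most the factor 64. *)
Lemma divisors_pow4_large n : 0 < n -> (forall p, prime p -> p %| n -> 16 <= p) ->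
  size (divisors n) ^ 4 <= n.
Proof.
elim/ltn_ind: n => n IH n0 Hp.
have [n1|n1] := leqP n 1.
  by have -> : n = 1 by apply/eqP; rewrite eqn_leq n1 n0.
have pp := pdiv_prime n1; have pn := pdiv_dvd n.
have HK e : e.+1 ^ 4 <= 1 * pdiv n ^ e.
  rewrite mul1n; apply: leq_trans (_ : 16 ^ e <= _).
    by rewrite -[16]/(2 ^ 4) -expnM mulnC expnM leq_exp2r // ltn_expl.
  by case: e => [//|e]; rewrite leq_exp2r // Hp.
have [m [m0 co mn lt H]] := divisors_pow4_coprime_part _ _ 1 pp n0 HK.
rewrite -[leqRHS]mul1n; apply: (H 1); rewrite mul1n; apply: IH => //; first exact: lt.
by move=> p p_pr pm; apply: Hp => //; apply: dvdn_trans mn.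
Qed.

(** All primes dividing n are at least 16 - i. The induction removes the candidate 15 - i, spending
    one factor 64 whether or not it is prime; at i = 16 the condition holds for every n. *)
Lemma divisors_pow4_sieve i n : 0 < n -> (forall p, prime p -> p %| n -> 16 <= p + i) ->
  size (divisors n) ^ 4 <= 64 ^ i * n.
Proof.
elim: i n => [|i IH] n n0 Hp.
  by rewrite mul1n; apply: divisors_pow4_large => // p pp pn; rewrite -(addn0 p) Hp.
have [pp|npp] := boolP (prime (15 - i)).
  have HK e : e.+1 ^ 4 <= 64 * (15 - i) ^ e.
    apply: leq_trans (pow4_le_exp2 e) _; rewrite leq_mul2l /=.
    by case: e => [//|e]; rewrite leq_exp2r // prime_gt1.
  have [m [m0 co mn lt H]] := divisors_pow4_coprime_part _ _ _ pp n0 HK.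
  rewrite [64 ^ _]expnS; apply: (H (64 ^ i)); apply: IH => // p p_pr pm.
  have := Hp p p_pr (dvdn_trans pm mn).
  have : p != 15 - i.
    apply: contraL pm => /eqP ->; rewrite -prime_coprime //.
  lia.
rewrite [64 ^ _]expnS -mulnA; apply: leq_trans (_ : 64 ^ i * n <= _); last by rewrite leq_pmull.
apply: IH => // p p_pr pn; have := Hp p p_pr pn.
have : p != 15 - i by apply: contraNneq npp => <-.
have := prime_gt1 p_pr.
lia.
Qed.

Lemma divisors_pow4 n : 0 < n -> size (divisors n) ^ 4 <= 64 ^ 16 * n.
Proof. by move=> n0; apply: divisors_pow4_sieve => // p _ _; rewrite leq_addl. Qed.

Lemma In_divisors (d n : nat) : 0 < n -> Nat.divide d n -> List.In d (divisors n).
Proof.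
move=> n0 [q E]; have : d \in divisors n by rewrite -dvdn_divisors // E -[(q * d)%coq_nat]/(q * d) dvdn_mull.
elim: (divisors n) => //= x s IH; rewrite inE => /orP[/eqP ->|/IH]; by [left|right].
Qed.
End DivisorBound.

(** With n of size b^2, this allows O(sqrt (1 + |b|)) forms per middle coefficient b against a
    weight of order b^-2. Any exponent below 1/2 in place of 1/4 would still give a convergent sum
    over b. *)
Lemma divisor_list_bound : exists K : R, (0 <= K)%R /\ forall n : nat, (0 < n)%nat ->
  exists l : list nat, (forall d, Nat.divide d n -> In d l) /\ (INR (length l) ^ 4 <= K * INR n)%R.
Proof.
  exists (64 ^ 16)%R. split; [apply pow_le; lra|].
  intros n Hn. exists (prime.divisors n).
  assert (Hn' : is_true (ssrnat.leq 1 n)) by (destruct n; [lia | reflexivity]).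
  split.
  - intros d. now apply DivisorBound.In_divisors.
  - pose proof (DivisorBound.divisors_pow4 n Hn') as H.
    assert (P : forall a b, ssrnat.expn a b = Nat.pow a b).
    { intros a b. induction b as [|b IH]; [reflexivity|]. simpl. rewrite <- IH. now rewrite ssrnat.expnS. }
    apply (Bool.reflect_iff _ _ ssrnat.leP) in H.
    rewrite P in H. apply le_INR in H. rewrite pow_INR in H.
    eapply Rle_trans; [exact H|].
    change (INR (Nat.mul (ssrnat.expn 64 16) n) <= 64 ^ 16 * INR n)%R.
    rewrite P, mult_INR, pow_INR. right. f_equal. f_equal. simpl. ring.
Qed.

(** * Summation of |Q|^-2, one middle coefficient at a time *)

Definition qn (Q : qform) : R := 1 + IZR (qa Q) ^ 2 + IZR (qb Q) ^ 2 + IZR (qc Q) ^ 2.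

Lemma qn_ge1 (Q : qform) : 1 <= qn Q.
Proof.
  unfold qn. pose proof (pow2_ge_0 (IZR (qa Q))); pose proof (pow2_ge_0 (IZR (qb Q)));
  pose proof (pow2_ge_0 (IZR (qc Q))). lra.
Qed.

(** The weight (1 + x)^(-3/2), that is sqrt (1 + x) forms times (1 + x)^-2. *)
Definition wt (x : R) : R := / ((1 + x) * sqrt (1 + x)).

Lemma wt_nonneg x : 0 <= x -> 0 <= wt x.
Proof.
  intros Hx. left. apply Rinv_0_lt_compat, Rmult_lt_0_compat; [lra | apply sqrt_lt_R0; lra].
Qed.

(** As y^2 - x^2 = 1, the right side is 4 / (x y (x + y)), so the claim is y (x + y) <= 4 x^2; it
    follows from y <= 3x/2, since 15/4 <= 4. *)
Lemma wt_telescope (t : R) : 1 <= t ->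
  / (t * sqrt t) <= 4 * (/ sqrt t - / sqrt (t + 1)).
Proof.
  intros Ht. set (x := sqrt t). set (y := sqrt (t + 1)).
  assert (Hx : x * x = t) by (apply sqrt_sqrt; lra).
  assert (Hy : y * y = t + 1) by (apply sqrt_sqrt; lra).
  assert (Hx1 : 1 <= x) by (rewrite <- sqrt_1; apply sqrt_le_1_alt; lra).
  assert (Hy0 : 0 < y) by (apply sqrt_lt_R0; lra).
  rewrite <- Hx in Hy |- *.
  assert (Hy1 : y <= 3 / 2 * x) by nra.
  assert (Hxy : x < y) by nra.
  apply (Rmult_le_reg_r (x * x * x * y * (x + y))).
  { repeat apply Rmult_lt_0_compat; lra. }
  replace (/ (x * x * x) * _) with (y * (x + y)) by (field; lra).
  replace (4 * (/ x - / y) * _) with (4 * (x * x) * (y * y - x * x)) by (field; lra).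
  rewrite Hy. nra.
Qed.

Lemma sum_wt_seq N : Rsum_list (fun n => wt (INR n)) (seq 0 N) <= 4 * (1 - / sqrt (1 + INR N)).
Proof.
  induction N as [|N IH].
  - simpl. rewrite Rplus_0_r, sqrt_1. lra.
  - rewrite seq_S, Rsum_list_app. simpl Rsum_list at 2.
    pose proof (pos_INR N). pose proof (wt_telescope (1 + INR N) ltac:(lra)) as H1.
    unfold wt at 2. rewrite S_INR. replace (1 + (INR N + 1)) with (1 + INR N + 1) by ring. lra.
Qed.

(** Only a cover of [-B, B]: 0 is listed twice, which is harmless in upper bounds for nonnegative
    sums and in minima. *)
Definition zrange (B : nat) : list Z :=
  map Z.of_nat (seq 0 (S B)) ++ map (fun n => (- Z.of_nat n)%Z) (seq 0 (S B)).

Lemma In_zrange B z : (Z.abs z <= Z.of_nat B)%Z -> In z (zrange B).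
Proof.
  intros H. apply in_or_app. destruct (Z.le_ge_cases 0 z).
  - left. apply in_map_iff. exists (Z.to_nat z). rewrite in_seq. lia.
  - right. apply in_map_iff. exists (Z.to_nat (- z)). rewrite in_seq. lia.
Qed.

Lemma Rsum_list_map {S T} (f : S -> T) (m : T -> R) l :
  Rsum_list m (map f l) = Rsum_list (fun x => m (f x)) l.
Proof. induction l as [|x l IH]; simpl; [auto | now rewrite IH]. Qed.

Lemma Rsum_list_flat_map {S T} (f : S -> list T) (m : T -> R) l :
  Rsum_list m (flat_map f l) = Rsum_list (fun x => Rsum_list m (f x)) l.
Proof. induction l as [|x l IH]; simpl; [auto | now rewrite Rsum_list_app, IH]. Qed.

Lemma Rsum_list_const_le {T} (m : T -> R) c l :
  (forall t, In t l -> m t <= c) -> Rsum_list m l <= INR (length l) * c.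
Proof.
  induction l as [|x l IH]; intros H; [simpl; lra|].
  change (length (x :: l)) with (S (length l)). rewrite S_INR. simpl.
  pose proof (H x (or_introl eq_refl)). specialize (IH (fun t h => H t (or_intror h))). lra.
Qed.

Lemma sum_wt_zrange B : Rsum_list (fun z => wt (Rabs (IZR z))) (zrange B) <= 8.
Proof.
  unfold zrange. rewrite Rsum_list_app, !Rsum_list_map.
  assert (H : Rsum_list (fun n => wt (INR n)) (seq 0 (S B)) <= 4).
  { eapply Rle_trans; [apply sum_wt_seq|].
    assert (0 < / sqrt (1 + INR (S B))); [|lra].
    apply Rinv_0_lt_compat, sqrt_lt_R0. pose proof (pos_INR (S B)). lra. }
  assert (E : forall n, Rabs (IZR (Z.of_nat n)) = INR n /\ Rabs (IZR (- Z.of_nat n)) = INR n).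
  { intros n. rewrite opp_IZR, <- INR_IZR_INZ, Rabs_Ropp, Rabs_pos_eq by apply pos_INR. auto. }
  pose proof (Rsum_list_le (fun n => wt (Rabs (IZR (Z.of_nat n)))) (fun n => wt (INR n)) (seq 0 (S B))
    ltac:(intros n _; cbv beta; rewrite (proj1 (E n)); lra)).
  pose proof (Rsum_list_le (fun n => wt (Rabs (IZR (- Z.of_nat n)))) (fun n => wt (INR n)) (seq 0 (S B))
    ltac:(intros n _; cbv beta; rewrite (proj2 (E n)); lra)). lra.
Qed.

Lemma inv_1_sqr_le_wt (x : R) : / (1 + x ^ 2) <= 2 * wt (Rabs x).
Proof.
  pose proof (Rabs_pos x) as H. unfold wt. rewrite <- pow2_abs. set (t := Rabs x) in *.
  set (r := sqrt (1 + t)).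
  assert (Hr : r * r = 1 + t) by (apply sqrt_sqrt; lra).
  assert (Hr1 : 1 <= r) by (rewrite <- sqrt_1; apply sqrt_le_1_alt; lra).
  apply (Rmult_le_reg_r ((1 + t ^ 2) * ((1 + t) * r))).
  { apply Rmult_lt_0_compat; nra. }
  replace (/ (1 + t ^ 2) * _) with ((1 + t) * r) by (field; nra).
  replace (2 * / ((1 + t) * r) * _) with (2 * (1 + t ^ 2)) by (field; nra).
  assert (r <= 1 + t) by nra.
  pose proof (pow2_ge_0 (t - 1)). nra.
Qed.

Lemma list_Z_bounded {T} (f : T -> Z) (l : list T) :
  exists B : nat, forall t, In t l -> (Z.abs (f t) <= Z.of_nat B)%Z.
Proof.
  induction l as [|x l [B HB]].
  - exists O. intros t [].
  - exists (B + Z.to_nat (Z.abs (f x)))%nat. intros t [->|Ht]; [lia|].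
    specialize (HB t Ht). lia.
Qed.

(* The forms in Q_D with a fixed middle coefficient b correspond to the
   factorisations 4ac = b^2 - D, so they are O(sqrt (1 + |b|)) in number by the
   divisor bound unless b^2 = D, when ac = 0. *)
Lemma Q_D_fiber_bound (D : Z) : (0 < D)%Z ->
  exists K, 0 <= K /\ forall (B : nat) (b : Z), exists L : list qform,
    (forall Q, Q_D D Q -> qb Q = b -> (Z.abs (qa Q) <= Z.of_nat B)%Z ->
       (Z.abs (qc Q) <= Z.of_nat B)%Z -> In Q L) /\
    Rsum_list (fun Q => / qn Q) L <= K * wt (Rabs (IZR b)).
Proof.
  intros HD. destruct divisor_list_bound as (K0 & HK0 & Hdiv).
  assert (HDR : 1 <= IZR D) by (apply IZR_le; lia).
  set (K1 := 1 + K0 * IZR D).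
  assert (HK1 : 1 <= K1) by (unfold K1; nra).
  (* The first summand serves b^2 = D, where two families sum to at most 16 each and wt |b| >= (1 +
     D)^-2; the second serves all other b. *)
  exists (32 * ((1 + IZR D) * (1 + IZR D)) + 4 * K1). split; [nra|]. intros B b.
  assert (Hw : 0 <= wt (Rabs (IZR b))) by apply wt_nonneg, Rabs_pos.
  destruct (Z.eq_dec (b * b) D) as [Eb|Nb].
  (* Here ac = 0 and the fibre is infinite; the cut-off B makes the list finite while the bound
     stays independent of B. *)
  - exists (map (fun c => QForm 0 b c) (zrange B) ++ map (fun a => QForm a b 0) (zrange B)). split.
    + intros [a b' c] HQ Hb Ha Hc. unfold Q_D in HQ. cbn [qa qb qc] in *. subst b'.
      assert (Hac : (a = 0 \/ c = 0)%Z) by (apply Z.mul_eq_0; lia).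
      apply in_or_app. destruct Hac as [->| ->]; [left|right]; apply in_map_iff.
      * exists c. split; auto. now apply In_zrange.
      * exists a. split; auto. now apply In_zrange.
    + rewrite Rsum_list_app, !Rsum_list_map.
      assert (HS : forall f : Z -> qform, (forall z, 1 + IZR z ^ 2 <= qn (f z)) ->
        Rsum_list (fun z => / qn (f z)) (zrange B) <= 16).
      { intros f Hf. apply (Rle_trans _ (Rsum_list (fun z => 2 * wt (Rabs (IZR z))) (zrange B))).
        - apply Rsum_list_le. intros z _. eapply Rle_trans; [|apply inv_1_sqr_le_wt].
          apply Rinv_le_contravar; auto. pose proof (pow2_ge_0 (IZR z)). lra.
        - rewrite Rsum_list_scal. pose proof (sum_wt_zrange B). lra. }
      pose proof (HS (fun c => QForm 0 b c)) as H1. pose proof (HS (fun a => QForm a b 0)) as H2.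
      assert (Hb2 := pow2_ge_0 (IZR b)).
      specialize (H1 ltac:(intros z; unfold qn; simpl; lra)).
      specialize (H2 ltac:(intros z; unfold qn; simpl; lra)).
      assert (HbD : Rabs (IZR b) <= IZR D).
      { rewrite <- abs_IZR. apply IZR_le. nia. }
      assert (Hwb : 1 <= ((1 + IZR D) * (1 + IZR D)) * wt (Rabs (IZR b))).
      { unfold wt. pose proof (Rabs_pos (IZR b)). set (t := Rabs (IZR b)) in *.
        set (r := sqrt (1 + t)).
        assert (Hr : r * r = 1 + t) by (apply sqrt_sqrt; lra).
        assert (Hr1 : 1 <= r) by (rewrite <- sqrt_1; apply sqrt_le_1_alt; lra).
        assert (0 < (1 + t) * r) by nra.
        apply (Rmult_le_reg_r ((1 + t) * r)); [auto|].
        replace (_ * / ((1 + t) * r) * _) with ((1 + IZR D) * (1 + IZR D)) by (field; nra).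
        assert (r <= 1 + t) by nra. nra. }
      nra.
  - set (n := Z.to_nat (Z.abs ((b * b - D) / 4))).
    destruct (Nat.eq_dec n 0) as [En|Nn].
    (* A form in this fibre would have |ac| = n = 0, hence b^2 = D, so the fibre is empty. *)
    { exists nil. split; [|simpl; nra].
      intros [a b' c] HQ Hb _ _. exfalso. unfold Q_D in HQ. cbn [qa qb qc] in *. subst b'.
      assert (E : (b * b - D = (a * c) * 4)%Z) by lia. unfold n in En.
      rewrite E, Z.div_mul in En by lia. apply Nb. nia. }
    destruct (Hdiv n ltac:(lia)) as (l & Hl & Hlen).
    (* The first coefficient is a divisor of n up to sign, and it determines the last one. *)
    exists (flat_map (fun d => QForm (Z.of_nat d) b ((b * b - D) / 4 / Z.of_nat d) ::
        QForm (- Z.of_nat d) b ((b * b - D) / 4 / - Z.of_nat d) :: nil) l). split.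
    + intros [a b' c] HQ Hb _ _. unfold Q_D in HQ. cbn [qa qb qc] in *. subst b'.
      assert (E : ((b * b - D) / 4 = c * a)%Z).
      { replace (b * b - D)%Z with ((c * a) * 4)%Z by lia. apply Z.div_mul; lia. }
      assert (Ha : a <> 0%Z) by (intros ->; apply Nn; unfold n; rewrite E; lia).
      apply in_flat_map. exists (Z.abs_nat a). split.
      * apply Hl. exists (Z.abs_nat c). unfold n. rewrite E. nia.
      * rewrite E. destruct (Z.le_ge_cases 0 a).
        -- left. rewrite Zabs2Nat.id_abs, Z.abs_eq by lia. f_equal. now apply Z.div_mul.
        -- right; left. rewrite Zabs2Nat.id_abs, Z.abs_neq, Z.opp_involutive by lia. f_equal.
           now apply Z.div_mul.
    + rewrite Rsum_list_flat_map.
      apply (Rle_trans _ (INR (length l) * (2 * / (1 + IZR b ^ 2)))).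
      { apply Rsum_list_const_le. intros d _. simpl Rsum_list.
        assert (Hq : forall a c, / qn (QForm a b c) <= / (1 + IZR b ^ 2)).
        { intros a c. pose proof (pow2_ge_0 (IZR a)); pose proof (pow2_ge_0 (IZR b));
          pose proof (pow2_ge_0 (IZR c)).
          apply Rinv_le_contravar; unfold qn; simpl qa; simpl qb; simpl qc; lra. }
        pose proof (Hq (Z.of_nat d) ((b * b - D) / 4 / Z.of_nat d)%Z).
        pose proof (Hq (- Z.of_nat d)%Z ((b * b - D) / 4 / - Z.of_nat d)%Z). lra. }
      set (t := Rabs (IZR b)). pose proof (Rabs_pos (IZR b) : 0 <= t) as Ht.
      assert (Hn : INR n <= IZR D * (1 + t) ^ 2).
      { unfold n. rewrite INR_IZR_INZ, Z2Nat.id by lia.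
        apply (Rle_trans _ (IZR (D * (1 + Z.abs b) ^ 2))).
        - apply IZR_le.
          assert (Z.abs ((b * b - D) / 4) <= Z.abs (b * b - D) + 1)%Z.
          { assert (H4 := Z.div_mod (b * b - D) 4 ltac:(lia)).
            assert (H5 := Z.mod_pos_bound (b * b - D) 4 ltac:(lia)). lia. }
          assert (Z.abs ((b * b - D) / 4) <= b * b + D)%Z.
          { assert (H4 := Z.div_mod (b * b - D) 4 ltac:(lia)).
            assert (H5 := Z.mod_pos_bound (b * b - D) 4 ltac:(lia)). nia. }
          nia.
        - rewrite mult_IZR. change 2%Z with (Z.of_nat 2). rewrite <- pow_IZR, plus_IZR, abs_IZR.
          fold t. lra. }
      set (r := sqrt (1 + t)).
      assert (Hr : r * r = 1 + t) by (apply sqrt_sqrt; lra).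
      assert (Hr1 : 1 <= r) by (rewrite <- sqrt_1; apply sqrt_le_1_alt; lra).
      (* Fourth powers are compared: r^4 = (1 + t)^2, and K1^4 >= K1 >= K0 D because K1 >= 1. *)
      assert (HL : INR (length l) <= K1 * r).
      { apply Rnot_lt_le. intros Hlt.
        assert (H1 : (K1 * r) ^ 4 < INR (length l) ^ 4).
        { assert (0 < K1 * r) by nra.
          assert (H2 : (K1 * r) ^ 2 < INR (length l) ^ 2) by (simpl; nra).
          assert (0 <= (K1 * r) ^ 2) by apply pow2_ge_0.
          replace ((K1 * r) ^ 4) with ((K1 * r) ^ 2 * (K1 * r) ^ 2) by ring.
          replace (INR (length l) ^ 4) with (INR (length l) ^ 2 * INR (length l) ^ 2) by ring. nra. }
        assert (H2 : K0 * INR n <= K0 * (IZR D * (1 + t) ^ 2)) by (apply Rmult_le_compat_l; auto).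
        assert (H3 : K1 ^ 4 * (1 + t) ^ 2 < K0 * IZR D * (1 + t) ^ 2).
        { replace (K1 ^ 4 * (1 + t) ^ 2) with ((K1 * r) ^ 4); [lra|].
          rewrite <- Hr. ring. }
        assert (H4 : K1 <= K1 ^ 4).
        { assert (1 <= K1 ^ 3) by (apply pow_R1_Rle; auto). simpl in *. nra. }
        assert (H5 : 0 <= (1 + t) ^ 2) by apply pow2_ge_0.
        assert (K0 * IZR D * (1 + t) ^ 2 <= K1 ^ 4 * (1 + t) ^ 2); [|lra].
        apply Rmult_le_compat_r; auto. unfold K1 in *. lra. }
      assert (Hb2 : / (1 + IZR b ^ 2) <= 2 * / (1 + t) ^ 2).
      { rewrite <- pow2_abs. fold t.
        apply (Rmult_le_reg_r ((1 + t ^ 2) * (1 + t) ^ 2)); [apply Rmult_lt_0_compat; nra|].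
        replace (/ (1 + t ^ 2) * _) with ((1 + t) ^ 2) by (field; nra).
        replace (2 * / (1 + t) ^ 2 * _) with (2 * (1 + t ^ 2)) by (field; nra).
        pose proof (pow2_ge_0 (t - 1)). nra. }
      assert (Hb0 : 0 < / (1 + IZR b ^ 2)).
      { apply Rinv_0_lt_compat. pose proof (pow2_ge_0 (IZR b)). lra. }
      apply (Rle_trans _ (K1 * r * (2 * (2 * / (1 + t) ^ 2)))).
      { apply Rmult_le_compat; try lra. apply pos_INR. }
      replace (K1 * r * (2 * (2 * / (1 + t) ^ 2))) with (4 * K1 * wt t).
      { fold t in Hw. nra. }
      unfold wt. fold r. rewrite <- Hr. field. lra.
Qed.

(** Selects one list of forms per middle coefficient; along a finite list this takes only
    induction. *)
Lemma finite_choice {S T} (P : S -> T -> Prop) : (forall s, exists t, P s t) ->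
  forall l : list S, exists l' : list T, Forall2 P l l'.
Proof.
  intros H l. induction l as [|s l [l' IH]].
  - exists nil. constructor.
  - destruct (H s) as [t Ht]. exists (t :: l'). now constructor.
Qed.

(** Any finite list of forms is contained in the concatenation of fibre lists over the b that occur;
    repetitions there only enlarge the bound. *)
Lemma summable_Q_D (D : Z) : (0 < D)%Z -> summable_on (Q_D D) (fun Q => / qn Q).
Proof.
  intros HD. destruct (Q_D_fiber_bound D HD) as (K & HK & HF). split.
  - intros Q _. left. apply Rinv_0_lt_compat. pose proof (qn_ge1 Q). lra.
  - exists (K * 8). intros l Hn Hl.
    destruct (list_Z_bounded qa l) as [Ba HBa]. destruct (list_Z_bounded qb l) as [Bb HBb].
    destruct (list_Z_bounded qc l) as [Bc HBc].
    destruct (finite_choice _ (HF (Ba + Bc)%nat) (zrange Bb)) as [LL HLL].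
    apply (Rle_trans _ (Rsum_list (fun Q => / qn Q) (concat LL))).
    + apply Rsum_list_incl; auto.
      * intros Q HQ. assert (Hb : In (qb Q) (zrange Bb)) by (apply In_zrange; auto).
        assert (HQD : Q_D D Q) by (rewrite List.Forall_forall in Hl; auto).
        specialize (HBa Q HQ). specialize (HBc Q HQ).
        apply in_concat. clear - HLL Hb HBa HBc HQD. revert Hb.
        induction HLL as [|b L lb LL [H _] HLL IH]; intros Hb; [destruct Hb|].
        destruct Hb as [->|Hb].
        -- exists L. split; [now left|]. apply H; auto; lia.
        -- destruct (IH Hb) as (x & Hx & HQx). exists x. split; auto. now right.
      * intros Q _. left. apply Rinv_0_lt_compat. pose proof (qn_ge1 Q). lra.
    + apply (Rle_trans _ (K * Rsum_list (fun z => wt (Rabs (IZR z))) (zrange Bb))).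
      * clear - HLL. induction HLL as [|b L lb LL [_ H] HLL IH]; simpl; [lra|].
        rewrite Rsum_list_app. lra.
      * apply Rmult_le_compat_l; auto. apply sum_wt_zrange.
Qed.

(** * Geometry of the forms near a point off the geodesics *)

Lemma Cmod_pair_sqr (x y : R) : Cmod (x, y) ^ 2 = x ^ 2 + y ^ 2.
Proof. now rewrite Cmod2_alt. Qed.

Lemma qgeod_pair (Q : qform) (x y : R) :
  qgeod Q (x, y) = IZR (qa Q) * (x ^ 2 + y ^ 2) + IZR (qb Q) * x + IZR (qc Q).
Proof. unfold qgeod. now rewrite Cmod_pair_sqr. Qed.

Lemma qeval_pair (Q : qform) (x y : R) :
  qeval Q (x, y) = (IZR (qa Q) * (x ^ 2 - y ^ 2) + IZR (qb Q) * x + IZR (qc Q),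
                    (2 * IZR (qa Q) * x + IZR (qb Q)) * y).
Proof. unfold qeval. apply injective_projections; simpl; ring. Qed.

Lemma Q_D_R (D : Z) (Q : qform) : Q_D D Q ->
  IZR (qb Q) ^ 2 - 4 * IZR (qa Q) * IZR (qc Q) = IZR D.
Proof. unfold Q_D. intros <-. rewrite minus_IZR, !mult_IZR. ring. Qed.

Lemma Cmod_qeval_sqr (D : Z) (Q : qform) (x y : R) : Q_D D Q -> y <> 0 ->
  Cmod (qeval Q (x, y)) ^ 2 = y ^ 2 * (Q_sub_z Q (x, y) ^ 2 + IZR D).
Proof.
  intros HQ Hy. unfold Q_sub_z. rewrite qgeod_pair, qeval_pair, Cmod_pair_sqr.
  rewrite <- (Q_D_R D Q HQ). simpl Im. field. auto.
Qed.

Lemma warg_Q_sub_z (D : Z) (Q : qform) (x y : R) : (0 < D)%Z -> Q_D D Q -> 0 < y ->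
  warg D Q (x, y) = IZR D / (Q_sub_z Q (x, y) ^ 2 + IZR D).
Proof.
  intros HD HQ Hy. apply IZR_lt in HD. unfold warg.
  rewrite (Cmod_qeval_sqr D) by (auto; lra). simpl Im. field.
  pose proof (pow2_ge_0 (Q_sub_z Q (x, y))). split; lra.
Qed.

(** * Derivatives of Q(z,1), of Q_z and of a single term *)

Definition dqeval (Q : qform) (z : C) : C :=
  (RtoC 2 * RtoC (IZR (qa Q)) * z + RtoC (IZR (qb Q)))%C.

Lemma is_derive_poly2 (A B C0 t : R) :
  is_derive (fun u => A * u ^ 2 + B * u + C0) t (2 * A * t + B).
Proof. auto_derive; auto. ring. Qed.

Lemma is_deriveC_qeval_x (Q : qform) (x y : R) :
  is_deriveC (fun t => qeval Q (t, y)) x (dqeval Q (x, y)).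
Proof.
  apply is_deriveC_Re_Im. split.
  - apply (is_derive_ext (fun t => IZR (qa Q) * t ^ 2 + IZR (qb Q) * t + (IZR (qc Q) - IZR (qa Q) * y ^ 2))).
    { intros t. rewrite qeval_pair. simpl. ring. }
    eapply is_deriveR_eq; [apply is_derive_poly2|]. simpl. ring.
  - apply (is_derive_ext (fun t => 0 * t ^ 2 + (2 * IZR (qa Q) * y) * t + IZR (qb Q) * y)).
    { intros t. rewrite qeval_pair. simpl. ring. }
    eapply is_deriveR_eq; [apply is_derive_poly2|]. simpl. ring.
Qed.

Lemma is_deriveC_qeval_y (Q : qform) (x y : R) :
  is_deriveC (fun t => qeval Q (x, t)) y (Ci * dqeval Q (x, y))%C.
Proof.
  apply is_deriveC_Re_Im. split.
  - apply (is_derive_ext (fun t => - IZR (qa Q) * t ^ 2 + 0 * t + (IZR (qa Q) * x ^ 2 + IZR (qb Q) * x + IZR (qc Q)))).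
    { intros t. rewrite qeval_pair. simpl. ring. }
    eapply is_deriveR_eq; [apply is_derive_poly2|]. simpl. ring.
  - apply (is_derive_ext (fun t => 0 * t ^ 2 + (2 * IZR (qa Q) * x + IZR (qb Q)) * t + 0)).
    { intros t. rewrite qeval_pair. simpl. ring. }
    eapply is_deriveR_eq; [apply is_derive_poly2|]. simpl. ring.
Qed.

Lemma is_derive_Q_sub_z_x (Q : qform) (x y : R) : 0 < y ->
  is_derive (fun t => Q_sub_z Q (t, y)) x (Im (qeval Q (x, y)) / y ^ 2).
Proof.
  intros Hy.
  apply (is_derive_ext (fun t => IZR (qa Q) / y * t ^ 2 + IZR (qb Q) / y * t + (IZR (qc Q) / y + IZR (qa Q) * y))).
  { intros t. unfold Q_sub_z. rewrite qgeod_pair. simpl Im. simpl. field. lra. }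
  eapply is_deriveR_eq; [apply is_derive_poly2|]. rewrite qeval_pair. simpl. field. lra.
Qed.

Lemma is_derive_Q_sub_z_y (Q : qform) (x y : R) : 0 < y ->
  is_derive (fun t => Q_sub_z Q (x, t)) y (- Re (qeval Q (x, y)) / y ^ 2).
Proof.
  intros Hy.
  apply (is_derive_ext (fun t => / t * (IZR (qa Q) * t ^ 2 + 0 * t + (IZR (qa Q) * x ^ 2 + IZR (qb Q) * x + IZR (qc Q))))).
  { intros t. unfold Q_sub_z. rewrite qgeod_pair. simpl. ring. }
  eapply is_deriveR_eq.
  - apply is_deriveR_mult; [|apply is_derive_poly2].
    apply (is_derive_inv (fun t => t) y 1); [exact (is_derive_id y) | lra].
  - cbv beta. rewrite qeval_pair. simpl. field. lra.
Qed.

Lemma is_derive_warg_of_p (d t : R) : 0 < d ->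
  is_derive (fun u => d / (u ^ 2 + d)) t (- (2 * t * d) / (t ^ 2 + d) ^ 2).
Proof.
  intros Hd. pose proof (pow2_ge_0 t).
  auto_derive.
  - repeat split; auto. simpl in *. lra.
  - field. simpl in *; lra.
Qed.

(* The common shape of the terms: sg = 1, m = -k for f and sg = sign, m = k - 1 for F. *)
Definition gterm (sg : R -> R) (m : Z) (g : R -> C) (D : Z) (z : C) (Q : qform) : C :=
  (RtoC (sg (Q_sub_z Q z)) * Cpow_Z (qeval Q z) m * g (warg D Q z))%C.

(* [qv] and [pv] are the derivatives of Q(z,1) and of Q_z in a given real
   direction. *)
Definition dgterm (sg : R -> R) (m : Z) (g g' : R -> C) (D : Z) (z : C) (Q : qform)
    (qv : C) (pv : R) : C :=
  let p := Q_sub_z Q z in let q := qeval Q z in let w := warg D Q z in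
  (RtoC (sg p) * (RtoC (IZR m) * qv * Cpow_Z q (m - 1) * g w
     + Cpow_Z q m * (RtoC (- (2 * p * w ^ 2 / IZR D) * pv) * g' w)))%C.

Lemma qeval_nonzero (D : Z) (Q : qform) (x y : R) : (0 < D)%Z -> Q_D D Q -> 0 < y ->
  qeval Q (x, y) <> 0%C.
Proof.
  intros HD HQ Hy. apply IZR_lt in HD. intros E.
  pose proof (Cmod_qeval_sqr D Q x y HQ ltac:(lra)) as H. rewrite E, Cmod_0 in H.
  pose proof (pow2_ge_0 (Q_sub_z Q (x, y))).
  assert (0 < y ^ 2 * (Q_sub_z Q (x, y) ^ 2 + IZR D)).
  { apply Rmult_lt_0_compat; [apply pow_lt; auto | lra]. }
  simpl in H. lra.
Qed.

Lemma warg_01 (D : Z) (Q : qform) (x y : R) : (0 < D)%Z -> Q_D D Q -> 0 < y ->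
  Q_sub_z Q (x, y) <> 0 -> 0 < warg D Q (x, y) < 1.
Proof.
  intros HD HQ Hy Hp. rewrite warg_Q_sub_z by auto. apply IZR_lt in HD.
  assert (0 < Q_sub_z Q (x, y) ^ 2) by (apply pow2_gt_0; auto).
  split.
  - apply Rdiv_lt_0_compat; lra.
  - apply (Rmult_lt_reg_r (Q_sub_z Q (x, y) ^ 2 + IZR D)); [lra|].
    replace (_ / _ * _) with (IZR D) by (field; lra). lra.
Qed.

(** [zt] will be a horizontal or vertical line. Off the geodesic of Q the factor sg (Q_z) is locally
    constant and contributes nothing. *)
Lemma is_deriveC_gterm (sg : R -> R) (m : Z) (g g' : R -> C) (D : Z) (Q : qform)
    (zt : R -> C) (t : R) (qv : C) (pv : R) :
  (0 < D)%Z -> Q_D D Q ->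
  (forall u, u <> 0 -> is_derive sg u 0) ->
  (forall w, 0 < w < 1 -> is_deriveC g w (g' w)) ->
  locally t (fun u => 0 < Im (zt u)) ->
  is_deriveC (fun u => qeval Q (zt u)) t qv ->
  is_derive (fun u => Q_sub_z Q (zt u)) t pv ->
  Q_sub_z Q (zt t) <> 0 ->
  is_deriveC (fun u => gterm sg m g D (zt u) Q) t (dgterm sg m g g' D (zt t) Q qv pv).
Proof.
  intros HD HQ Hsg Hg Hloc Hq Hp Hp0.
  assert (Ht : 0 < Im (zt t)) by (apply locally_singleton in Hloc; auto).
  assert (Ew : forall u, 0 < Im (zt u) -> warg D Q (zt u) = IZR D / (Q_sub_z Q (zt u) ^ 2 + IZR D)).
  { intros u Hu. destruct (zt u). now apply warg_Q_sub_z. }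
  assert (HDR := IZR_lt _ _ HD).
  assert (Hw : is_derive (fun u => warg D Q (zt u)) t (- (2 * Q_sub_z Q (zt t) * warg D Q (zt t) ^ 2 / IZR D) * pv)).
  { apply (is_derive_ext_loc (fun u => IZR D / (Q_sub_z Q (zt u) ^ 2 + IZR D))).
    - refine (filter_imp _ _ _ Hloc). intros u Hu. symmetry. now apply Ew.
    - eapply is_deriveR_eq.
      + apply (is_deriveR_comp (fun v => IZR D / (v ^ 2 + IZR D)) (fun u => Q_sub_z Q (zt u))).
        * now apply is_derive_warg_of_p.
        * exact Hp.
      + cbv beta. rewrite (Ew t Ht). pose proof (pow2_ge_0 (Q_sub_z Q (zt t))). field. lra. }
  assert (Hq0 : qeval Q (zt t) <> 0%C).
  { destruct (zt t). now apply (qeval_nonzero D). }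
  assert (Hw01 : 0 < warg D Q (zt t) < 1).
  { destruct (zt t). now apply warg_01. }
  pose proof (is_deriveC_RtoC _ _ _ (is_deriveR_comp sg _ _ _ _ (Hsg _ Hp0) Hp)) as D1.
  pose proof (is_deriveC_Cpow_Z _ _ _ m Hq0 Hq) as D2.
  pose proof (is_deriveC_comp g (fun u => warg D Q (zt u)) t _ _ (Hg _ Hw01) Hw) as D3.
  pose proof (is_deriveC_mult _ _ _ _ _ (is_deriveC_mult _ _ _ _ _ D1 D2) D3) as D4.
  eapply is_deriveC_eq; [exact D4|].
  unfold dgterm. cbv beta zeta. rewrite Rmult_0_r. ring.
Qed.

(** * Comparison of Q_z, Q(z,1) and the coefficients *)

Definition rqn (Q : qform) : R := sqrt (qn Q).

Lemma rqn_sqr Q : rqn Q * rqn Q = qn Q.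
Proof. apply sqrt_sqrt. pose proof (qn_ge1 Q); lra. Qed.

Lemma rqn_ge1 Q : 1 <= rqn Q.
Proof. unfold rqn. rewrite <- sqrt_1. apply sqrt_le_1_alt, qn_ge1. Qed.

Lemma Rabs_le_rqn (t : R) Q : t ^ 2 <= qn Q -> Rabs t <= rqn Q.
Proof.
  intros H. unfold rqn. rewrite <- (sqrt_pow2 (Rabs t)) by apply Rabs_pos.
  apply sqrt_le_1_alt. now rewrite pow2_abs.
Qed.

Lemma coeff_le_rqn Q : Rabs (IZR (qa Q)) <= rqn Q /\ Rabs (IZR (qb Q)) <= rqn Q /\ Rabs (IZR (qc Q)) <= rqn Q.
Proof.
  pose proof (pow2_ge_0 (IZR (qa Q))); pose proof (pow2_ge_0 (IZR (qb Q)));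
  pose proof (pow2_ge_0 (IZR (qc Q))).
  repeat split; apply Rabs_le_rqn; unfold qn; lra.
Qed.

(** The coefficients are linear in y Q_z, Re q and Im q: a from y Q_z - Re q = 2 a y^2, then b from
    Im q, then c. All three quantities are at most |q|, and the 1 in [qn] is covered by |q|^2 >= y^2
    D. *)
Lemma qn_le_qeval (D : Z) (x y : R) : (0 < D)%Z -> 0 < y ->
  exists M, 0 < M /\ forall Q, Q_D D Q -> qn Q <= M * Cmod (qeval Q (x, y)) ^ 2.
Proof.
  intros HD Hy. assert (HDR : 1 <= IZR D) by (apply IZR_le; lia).
  set (A := / y ^ 2). set (B := / y + 2 * Rabs x * A).
  set (C0 := 1 + A * (x ^ 2 + y ^ 2) + B * Rabs x).
  assert (Hy2 : 0 < y ^ 2) by (apply pow_lt; auto).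
  assert (HA : 0 < A) by (now apply Rinv_0_lt_compat).
  pose proof (Rabs_pos x) as Hx.
  assert (Hiy : 0 < / y) by (now apply Rinv_0_lt_compat).
  assert (HB : 0 <= B) by (unfold B; nra).
  assert (HC : 0 <= C0) by (unfold C0; pose proof (pow2_ge_0 x); nra).
  exists (A + A ^ 2 + B ^ 2 + C0 ^ 2). split; [nra|]. intros Q HQ.
  pose proof (Cmod_qeval_sqr D Q x y HQ ltac:(lra)) as E.
  set (n := Cmod (qeval Q (x, y))) in *. assert (Hn : 0 <= n) by apply Cmod_ge_0.
  set (p := Q_sub_z Q (x, y)) in *. pose proof (pow2_ge_0 p) as Hp2.
  assert (Hyp : Rabs (y * p) <= n).
  { rewrite <- (Rabs_pos_eq n) by auto. apply Rsqr_le_abs_0. unfold Rsqr. nra. }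
  assert (H1 : 1 <= A * n ^ 2).
  { rewrite E. unfold A. replace (/ y ^ 2 * (y ^ 2 * (p ^ 2 + IZR D))) with (p ^ 2 + IZR D) by (field; lra). lra. }
  pose proof (re_le_Cmod (qeval Q (x, y))) as Hre. pose proof (im_le_Cmod (qeval Q (x, y))) as Him.
  fold n in Hre, Him. rewrite qeval_pair in Hre, Him. unfold Re, Im in Hre, Him. cbn [fst snd] in Hre, Him.
  set (a := IZR (qa Q)) in *. set (b := IZR (qb Q)) in *. set (c := IZR (qc Q)) in *.
  assert (Ep : y * p = a * (x ^ 2 + y ^ 2) + b * x + c).
  { unfold p, Q_sub_z. rewrite qgeod_pair. simpl Im. fold a b c. field. lra. }
  rewrite Ep in Hyp.
  assert (Ha : Rabs a <= A * n).
  { replace a with (/ 2 * A * ((a * (x ^ 2 + y ^ 2) + b * x + c) + - (a * (x ^ 2 - y ^ 2) + b * x + c)))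
      by (unfold A; field; lra).
    rewrite Rabs_mult, (Rabs_pos_eq (/ 2 * A)) by lra.
    pose proof (Rabs_triang (a * (x ^ 2 + y ^ 2) + b * x + c) (- (a * (x ^ 2 - y ^ 2) + b * x + c))) as HT.
    rewrite Rabs_Ropp in HT.
    replace (A * n) with (/ 2 * A * (n + n)) by field. apply Rmult_le_compat_l; lra. }
  assert (Hb : Rabs b <= B * n).
  { replace b with (/ y * ((2 * a * x + b) * y) + - (2 * a * x)) by (field; lra).
    eapply Rle_trans; [apply Rabs_triang|].
    rewrite Rabs_Ropp, (Rabs_mult (/ y)), (Rabs_pos_eq (/ y)), (Rabs_mult (2 * a)), (Rabs_mult 2), (Rabs_pos_eq 2) by lra.
    unfold B. assert (Rabs a * Rabs x <= A * n * Rabs x) by (apply Rmult_le_compat_r; auto).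
    assert (/ y * Rabs ((2 * a * x + b) * y) <= / y * n) by (apply Rmult_le_compat_l; lra). lra. }
  assert (Hc : Rabs c <= C0 * n).
  { replace c with ((a * (x ^ 2 + y ^ 2) + b * x + c) + (- (a * (x ^ 2 + y ^ 2)) + - (b * x))) at 1 by ring.
    eapply Rle_trans; [apply Rabs_triang|].
    pose proof (Rabs_triang (- (a * (x ^ 2 + y ^ 2))) (- (b * x))) as HT.
    rewrite !Rabs_Ropp, !Rabs_mult, (Rabs_pos_eq (x ^ 2 + y ^ 2)) in HT by (pose proof (pow2_ge_0 x); lra).
    assert (Rabs a * (x ^ 2 + y ^ 2) <= A * n * (x ^ 2 + y ^ 2))
      by (apply Rmult_le_compat_r; auto; pose proof (pow2_ge_0 x); lra).
    assert (Rabs b * Rabs x <= B * n * Rabs x) by (apply Rmult_le_compat_r; auto).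
    unfold C0. lra. }
  unfold qn. fold a b c.
  assert (HS : forall u K, Rabs u <= K * n -> u ^ 2 <= K ^ 2 * n ^ 2).
  { intros u K Hu. rewrite <- pow2_abs, <- Rpow_mult_distr. apply pow_incr. split; auto. apply Rabs_pos. }
  pose proof (HS _ _ Ha). pose proof (HS _ _ Hb). pose proof (HS _ _ Hc). lra.
Qed.

Lemma list_min_pos {T} (P : T -> Prop) (f : T -> R) (l : list T) :
  (forall t, P t -> f t <> 0) -> exists v, 0 < v /\ forall t, In t l -> P t -> v <= Rabs (f t).
Proof.
  intros H. induction l as [|x l (v & Hv & IH)].
  - exists 1. split; [lra|]. intros t [].
  - destruct (classic (P x)) as [Hx|Hx].
    + exists (Rmin v (Rabs (f x))). split.
      * apply Rmin_pos; auto. now apply Rabs_pos_lt, H.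
      * intros t [<-|Ht] HP; [apply Rmin_r|]. eapply Rle_trans; [apply Rmin_l | auto].
    + exists v. split; auto. intros t [<-|Ht] HP; [contradiction | auto].
Qed.

Lemma coeff_le_qn Q (B : nat) : qn Q <= INR B ->
  (Z.abs (qa Q) <= Z.of_nat B)%Z /\ (Z.abs (qb Q) <= Z.of_nat B)%Z /\ (Z.abs (qc Q) <= Z.of_nat B)%Z.
Proof.
  intros H. rewrite INR_IZR_INZ in H.
  assert (E : qn Q = IZR (1 + qa Q * qa Q + qb Q * qb Q + qc Q * qc Q)).
  { rewrite !plus_IZR, !mult_IZR. unfold qn. ring. }
  rewrite E in H. apply le_IZR in H. repeat split; nia.
Qed.

(** Large and small forms are treated apart. Beyond the threshold R0 the term D is at most half of
    p^2 + D, so p^2 is comparable with [qn Q]. Finitely many forms remain, and off E_D each has p <>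
    0, so |p| has a positive minimum on them. *)
Lemma Q_sub_z_lower (D : Z) (x y : R) : (0 < D)%Z -> 0 < y -> ~ E_D D (x, y) ->
  exists v, 0 < v /\ forall Q, Q_D D Q -> v * rqn Q <= Rabs (Q_sub_z Q (x, y)).
Proof.
  intros HD Hy HE. assert (HDR := IZR_lt _ _ HD).
  destruct (qn_le_qeval D x y HD Hy) as (M & HM & HQM).
  assert (Hp0 : forall Q, Q_D D Q -> Q_sub_z Q (x, y) <> 0).
  { intros Q HQ E. apply HE. split; [exact Hy|]. exists Q. split; auto.
    unfold Q_sub_z in E. simpl Im in E. apply Rmult_integral in E. destruct E as [E|E]; auto.
    exfalso. revert E. apply Rinv_neq_0_compat. lra. }
  set (R0 := 2 * M * y ^ 2 * IZR D).
  assert (Hy2 : 0 < y ^ 2) by (apply pow_lt; auto).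
  assert (HMy : 0 < M * y ^ 2) by nra.
  destruct (INR_unbounded (R0 + 1)) as [B HB].
  set (L := flat_map (fun a => flat_map (fun b => map (fun c => QForm a b c) (zrange B)) (zrange B)) (zrange B)).
  destruct (list_min_pos (Q_D D) (fun Q => Q_sub_z Q (x, y)) L Hp0) as (v & Hv & Hmin).
  assert (HR0 : 0 < R0) by (unfold R0; nra).
  assert (Hs : forall r t Q, 0 < r -> r * qn Q <= t ^ 2 -> sqrt r * rqn Q <= Rabs t).
  { intros r t Q Hr H. rewrite <- (sqrt_pow2 (Rabs t)) by apply Rabs_pos.
    rewrite pow2_abs. unfold rqn. rewrite <- sqrt_mult_alt by lra. now apply sqrt_le_1_alt. }
  set (r1 := / (2 * M * y ^ 2)). set (r2 := v ^ 2 / (R0 + 1)).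
  assert (Hr1 : 0 < r1) by (apply Rinv_0_lt_compat; lra).
  assert (Hr2 : 0 < r2) by (apply Rdiv_lt_0_compat; [apply pow_lt; auto | lra]).
  exists (sqrt (Rmin r1 r2)). assert (Hr := Rmin_pos _ _ Hr1 Hr2).
  split; [now apply sqrt_lt_R0|]. intros Q HQ. apply Hs; auto.
  pose proof (qn_ge1 Q) as Hq1. pose proof (Rmin_l r1 r2). pose proof (Rmin_r r1 r2).
  destruct (Rle_lt_dec (qn Q) R0) as [Hq|Hq].
  - assert (HIn : In Q L).
    { destruct (coeff_le_qn Q B) as (Ha & Hb & Hc); [lra|].
      unfold L. apply in_flat_map. exists (qa Q). split; [now apply In_zrange|].
      apply in_flat_map. exists (qb Q). split; [now apply In_zrange|].
      apply in_map_iff. exists (qc Q). split; [now destruct Q | now apply In_zrange]. }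
    specialize (Hmin Q HIn HQ).
    assert (v ^ 2 <= Q_sub_z Q (x, y) ^ 2).
    { rewrite <- (pow2_abs (Q_sub_z Q (x, y))). apply pow_incr. lra. }
    assert (r2 * qn Q <= v ^ 2).
    { unfold r2. apply (Rmult_le_reg_r (R0 + 1)); [lra|].
      replace (v ^ 2 / (R0 + 1) * qn Q * (R0 + 1)) with (v ^ 2 * qn Q) by (field; lra).
      apply Rmult_le_compat_l; [apply pow2_ge_0 | lra]. }
    nra.
  - specialize (HQM Q HQ). rewrite (Cmod_qeval_sqr D) in HQM by (auto; lra).
    assert (r1 * qn Q <= Q_sub_z Q (x, y) ^ 2).
    { unfold r1. apply (Rmult_le_reg_l (2 * M * y ^ 2)); [lra|].
      replace (2 * M * y ^ 2 * (/ (2 * M * y ^ 2) * qn Q)) with (qn Q) by (field; lra).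
      unfold R0 in Hq. lra. }
    nra.
Qed.

Lemma Rabs_le_center (u u0 d : R) : Rabs (u - u0) <= d -> u0 - d <= u <= u0 + d.
Proof. intros H. apply Rabs_le_between in H. lra. Qed.

(** Termwise differentiation needs the lower bound uniformly in a neighbourhood; it spreads because
    the geodesic polynomial varies slowly relative to |Q|. *)
Lemma box_bounds (D : Z) (x0 y0 : R) : (0 < D)%Z -> 0 < y0 -> ~ E_D D (x0, y0) ->
  exists d v K, 0 < d /\ d <= y0 / 2 /\ 0 < v /\ 0 < K /\
    forall Q x y, Q_D D Q -> Rabs (x - x0) <= d -> Rabs (y - y0) <= d ->
      v * rqn Q <= Rabs (Q_sub_z Q (x, y)) /\
      Cmod (qeval Q (x, y)) <= K * rqn Q /\ Cmod (dqeval Q (x, y)) <= K * rqn Q.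
Proof.
  intros HD Hy0 HE. destruct (Q_sub_z_lower D x0 y0 HD Hy0 HE) as (v & Hv & Hlow).
  pose proof (Rabs_pos x0) as Hx0.
  set (T := Rabs x0 + y0 + 1). set (L := 2 * Rabs x0 + 2 * y0 + 3).
  assert (HT : 1 <= T) by (unfold T; lra). assert (HL : 0 < L) by (unfold L; lra).
  (* Over the box [qgeod Q] changes by at most d L |Q|; the last entry keeps this below half of the
     value y0 v |Q| guaranteed at the centre. *)
  set (d := Rmin (Rmin 1 (y0 / 2)) (y0 * v / (2 * L))).
  assert (Hyv : 0 < y0 * v) by nra.
  assert (Hd : 0 < d).
  { unfold d. repeat apply Rmin_pos; try lra. apply Rdiv_lt_0_compat; lra. }
  assert (Hd1 : d <= 1) by (unfold d; eapply Rle_trans; [apply Rmin_l | apply Rmin_l]).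
  assert (Hd2 : d <= y0 / 2) by (unfold d; eapply Rle_trans; [apply Rmin_l | apply Rmin_r]).
  assert (Hd3 : d * L <= y0 * v / 2).
  { apply (Rle_trans _ (y0 * v / (2 * L) * L)).
    - apply Rmult_le_compat_r; [lra | apply Rmin_r].
    - right. field. lra. }
  (* From y0 v / 2 the division by y <= 3 y0 / 2 leaves v / 3. T bounds |x| and |y| on the box. *)
  exists d, (v / 3), (4 * T ^ 2 + 4 * T + 4).
  assert (HTT : 1 <= T ^ 2) by nra.
  repeat split; auto; try lra; try (
  pose proof (Rabs_le_center _ _ _ H0) as Bx; pose proof (Rabs_le_center _ _ _ H1) as By;
  destruct (coeff_le_rqn Q) as (Ha & Hb & Hc); pose proof (rqn_ge1 Q) as Hr).
  - specialize (Hlow Q H).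
    assert (E0 : Rabs (qgeod Q (x0, y0)) = y0 * Rabs (Q_sub_z Q (x0, y0))).
    { unfold Q_sub_z. simpl Im. rewrite Rabs_mult, Rabs_inv, (Rabs_pos_eq y0) by lra. field. lra. }
    assert (E1 : Rabs (qgeod Q (x, y)) = y * Rabs (Q_sub_z Q (x, y))).
    { unfold Q_sub_z. simpl Im. rewrite Rabs_mult, Rabs_inv, (Rabs_pos_eq y) by lra. field. lra. }
    assert (Hdiff : Rabs (qgeod Q (x0, y0) - qgeod Q (x, y)) <= rqn Q * (d * L)).
    { rewrite !qgeod_pair.
      replace (_ - _) with (IZR (qa Q) * ((x0 - x) * (x0 + x) + (y0 - y) * (y0 + y)) + IZR (qb Q) * (x0 - x)) by ring.
      assert (Ax : Rabs (x0 - x) <= d) by (now rewrite Rabs_minus_sym).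
      assert (Ay : Rabs (y0 - y) <= d) by (now rewrite Rabs_minus_sym).
      assert (Sx : Rabs (x0 + x) <= 2 * Rabs x0 + 1).
      { replace (x0 + x) with (2 * x0 + (x - x0)) by ring. eapply Rle_trans; [apply Rabs_triang|].
        rewrite Rabs_mult, (Rabs_pos_eq 2) by lra. lra. }
      assert (Sy : Rabs (y0 + y) <= 2 * y0 + 1) by (rewrite Rabs_pos_eq; lra).
      assert (P1 : Rabs ((x0 - x) * (x0 + x)) <= d * (2 * Rabs x0 + 1)).
      { rewrite Rabs_mult. apply Rmult_le_compat; auto using Rabs_pos. }
      assert (P2 : Rabs ((y0 - y) * (y0 + y)) <= d * (2 * y0 + 1)).
      { rewrite Rabs_mult. apply Rmult_le_compat; auto using Rabs_pos. }
      eapply Rle_trans; [apply Rabs_triang|]. rewrite !Rabs_mult.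
      assert (P3 : Rabs (IZR (qa Q)) * Rabs ((x0 - x) * (x0 + x) + (y0 - y) * (y0 + y)) <=
         rqn Q * (d * (2 * Rabs x0 + 1) + d * (2 * y0 + 1))).
      { apply Rmult_le_compat; auto using Rabs_pos. eapply Rle_trans; [apply Rabs_triang|]. lra. }
      assert (P4 : Rabs (IZR (qb Q)) * Rabs (x0 - x) <= rqn Q * d) by (apply Rmult_le_compat; auto using Rabs_pos).
      unfold L. lra. }
    assert (Htri : Rabs (qgeod Q (x0, y0)) <= Rabs (qgeod Q (x, y)) + Rabs (qgeod Q (x0, y0) - qgeod Q (x, y))).
    { replace (qgeod Q (x0, y0)) with (qgeod Q (x, y) + (qgeod Q (x0, y0) - qgeod Q (x, y))) at 1 by ring.
      apply Rabs_triang. }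
    assert (Hgoal : y0 * v / 2 * rqn Q <= y * Rabs (Q_sub_z Q (x, y))).
    { rewrite <- E1. rewrite E0 in Htri.
      assert (y0 * (v * rqn Q) <= y0 * Rabs (Q_sub_z Q (x0, y0))) by (apply Rmult_le_compat_l; lra).
      assert (rqn Q * (d * L) <= rqn Q * (y0 * v / 2)) by (apply Rmult_le_compat_l; lra).
      lra. }
    apply (Rmult_le_reg_l y); [lra|].
    assert (y * (v / 3 * rqn Q) <= (3 / 2 * y0) * (v / 3 * rqn Q)) by (apply Rmult_le_compat_r; nra).
    lra.
  - assert (Hx : Rabs x <= T).
    { replace x with (x0 + (x - x0)) by ring. eapply Rle_trans; [apply Rabs_triang|]. unfold T; lra. }
    assert (Hyy : Rabs y <= T) by (rewrite Rabs_pos_eq; unfold T; lra).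
    assert (Hxy : Rabs x * Rabs y <= T ^ 2).
    { replace (T ^ 2) with (T * T) by ring. apply Rmult_le_compat; auto using Rabs_pos. }
    assert (Hx2 : x ^ 2 <= T ^ 2) by (rewrite <- pow2_abs; apply pow_incr; split; auto using Rabs_pos).
    assert (Hy2 : y ^ 2 <= T ^ 2) by (rewrite <- pow2_abs; apply pow_incr; split; auto using Rabs_pos).
    rewrite qeval_pair. eapply Rle_trans; [apply Cmod_le_Re_Im|]. unfold Re, Im; cbn [fst snd].
    assert (P0 : Rabs (x ^ 2 - y ^ 2) <= 2 * T ^ 2).
    { apply Rabs_le. pose proof (pow2_ge_0 x); pose proof (pow2_ge_0 y). lra. }
    assert (P1 : Rabs (IZR (qa Q)) * Rabs (x ^ 2 - y ^ 2) <= rqn Q * (2 * T ^ 2))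
      by (apply Rmult_le_compat; auto using Rabs_pos).
    assert (P2 : Rabs (IZR (qb Q)) * Rabs x <= rqn Q * T) by (apply Rmult_le_compat; auto using Rabs_pos).
    assert (P3 : Rabs (IZR (qb Q)) * Rabs y <= rqn Q * T) by (apply Rmult_le_compat; auto using Rabs_pos).
    assert (P4 : Rabs (IZR (qa Q)) * (Rabs x * Rabs y) <= rqn Q * T ^ 2).
    { apply Rmult_le_compat; auto using Rabs_pos. apply Rmult_le_pos; apply Rabs_pos. }
    replace ((2 * IZR (qa Q) * x + IZR (qb Q)) * y) with (2 * (IZR (qa Q) * (x * y)) + IZR (qb Q) * y) by ring.
    pose proof (Rabs_triang (IZR (qa Q) * (x ^ 2 - y ^ 2) + IZR (qb Q) * x) (IZR (qc Q))) as T1.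
    pose proof (Rabs_triang (IZR (qa Q) * (x ^ 2 - y ^ 2)) (IZR (qb Q) * x)) as T2.
    pose proof (Rabs_triang (2 * (IZR (qa Q) * (x * y))) (IZR (qb Q) * y)) as T3.
    rewrite !Rabs_mult in T2, T3. rewrite (Rabs_pos_eq 2) in T3 by lra.
    rewrite (Rabs_mult x y), (Rabs_mult (IZR (qb Q)) y) in T3.
    assert (rqn Q * (4 * T ^ 2 + 4 * T + 4) >= rqn Q * (2 * T ^ 2 + T + 1 + 2 * T ^ 2 + T))
      by (apply Rle_ge, Rmult_le_compat_l; lra).
    lra.
  - assert (Hx : Rabs x <= T).
    { replace x with (x0 + (x - x0)) by ring. eapply Rle_trans; [apply Rabs_triang|]. unfold T; lra. }
    assert (Hyy : Rabs y <= T) by (rewrite Rabs_pos_eq; unfold T; lra).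
    unfold dqeval. eapply Rle_trans; [apply Cmod_triangle|]. rewrite !Cmod_mult, !Cmod_R.
    rewrite (Rabs_pos_eq 2) by lra.
    assert (P1 : Cmod (x, y) <= 2 * T).
    { eapply Rle_trans; [apply Cmod_le_Re_Im|]. unfold Re, Im; cbn [fst snd]. lra. }
    assert (P2 : Rabs (IZR (qa Q)) * Cmod (x, y) <= rqn Q * (2 * T))
      by (apply Rmult_le_compat; auto using Rabs_pos, Cmod_ge_0).
    nra.
Qed.

(* Growth condition making q^m g(w) of size |q|^-k, through sqrt w = sqrt D y / |q|. *)
Definition profile_bound (g g' : R -> C) (j : nat) : Prop :=
  forall w0, 0 <= w0 < 1 -> exists M, 0 <= M /\ forall w, 0 < w <= w0 ->
    Cmod (g w) <= M * sqrt w ^ j /\ Cmod (g' w) * w <= M * sqrt w ^ j.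

Lemma sqrt_warg (D : Z) (Q : qform) (x y : R) : (0 < D)%Z -> Q_D D Q -> 0 < y ->
  sqrt (warg D Q (x, y)) = sqrt (IZR D) * y / Cmod (qeval Q (x, y)).
Proof.
  intros HD HQ Hy. assert (HDR := IZR_lt _ _ HD).
  assert (Hn : 0 < Cmod (qeval Q (x, y))) by (apply Cmod_gt_0; now apply (qeval_nonzero D)).
  unfold warg. simpl Im.
  replace (IZR D * y ^ 2 / Cmod (qeval Q (x, y)) ^ 2) with ((sqrt (IZR D) * y / Cmod (qeval Q (x, y))) ^ 2).
  - apply sqrt_pow2. apply Rmult_le_pos.
    + apply Rmult_le_pos; [apply sqrt_pos | lra].
    + left. now apply Rinv_0_lt_compat.
  - unfold Rdiv. rewrite !Rpow_mult_distr, pow2_sqrt by lra. rewrite pow_inv. ring.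
Qed.

(** Substituting sqrt w = sqrt D y / |q| gives |q^m| sqrt w^j = O(|q|^(m-j)) = O(|q|^-k).
    Differentiating multiplies the size only by bounded factors, since both the derivative of q
    relative to q and that of w relative to w are O(1) on the box. *)
Lemma gterm_bounds (sg : R -> R) (m k : Z) (j : nat) (g g' : R -> C) (D : Z) (x0 y0 : R) :
  (0 < D)%Z -> (2 <= k)%Z -> (m - Z.of_nat j = - k)%Z ->
  (forall u, Rabs (sg u) <= 1) -> profile_bound g g' j ->
  0 < y0 -> ~ E_D D (x0, y0) ->
  exists d K, 0 < d /\ d <= y0 / 2 /\ 0 <= K /\
    forall Q x y, Q_D D Q -> Rabs (x - x0) <= d -> Rabs (y - y0) <= d ->
      Q_sub_z Q (x, y) <> 0 /\
      Cmod (gterm sg m g D (x, y) Q) <= K * / qn Q /\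
      forall qv pv, Cmod qv <= Cmod (dqeval Q (x, y)) ->
        Rabs pv <= Cmod (qeval Q (x, y)) / y ^ 2 ->
        Cmod (dgterm sg m g g' D (x, y) Q qv pv) <= K * / qn Q.
Proof.
  intros HD Hk Hmj Hsg Hg Hy0 HE. assert (HDR := IZR_lt _ _ HD).
  destruct (box_bounds D x0 y0 HD Hy0 HE) as (d & v & K & Hd & Hd2 & Hv & HK & Hbox).
  set (w0 := IZR D / (v ^ 2 + IZR D)).
  assert (Hv2 : 0 < v ^ 2) by (apply pow_lt; auto).
  assert (Hw0 : 0 <= w0 < 1).
  { unfold w0. split; [left; apply Rdiv_lt_0_compat; lra|].
    apply (Rmult_lt_reg_r (v ^ 2 + IZR D)); [lra|].
    replace (_ / _ * _) with (IZR D) by (field; lra). lra. }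
  destruct (Hg w0 Hw0) as (M & HM & HgM).
  set (c := y0 / 2 * v). assert (Hc : 0 < c) by (unfold c; nra).
  (* Of |q|^-k, two powers become [/ qn Q]; the other k - 2 are bounded using |q| >= c. *)
  set (k' := Z.to_nat (k - 2)).
  set (C1 := (sqrt (IZR D) * (2 * y0)) ^ j * (/ c ^ 2 * / c ^ k')).
  assert (HC1 : 0 <= C1).
  { unfold C1. apply Rmult_le_pos.
    - apply pow_le, Rmult_le_pos; [apply sqrt_pos | lra].
    - apply Rmult_le_pos; left; apply Rinv_0_lt_compat, pow_lt; auto. }
  (* K1 bounds |m qv / q| and K2 bounds the derivative of w divided by w. *)
  set (K1 := Rabs (IZR m) * (K / c)). set (K2 := 8 * K / (v * y0 ^ 2)).
  assert (Hy02 : 0 < y0 ^ 2) by (apply pow_lt; auto).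
  assert (HK1 : 0 <= K1).
  { unfold K1. apply Rmult_le_pos; [apply Rabs_pos | left; apply Rdiv_lt_0_compat; lra]. }
  assert (HK2 : 0 <= K2) by (unfold K2; left; apply Rdiv_lt_0_compat; nra).
  exists d, ((1 + K1 + K2) * M * C1). split; [auto|]. split; [auto|].
  split; [apply Rmult_le_pos; [apply Rmult_le_pos; lra | exact HC1]|].
  intros Q x y HQ Hx Hyd. destruct (Hbox Q x y HQ Hx Hyd) as (Hp & Hq & Hdq).
  pose proof (Rabs_le_center _ _ _ Hyd) as By. pose proof (rqn_ge1 Q) as Hr.
  assert (Hy : 0 < y) by lra.
  assert (HvN : v <= v * rqn Q) by nra.
  assert (Hqn := qeval_nonzero D Q x y HD HQ Hy).
  assert (Hn : 0 < Cmod (qeval Q (x, y))) by (now apply Cmod_gt_0).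
  pose proof (Cmod_qeval_sqr D Q x y HQ ltac:(lra)) as En.
  assert (Hp0 : 0 < Rabs (Q_sub_z Q (x, y))) by lra.
  assert (Hp0' : Q_sub_z Q (x, y) <> 0) by (intros E; rewrite E, Rabs_R0 in Hp0; lra).
  split; [exact Hp0'|].
  pose proof (warg_01 D Q x y HD HQ Hy Hp0') as Hw.
  pose proof (warg_Q_sub_z D Q x y HD HQ Hy) as Ew.
  pose proof (sqrt_warg D Q x y HD HQ Hy) as Esw.
  pose proof (pow2_abs (Q_sub_z Q (x, y))) as Eabs.
  set (p := Q_sub_z Q (x, y)) in *. set (w := warg D Q (x, y)) in *.
  set (q := qeval Q (x, y)) in *. set (n := Cmod q) in *. set (N := rqn Q) in *.
  assert (Hww : w <= w0).
  { rewrite Ew. unfold w0, Rdiv. apply Rmult_le_compat_l; [lra|].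
    apply Rinv_le_contravar; [lra|].
    assert (v ^ 2 <= Rabs p ^ 2) by (apply pow_incr; lra). lra. }
  destruct (HgM w ltac:(lra)) as [G1 G2].
  assert (HcN : c * N <= n).
  { assert (Hyp : y * Rabs p <= n).
    { rewrite <- (Rabs_pos_eq n), <- (Rabs_pos_eq y), <- Rabs_mult by lra.
      apply Rsqr_le_abs_0. rewrite !Rsqr_pow2, En, Rpow_mult_distr.
      apply Rmult_le_compat_l; [apply pow2_ge_0 | lra]. }
    unfold c. assert (y0 / 2 * (v * N) <= y * Rabs p) by (apply Rmult_le_compat; lra). lra. }
  assert (Hcn : c <= n) by (assert (c * 1 <= c * N) by (apply Rmult_le_compat_l; lra); lra).
  assert (HcN0 : 0 < c * N) by (apply Rmult_lt_0_compat; lra).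
  assert (HP : powerRZ n m * sqrt w ^ j <= C1 * / qn Q).
  { rewrite Esw. unfold Rdiv. rewrite Rpow_mult_distr, pow_inv.
    replace m with (Z.of_nat j + - k)%Z by lia. rewrite powerRZ_add, <- pow_powerRZ by lra.
    replace (- k)%Z with (- Z.of_nat (2 + k'))%Z by (unfold k'; lia).
    rewrite powerRZ_neg', <- pow_powerRZ.
    replace (n ^ j * / n ^ (2 + k') * ((sqrt (IZR D) * y) ^ j * / n ^ j))
      with ((sqrt (IZR D) * y) ^ j * (/ n ^ 2 * / n ^ k'))
      by (rewrite pow_add; field; repeat split; try apply pow_nonzero; lra).
    unfold C1. rewrite <- rqn_sqr. fold N.
    replace ((sqrt (IZR D) * (2 * y0)) ^ j * (/ c ^ 2 * / c ^ k') * / (N * N))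
      with ((sqrt (IZR D) * (2 * y0)) ^ j * (/ (c * N) ^ 2 * / c ^ k'))
      by (field; repeat split; try apply pow_nonzero; lra).
    pose proof (sqrt_pos (IZR D)).
    apply Rmult_le_compat.
    - apply pow_le, Rmult_le_pos; lra.
    - apply Rmult_le_pos; left; apply Rinv_0_lt_compat, pow_lt; auto.
    - apply pow_incr; split; [apply Rmult_le_pos; lra | apply Rmult_le_compat_l; lra].
    - apply Rmult_le_compat; try (left; apply Rinv_0_lt_compat, pow_lt; auto; fail);
        apply Rinv_le_contravar; try (apply pow_lt; auto); apply pow_incr; lra. }
  assert (Hs : 0 <= sqrt w ^ j) by (apply pow_le, sqrt_pos).
  assert (Hnm : 0 < powerRZ n m) by (apply powerRZ_lt; auto).
  assert (HMP : powerRZ n m * (M * sqrt w ^ j) <= M * C1 * / qn Q).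
  { replace (powerRZ n m * (M * sqrt w ^ j)) with (M * (powerRZ n m * sqrt w ^ j)) by ring.
    rewrite Rmult_assoc. now apply Rmult_le_compat_l. }
  assert (HMs : 0 <= M * sqrt w ^ j) by (apply Rmult_le_pos; auto).
  assert (HMC : 0 <= M * C1 * / qn Q).
  { apply Rmult_le_pos; [apply Rmult_le_pos; auto|].
    left; apply Rinv_0_lt_compat; pose proof (qn_ge1 Q); lra. }
  assert (HK12 : 0 <= (K1 + K2) * (M * C1 * / qn Q)) by (apply Rmult_le_pos; lra).
  split.
  - unfold gterm. fold p q w. rewrite !Cmod_mult, Cmod_R, Cmod_Cpow_Z by auto. fold n.
    apply (Rle_trans _ (1 * powerRZ n m * (M * sqrt w ^ j))).
    + apply Rmult_le_compat; auto using Cmod_ge_0.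
      * apply Rmult_le_pos; [apply Rabs_pos | lra].
      * apply Rmult_le_compat_r; auto; lra.
    + rewrite Rmult_1_l. lra.
  - intros qv pv Hqv Hpv. unfold dgterm. fold p q w. cbv zeta.
    rewrite Cmod_mult, Cmod_R.
    apply (Rle_trans _ (1 * ((K1 + K2) * (powerRZ n m * (M * sqrt w ^ j))))).
    2: { rewrite Rmult_1_l.
         assert ((K1 + K2) * (powerRZ n m * (M * sqrt w ^ j)) <= (K1 + K2) * (M * C1 * / qn Q))
           by (apply Rmult_le_compat_l; lra). lra. }
    apply Rmult_le_compat; auto using Rabs_pos, Cmod_ge_0.
    eapply Rle_trans; [apply Cmod_triangle|].
    rewrite !Cmod_mult, !Cmod_R, !Cmod_Cpow_Z by auto. fold n.
    rewrite Rmult_plus_distr_r. apply Rplus_le_compat.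
    + replace (powerRZ n m) with (powerRZ n (m - 1) * n).
      2: { replace m with ((m - 1) + 1)%Z at 2 by lia. rewrite powerRZ_add by lra. simpl. ring. }
      assert (Hnm1 : 0 < powerRZ n (m - 1)) by (apply powerRZ_lt; auto).
      assert (HqN : Cmod qv <= K / c * n).
      { apply (Rle_trans _ (K * N)); [lra|].
        replace (K * N) with (K / c * (c * N)) by (field; lra).
        apply Rmult_le_compat_l; auto. left; apply Rdiv_lt_0_compat; lra. }
      unfold K1.
      replace (Rabs (IZR m) * (K / c) * (powerRZ n (m - 1) * n * (M * sqrt w ^ j)))
        with (Rabs (IZR m) * (K / c * n) * powerRZ n (m - 1) * (M * sqrt w ^ j)) by ring.
      apply Rmult_le_compat; auto using Cmod_ge_0.
      * apply Rmult_le_pos; [apply Rmult_le_pos; [apply Rabs_pos | apply Cmod_ge_0] | lra].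
      * apply Rmult_le_compat_r; [lra|]. apply Rmult_le_compat_l; auto using Rabs_pos.
    + replace (K2 * (powerRZ n m * (M * sqrt w ^ j))) with (powerRZ n m * (K2 * (M * sqrt w ^ j))) by ring.
      apply Rmult_le_compat_l; [lra|].
      assert (Hcoef : Rabs (- (2 * p * w ^ 2 / IZR D) * pv) <= K2 * w).
      { rewrite Rabs_mult, Rabs_Ropp. unfold Rdiv at 1.
        rewrite !Rabs_mult, (Rabs_pos_eq 2), (Rabs_pos_eq (w ^ 2)), (Rabs_pos_eq (/ IZR D));
          try (left; apply Rinv_0_lt_compat; lra); try (apply pow2_ge_0); try lra.
        assert (Hn2 : Rabs pv <= 4 * K * N / y0 ^ 2).
        { eapply Rle_trans; [exact Hpv|].
          apply (Rle_trans _ (K * N * / y ^ 2)).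
          - unfold Rdiv. apply Rmult_le_compat_r; auto. left; apply Rinv_0_lt_compat, pow_lt; auto.
          - replace (4 * K * N / y0 ^ 2) with (K * N * / (y0 / 2) ^ 2) by (field; lra).
            apply Rmult_le_compat_l; [nra|]. apply Rinv_le_contravar; [apply pow_lt; lra|].
            apply pow_incr; lra. }
        (* The left side is |p| / (p^2 + D) <= 1 / |p|; this gain of 1 / |Q| offsets the growth |pv|
           = O(|Q|). *)
        assert (Hpw : Rabs p * w * / IZR D <= / (v * N)).
        { rewrite Ew. replace (Rabs p * (IZR D / (p ^ 2 + IZR D)) * / IZR D)
            with (Rabs p * / (p ^ 2 + IZR D)) by (field; pose proof (pow2_ge_0 p); lra).
          apply (Rle_trans _ (/ Rabs p)).
          - apply (Rmult_le_reg_r (Rabs p * (p ^ 2 + IZR D))).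
            { apply Rmult_lt_0_compat; auto. pose proof (pow2_ge_0 p); lra. }
            replace (Rabs p * / (p ^ 2 + IZR D) * _) with (Rabs p ^ 2)
              by (field; pose proof (pow2_ge_0 p); lra).
            replace (/ Rabs p * _) with (p ^ 2 + IZR D) by (field; lra). lra.
          - apply Rinv_le_contravar; nra. }
        replace (2 * Rabs p * w ^ 2 * / IZR D * Rabs pv)
          with (2 * w * ((Rabs p * w * / IZR D) * Rabs pv)) by ring.
        assert (Hprod : (Rabs p * w * / IZR D) * Rabs pv <= / (v * N) * (4 * K * N / y0 ^ 2)).
        { apply Rmult_le_compat; auto using Rabs_pos.
          apply Rmult_le_pos; [apply Rmult_le_pos; [apply Rabs_pos | lra]|].
          left; apply Rinv_0_lt_compat; lra. }
        replace (/ (v * N) * (4 * K * N / y0 ^ 2)) with (K2 / 2) in Hprod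
          by (unfold K2; field; repeat split; lra).
        assert (2 * w * ((Rabs p * w * / IZR D) * Rabs pv) <= 2 * w * (K2 / 2))
          by (apply Rmult_le_compat_l; lra). lra. }
      apply (Rle_trans _ (K2 * w * Cmod (g' w))).
      * apply Rmult_le_compat_r; auto using Cmod_ge_0.
      * replace (K2 * w * Cmod (g' w)) with (K2 * (Cmod (g' w) * w)) by ring.
        apply Rmult_le_compat_l; auto.
Qed.

(** * Termwise differentiation *)

(** The last factor is dw/dzbar, the product of dw/dp = -2 p w^2 / D and dp/dzbar = - i q / (2
    y^2). *)
Definition gterm_dbar (sg : R -> R) (m : Z) (g' : R -> C) (D : Z) (z : C) (Q : qform) : C :=
  let p := Q_sub_z Q z in let q := qeval Q z in let w := warg D Q z in
  (RtoC (sg p) * Cpow_Z q m * g' w * (Ci * RtoC (p * w ^ 2 / (IZR D * Im z ^ 2)) * q))%C.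

Lemma Rmin_Rmax_center (x u d t : R) : Rabs (u - x) <= d ->
  Rmin x u <= t <= Rmax x u -> Rabs (t - x) <= d.
Proof.
  intros Hu Ht. apply Rabs_le. apply Rabs_le_between in Hu.
  unfold Rmin, Rmax in Ht. destruct (Rle_dec x u); lra.
Qed.

Lemma Cmod_Ci_mult (z : C) : Cmod (Ci * z)%C = Cmod z.
Proof. rewrite Cmod_mult, Cmod_Ci. ring. Qed.

Lemma ex_Csum_gterm (sg : R -> R) (m k : Z) (j : nat) (g g' : R -> C) (D : Z) (x0 y0 : R) :
  (0 < D)%Z -> (2 <= k)%Z -> (m - Z.of_nat j = - k)%Z ->
  (forall u, Rabs (sg u) <= 1) -> profile_bound g g' j ->
  0 < y0 -> ~ E_D D (x0, y0) ->
  ex_Csum (Q_D D) (gterm sg m g D (x0, y0)).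
Proof.
  intros HD Hk Hmj Hsg Hg Hy0 HE.
  destruct (gterm_bounds sg m k j g g' D x0 y0 HD Hk Hmj Hsg Hg Hy0 HE) as (d & K & Hd & _ & HK & HB).
  apply (ex_Csum_dominated _ _ (fun Q => K * / qn Q)).
  - apply summable_on_scal; auto. now apply summable_Q_D.
  - intros Q HQ. apply (HB Q x0 y0 HQ); rewrite Rminus_diag, Rabs_R0; lra.
Qed.

(** [is_deriveC_Csum] is applied along the horizontal and the vertical line through the point; the
    bounds on the whole box give, by the mean value theorem, the Lipschitz constants it requires. *)
Lemma is_dbar_Csum_gterm (sg : R -> R) (m k : Z) (j : nat) (g g' : R -> C) (D : Z) (x0 y0 : R) :
  (0 < D)%Z -> (2 <= k)%Z -> (m - Z.of_nat j = - k)%Z ->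
  (forall u, Rabs (sg u) <= 1) -> (forall u, u <> 0 -> is_derive sg u 0) ->
  (forall w, 0 < w < 1 -> is_deriveC g w (g' w)) -> profile_bound g g' j ->
  0 < y0 -> ~ E_D D (x0, y0) ->
  ex_Csum (Q_D D) (gterm_dbar sg m g' D (x0, y0)) /\
  is_dbar (fun z => Csum (Q_D D) (gterm sg m g D z)) (x0, y0)
    (Csum (Q_D D) (gterm_dbar sg m g' D (x0, y0))).
Proof.
  intros HD Hk Hmj Hsg Hsgd Hgd Hg Hy0 HE. assert (HDR := IZR_lt _ _ HD).
  destruct (gterm_bounds sg m k j g g' D x0 y0 HD Hk Hmj Hsg Hg Hy0 HE)
    as (d & K & Hd & Hd2 & HK & HB).
  assert (HC0 : forall u : R, Rabs (u - u) <= d) by (intros u; rewrite Rminus_diag, Rabs_R0; lra).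
  set (dx := fun Q x y => dgterm sg m g g' D (x, y) Q (dqeval Q (x, y)) (Im (qeval Q (x, y)) / y ^ 2)).
  set (dy := fun Q x y => dgterm sg m g g' D (x, y) Q (Ci * dqeval Q (x, y))%C (- Re (qeval Q (x, y)) / y ^ 2)).
  assert (HBx : forall Q x y, Q_D D Q -> Rabs (x - x0) <= d -> Rabs (y - y0) <= d ->
      Cmod (dx Q x y) <= K * / qn Q /\ Cmod (dy Q x y) <= K * / qn Q).
  { intros Q x y HQ Hx Hy. destruct (HB Q x y HQ Hx Hy) as (_ & _ & H).
    assert (Hy2 : 0 < y ^ 2) by (apply Rabs_le_center in Hy; apply pow_lt; lra).
    split; apply H.
    - lra.
    - unfold Rdiv. rewrite Rabs_mult, (Rabs_pos_eq (/ y ^ 2)) by (left; now apply Rinv_0_lt_compat).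
      apply Rmult_le_compat_r; [left; now apply Rinv_0_lt_compat | apply im_le_Cmod].
    - rewrite Cmod_Ci_mult. lra.
    - unfold Rdiv. rewrite Rabs_mult, Rabs_Ropp, (Rabs_pos_eq (/ y ^ 2)) by (left; now apply Rinv_0_lt_compat).
      apply Rmult_le_compat_r; [left; now apply Rinv_0_lt_compat | apply re_le_Cmod]. }
  assert (Hdx : forall Q x, Q_D D Q -> Rabs (x - x0) <= d ->
     is_deriveC (fun t => gterm sg m g D (t, y0) Q) x (dx Q x y0)).
  { intros Q x HQ Hx. destruct (HB Q x y0 HQ Hx (HC0 y0)) as (Hp & _ & _).
    apply (is_deriveC_gterm sg m g g' D Q (fun t => (t, y0))); auto.
    - apply filter_forall. intros u. exact Hy0.
    - apply is_deriveC_qeval_x.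
    - now apply is_derive_Q_sub_z_x. }
  assert (Hdy : forall Q y, Q_D D Q -> Rabs (y - y0) <= d ->
     is_deriveC (fun t => gterm sg m g D (x0, t) Q) y (dy Q x0 y)).
  { intros Q y HQ Hy. destruct (HB Q x0 y HQ (HC0 x0) Hy) as (Hp & _ & _).
    assert (Hy' : 0 < y) by (apply Rabs_le_center in Hy; lra).
    apply (is_deriveC_gterm sg m g g' D Q (fun t => (x0, t))); auto.
    - exact (open_gt 0 y Hy').
    - apply is_deriveC_qeval_y.
    - now apply is_derive_Q_sub_z_y. }
  assert (Hsum : forall K', 0 <= K' -> summable_on (Q_D D) (fun Q => K' * / qn Q)).
  { intros K' HK'. apply summable_on_scal; auto. now apply summable_Q_D. }
  assert (Hinv : forall Q, 0 <= K * / qn Q).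
  { intros Q. apply Rmult_le_pos; auto. left. apply Rinv_0_lt_compat. pose proof (qn_ge1 Q); lra. }
  assert (HX : is_deriveC (fun u => Csum (Q_D D) (gterm sg m g D (u, y0))) x0
      (Csum (Q_D D) (fun Q => dx Q x0 y0))).
  (* The majorant is doubled to absorb the factor 2 of [mvt_Cmod]. *)
  { apply (is_deriveC_Csum (Q_D D) (fun Q => 2 * K * / qn Q) (fun u Q => gterm sg m g D (u, y0) Q) _ x0 d); auto.
    - apply Hsum; lra.
    - intros Q HQ. rewrite Rmult_assoc. pose proof (Hinv Q).
      destruct (HBx Q x0 y0 HQ (HC0 x0) (HC0 y0)). lra.
    - intros Q HQ. rewrite Rmult_assoc. pose proof (Hinv Q).
      destruct (HB Q x0 y0 HQ (HC0 x0) (HC0 y0)) as (_ & Hb & _). lra.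
    - intros Q u HQ Hu. rewrite (Rmult_assoc 2 K).
      apply (mvt_Cmod (fun u => gterm sg m g D (u, y0) Q) (fun u => dx Q u y0)); intros t Ht.
      + apply Hdx; auto. apply (Rmin_Rmax_center x0 u); auto; lra.
      + apply HBx; auto. apply (Rmin_Rmax_center x0 u); auto; lra. }
  assert (HY : is_deriveC (fun u => Csum (Q_D D) (gterm sg m g D (x0, u))) y0
      (Csum (Q_D D) (fun Q => dy Q x0 y0))).
  { apply (is_deriveC_Csum (Q_D D) (fun Q => 2 * K * / qn Q) (fun u Q => gterm sg m g D (x0, u) Q) _ y0 d); auto.
    - apply Hsum; lra.
    - intros Q HQ. rewrite Rmult_assoc. pose proof (Hinv Q).
      destruct (HBx Q x0 y0 HQ (HC0 x0) (HC0 y0)). lra.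
    - intros Q HQ. rewrite Rmult_assoc. pose proof (Hinv Q).
      destruct (HB Q x0 y0 HQ (HC0 x0) (HC0 y0)) as (_ & Hb & _). lra.
    - intros Q u HQ Hu. rewrite (Rmult_assoc 2 K).
      apply (mvt_Cmod (fun u => gterm sg m g D (x0, u) Q) (fun u => dy Q x0 u)); intros t Ht.
      + apply Hdy; auto. apply (Rmin_Rmax_center y0 u); auto; lra.
      + apply HBx; auto. apply (Rmin_Rmax_center y0 u); auto; lra. }
  assert (Ex : ex_Csum (Q_D D) (fun Q => dx Q x0 y0)).
  { apply (ex_Csum_dominated _ _ (fun Q => K * / qn Q)); auto.
    intros Q HQ. now apply HBx. }
  assert (Ey : ex_Csum (Q_D D) (fun Q => dy Q x0 y0)).
  { apply (ex_Csum_dominated _ _ (fun Q => K * / qn Q)); auto.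
    intros Q HQ. now apply HBx. }
  assert (H2 : RtoC 2 <> 0%C) by (apply RtoC_nonzero; lra).
  pose proof (is_Csum_scal _ (/ 2)%C _ _ (is_Csum_plus _ _ _ _ _ (Csum_correct _ _ Ex)
     (is_Csum_scal _ Ci _ _ (Csum_correct _ _ Ey)))) as HS.
  assert (HS' : is_Csum (Q_D D) (gterm_dbar sg m g' D (x0, y0))
     ((Csum (Q_D D) (fun Q => dx Q x0 y0) + Ci * Csum (Q_D D) (fun Q => dy Q x0 y0)) / 2)%C).
  { replace (_ / 2)%C with (/ 2 * (Csum (Q_D D) (fun Q => dx Q x0 y0) + Ci * Csum (Q_D D) (fun Q => dy Q x0 y0)))%C
      by (field; auto).
    eapply is_Csum_ext; [|exact HS]. intros Q HQ. cbv beta.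
    unfold dx, dy, dgterm, gterm_dbar. cbv zeta. simpl (Im (x0, y0)).
    set (p := Q_sub_z Q (x0, y0)). set (q := qeval Q (x0, y0)). set (w := warg D Q (x0, y0)).
    set (e := (2 * p * w ^ 2 / IZR D)).
    transitivity (RtoC (sg p) * (/ 2 * (RtoC (IZR m) * (1 + Ci * Ci) * dqeval Q (x0, y0) * Cpow_Z q (m - 1) * g w)
      + Cpow_Z q m * g' w * (/ 2 * (RtoC (- e * (Im q / y0 ^ 2)) + Ci * RtoC (- e * (- Re q / y0 ^ 2))))))%C; [ring|].
    (* Holomorphy of q: its horizontal and vertical derivatives cancel in the combination defining
       dbar. *)
    replace (1 + Ci * Ci)%C with (RtoC 0) by (apply injective_projections; simpl; ring).
    replace (/ 2 * (RtoC (- e * (Im q / y0 ^ 2)) + Ci * RtoC (- e * (- Re q / y0 ^ 2))))%C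
      with (Ci * RtoC (p * w ^ 2 / (IZR D * y0 ^ 2)) * q)%C.
    - ring.
    - unfold e. destruct q as [q1 q2]. apply injective_projections; simpl; field; lra. }
  split; [eexists; exact HS'|].
  rewrite (is_Csum_unique _ _ _ HS').
  exists (Csum (Q_D D) (fun Q => dx Q x0 y0)), (Csum (Q_D D) (fun Q => dy Q x0 y0)).
  split; [exact HX | split; [exact HY | reflexivity]].
Qed.

(** * Growth of the two profiles and the xi-identities for single terms *)

Lemma is_derive_sign (u : R) : u <> 0 -> is_derive sign u 0.
Proof.
  intros Hu. destruct (Rdichotomy _ _ Hu) as [H|H].
  - apply (is_derive_ext_loc (fun _ => -1)).
    + refine (filter_imp _ _ _ (open_lt 0 u H)). intros v Hv. symmetry. now apply sign_eq_m1.
    + exact (is_derive_const (-1 : R_NormedModule) u).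
  - apply (is_derive_ext_loc (fun _ => 1)).
    + refine (filter_imp _ _ _ (open_gt 0 u H)). intros v Hv. symmetry. now apply sign_eq_1.
    + exact (is_derive_const (1 : R_NormedModule) u).
Qed.

Lemma Rabs_sign_le1 (u : R) : Rabs (sign u) <= 1.
Proof.
  destruct (Rtotal_order u 0) as [H|[H|H]].
  - rewrite sign_eq_m1 by auto. rewrite Rabs_left; lra.
  - subst. rewrite sign_0, Rabs_R0. lra.
  - rewrite sign_eq_1 by auto. rewrite Rabs_R1. lra.
Qed.

Lemma profile_bound_scal (c : C) (g g' h h' : R -> C) (j : nat) :
  profile_bound g g' j ->
  (forall w, 0 < w < 1 -> h w = (c * g w)%C) -> (forall w, 0 < w < 1 -> h' w = (c * g' w)%C) ->
  profile_bound h h' j.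
Proof.
  intros H E E' w0 Hw0. destruct (H w0 Hw0) as (M & HM & HB).
  pose proof (Cmod_ge_0 c) as Hc.
  exists (Cmod c * M). split; [now apply Rmult_le_pos|]. intros w Hw.
  rewrite E, E', !Cmod_mult, !Rmult_assoc by lra.
  destruct (HB w Hw). split; apply Rmult_le_compat_l; auto.
Qed.

(** At Re s = k/2 + 1/4 the exponent of w is purely imaginary, so j = 0; all decay then comes from
    q^(-k). *)
Lemma profile_bound_phi (k D : Z) (s : C) : (0 < k)%Z -> IZR k / 2 + 1 / 4 <= Re s ->
  profile_bound (phi k s D) (dphi k s D) 0.
Proof.
  intros Hk Hs. apply IZR_lt in Hk.
  apply (profile_bound_scal (phi_const k s D)
    (hprofile (s + RtoC (IZR k / 2) - RtoC (1/4)) (s - RtoC (IZR k / 2) - RtoC (1/4)) (RtoC 2 * s))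
    (dhprofile (s + RtoC (IZR k / 2) - RtoC (1/4)) (s - RtoC (IZR k / 2) - RtoC (1/4)) (RtoC 2 * s))).
  - intros w0 Hw0. apply hprofile_bounds; auto.
    + rewrite Re_2s. lra.
    + unfold Re in *. simpl in *. lra.
  - intros w Hw. apply phi_hprofile; auto; lra.
  - reflexivity.
Qed.

(** Here the exponent of w has real part at least k - 1/2, and j = 2k - 1 brings q^(k-1) down to
    |q|^-k. *)
Lemma profile_bound_phi_star (k D : Z) (s : C) : (0 < k)%Z -> IZR k / 2 + 1 / 4 <= Re s ->
  profile_bound (phi_star k s D) (dphi_star k s D) (Z.to_nat (2 * k - 1)).
Proof.
  intros Hk Hs. assert (Hk' := IZR_lt _ _ Hk).
  apply (profile_bound_scal (phi_star_const k s D)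
    (hprofile (s - RtoC (IZR k / 2) + RtoC (1/4)) (s + RtoC (IZR k / 2) - RtoC (3/4)) (RtoC 2 * s))
    (dhprofile (s - RtoC (IZR k / 2) + RtoC (1/4)) (s + RtoC (IZR k / 2) - RtoC (3/4)) (RtoC 2 * s))).
  - intros w0 Hw0. apply hprofile_bounds; auto.
    + rewrite Re_2s. lra.
    + rewrite INR_IZR_INZ, Z2Nat.id, minus_IZR, mult_IZR by lia. unfold Re in *. simpl in *. lra.
  - intros w Hw. apply phi_star_hprofile; auto; lra.
  - reflexivity.
Qed.

Lemma Cpow_Z_mult (a b : C) (n : Z) : a <> 0%C -> b <> 0%C ->
  Cpow_Z (a * b) n = (Cpow_Z a n * Cpow_Z b n)%C.
Proof.
  intros Ha Hb. destruct n; simpl.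
  - ring.
  - apply Cpow_mult_l.
  - rewrite Cpow_mult_l. field. split; now apply Cpow_nz.
Qed.

Lemma Cpow_Z_RtoC (r : R) (n : Z) : r <> 0 -> Cpow_Z (RtoC r) n = RtoC (powerRZ r n).
Proof.
  intros Hr. destruct n; simpl; auto.
  - now rewrite RtoC_pow.
  - rewrite RtoC_inv by now apply pow_nonzero. now rewrite RtoC_pow.
Qed.

(** The conjugate of q is |q|^2 / q; this turns antiholomorphic powers into holomorphic ones of
    opposite exponent. *)
Lemma Cpow_Z_Cconj_eq (q : C) (n : Z) : q <> 0%C ->
  Cconj (Cpow_Z q n) = (RtoC (powerRZ (Cmod q ^ 2) n) * Cpow_Z q (- n))%C.
Proof.
  intros Hq. rewrite Cpow_Z_conj by auto.
  assert (Hc : Cconj q <> 0%C).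
  { intros E. apply Hq. rewrite <- (Cconj_conj q), E. apply RtoC_conj. }
  assert (Hm : Cmod q ^ 2 <> 0) by (apply pow_nonzero, Rgt_not_eq; now apply Cmod_gt_0).
  rewrite <- Cpow_Z_RtoC, Cmod2_conj, Cpow_Z_mult by auto.
  transitivity (Cpow_Z (Cconj q) n * (Cpow_Z q n * Cpow_Z q (- n)))%C; [|ring].
  rewrite <- Cpow_Z_add, Z.add_opp_diag_r by auto. simpl. ring.
Qed.

Lemma Rpower_minus_half (X : R) (k : Z) : 0 < X ->
  Rpower X (IZR k - 1 / 2) = powerRZ X k / sqrt X.
Proof.
  intros HX. unfold Rminus. rewrite Rpower_plus, <- powerRZ_Rpower by auto.
  unfold Rdiv at 2. f_equal. replace (- (1 / 2)) with (- / 2) by field.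
  rewrite Rpower_Ropp, Rpower_sqrt by auto. reflexivity.
Qed.

Lemma sqrt_1m_warg (d p : R) : 0 < d ->
  sqrt (1 - d / (p ^ 2 + d)) = Rabs p / sqrt (p ^ 2 + d).
Proof.
  intros Hd. pose proof (pow2_ge_0 p).
  replace (1 - d / (p ^ 2 + d)) with (p ^ 2 / (p ^ 2 + d)) by (field; lra).
  rewrite sqrt_div_alt by lra. now rewrite <- pow2_abs, sqrt_pow2 by apply Rabs_pos.
Qed.

Lemma sign_mult_Rabs (p : R) : sign p * Rabs p = p.
Proof.
  destruct (Rtotal_order p 0) as [H|[H|H]].
  - rewrite sign_eq_m1, Rabs_left by auto. ring.
  - subst. rewrite sign_0. ring.
  - rewrite sign_eq_1, Rabs_pos_eq by lra. ring.
Qed.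

Lemma sign_mult_self (p : R) : sign p * p = Rabs p.
Proof.
  destruct (Rtotal_order p 0) as [H|[H|H]].
  - rewrite sign_eq_m1, Rabs_left by auto. ring.
  - subst. rewrite sign_0, Rabs_R0. ring.
  - rewrite sign_eq_1, Rabs_pos_eq by lra. ring.
Qed.

Lemma Cconj_Ci : Cconj Ci = (- Ci)%C.
Proof. apply injective_projections; simpl; ring. Qed.

(** Conjugating q^(m+1) yields |q|^(2m+2) q^(-m-1) with |q|^2 = y^2 X. For kappa = -2m the powers of
    y cancel exactly, leaving a function of p alone times q^(-m-1). *)
Lemma xi_gterm_dbar (sg : R -> R) (m : Z) (g' : R -> C) (D kappa : Z) (Q : qform) (x y : R) :
  (0 < D)%Z -> Q_D D Q -> 0 < y -> (kappa = - 2 * m)%Z ->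
  let p := Q_sub_z Q (x, y) in let X := p ^ 2 + IZR D in let w := warg D Q (x, y) in
  (RtoC 2 * Ci * RtoC (powerRZ y kappa) * Cconj (gterm_dbar sg m g' D (x, y) Q) =
   RtoC (2 * sg p * p * w * powerRZ X m) * Cpow_Z (qeval Q (x, y)) (- m - 1) * Cconj (g' w))%C.
Proof.
  intros HD HQ Hy Hk p X w. assert (HDR := IZR_lt _ _ HD).
  assert (Hq := qeval_nonzero D Q x y HD HQ Hy).
  assert (HX : 0 < X) by (unfold X; pose proof (pow2_ge_0 p); lra).
  pose proof (warg_Q_sub_z D Q x y HD HQ Hy) as Ew. fold p X w in Ew.
  unfold gterm_dbar. cbv zeta. simpl (Im (x, y)). fold p w. set (q := qeval Q (x, y)) in *.
  rewrite !Cmult_conj, !RtoC_conj, Cconj_Ci.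
  set (P := powerRZ y (m + 1)).
  assert (EP : powerRZ y kappa * (P * P) = y ^ 2).
  { unfold P. rewrite <- !powerRZ_add, pow_powerRZ by lra. f_equal. lia. }
  assert (EX : powerRZ X (m + 1) = powerRZ X m * X) by (rewrite powerRZ_add by lra; simpl; ring).
  assert (Eqq : (Cconj (Cpow_Z q m) * Cconj q)%C =
     (RtoC (P * P * (powerRZ X m * X)) * Cpow_Z q (- m - 1))%C).
  { rewrite <- Cmult_conj, (Cmult_comm _ q), <- Cpow_Z_succ, Cpow_Z_Cconj_eq by auto.
    replace (- (m + 1))%Z with (- m - 1)%Z by lia. do 2 f_equal.
    unfold q. rewrite (Cmod_qeval_sqr D) by (auto; lra). fold p X.
    rewrite powerRZ_mult, EX. simpl pow. rewrite Rmult_1_r, powerRZ_mult. reflexivity. }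
  transitivity (- (Ci * Ci) * RtoC (2 * powerRZ y kappa * sg p * (p * w ^ 2 / (IZR D * y ^ 2)))
     * (Cconj (Cpow_Z q m) * Cconj q) * Cconj (g' w))%C.
  { rewrite !RtoC_mult. ring. }
  replace (- (Ci * Ci))%C with (RtoC 1) by (apply injective_projections; simpl; ring).
  rewrite Eqq.
  transitivity (RtoC (2 * powerRZ y kappa * sg p * (p * w ^ 2 / (IZR D * y ^ 2)) * (P * P * (powerRZ X m * X)))
     * Cpow_Z q (- m - 1) * Cconj (g' w))%C.
  { rewrite (RtoC_mult (2 * powerRZ y kappa * sg p * (p * w ^ 2 / (IZR D * y ^ 2)))). ring. }
  do 3 f_equal.
  replace (2 * powerRZ y kappa * sg p * (p * w ^ 2 / (IZR D * y ^ 2)) * (P * P * (powerRZ X m * X)))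
    with (2 * sg p * (p * w ^ 2 / (IZR D * y ^ 2)) * (powerRZ y kappa * (P * P)) * (powerRZ X m * X)) by ring.
  rewrite EP, Ew. field. lra.
Qed.

(** The sign of F is consumed: sgn(p) p = |p| = sqrt (1 - w) sqrt (p^2 + D), which is the factor in
    [dphi_star_relation]. *)
Lemma xi_F_term (k D : Z) (s : C) (Q : qform) (x y : R) :
  (0 < D)%Z -> Q_D D Q -> 0 < y -> Q_sub_z Q (x, y) <> 0 -> 1 / 2 <= Re s ->
  (RtoC 2 * Ci * RtoC (powerRZ y (2 - 2 * k)) *
     Cconj (gterm_dbar sign (k - 1) (dphi_star k s D) D (x, y) Q) =
   RtoC 2 * (Cconj s - RtoC (3 / 4) + RtoC (IZR k / 2)) * f_term k (Cconj s) D (x, y) Q)%C.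
Proof.
  intros HD HQ Hy Hp0 Hs. assert (HDR := IZR_lt _ _ HD).
  pose proof (warg_01 D Q x y HD HQ Hy Hp0) as Hw.
  pose proof (warg_Q_sub_z D Q x y HD HQ Hy) as Ew.
  rewrite xi_gterm_dbar by (auto; lia). unfold f_term.
  pose proof (dphi_star_relation k D s (warg D Q (x, y)) HD Hs Hw) as R.
  set (p := Q_sub_z Q (x, y)) in *. set (w := warg D Q (x, y)) in *.
  assert (HX : 0 < p ^ 2 + IZR D) by (pose proof (pow2_ge_0 p); lra).
  assert (HsX : 0 < sqrt (p ^ 2 + IZR D)) by (now apply sqrt_lt_R0).
  assert (EX : IZR D / w = p ^ 2 + IZR D) by (rewrite Ew; field; lra).
  rewrite EX in R. apply (f_equal Cconj) in R.
  rewrite !Cmult_conj, !RtoC_conj, (phi_conj k D s w) in R by (auto; lra).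
  rewrite Cminus_conj, Cplus_conj, !RtoC_conj in R.
  replace (- (k - 1) - 1)%Z with (- k)%Z by lia.
  replace (RtoC 2 * (Cconj s - RtoC (3 / 4) + RtoC (IZR k / 2)) *
    (Cpow_Z (qeval Q (x, y)) (- k) * phi k (Cconj s) D w))%C
   with (RtoC 2 * Cpow_Z (qeval Q (x, y)) (- k) *
     ((Cconj s + RtoC (IZR k / 2) - RtoC (3 / 4)) * phi k (Cconj s) D w))%C by ring.
  rewrite <- R.
  assert (E : sign p * p * w * powerRZ (p ^ 2 + IZR D) (k - 1) =
     sqrt (1 - w) * w * Rpower (p ^ 2 + IZR D) (IZR k - 1 / 2)).
  { rewrite sign_mult_self, Rpower_minus_half by auto.
    rewrite Ew at 2. rewrite sqrt_1m_warg by auto.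
    replace k with ((k - 1) + 1)%Z at 2 by lia. rewrite powerRZ_add by lra.
    replace (powerRZ (p ^ 2 + IZR D) 1) with (p ^ 2 + IZR D) by (simpl; ring). set (P := powerRZ (p ^ 2 + IZR D) (k - 1)).
    replace (P * (p ^ 2 + IZR D)) with (P * (sqrt (p ^ 2 + IZR D) * sqrt (p ^ 2 + IZR D)))
      by (rewrite sqrt_sqrt by lra; reflexivity).
    field. lra. }
  replace (2 * sign p * p * w * powerRZ (p ^ 2 + IZR D) (k - 1))
    with (2 * (sign p * p * w * powerRZ (p ^ 2 + IZR D) (k - 1))) by ring.
  rewrite E, !RtoC_mult. ring.
Qed.

(** The sign of F is produced: p = sgn(p) |p|, and |p| is absorbed by sqrt (1 - w) in
    [dphi_relation]. *)
Lemma xi_f_term (k D : Z) (s : C) (Q : qform) (x y : R) :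
  (0 < D)%Z -> Q_D D Q -> 0 < y -> Q_sub_z Q (x, y) <> 0 -> 1 / 2 <= Re s ->
  (RtoC 2 * Ci * RtoC (powerRZ y (2 * k)) *
     Cconj (gterm_dbar (fun _ => 1) (- k) (dphi k s D) D (x, y) Q) =
   RtoC 2 * (Cconj s - RtoC (IZR k / 2) - RtoC (1 / 4)) * F_term k (Cconj s) D (x, y) Q)%C.
Proof.
  intros HD HQ Hy Hp0 Hs. assert (HDR := IZR_lt _ _ HD).
  pose proof (warg_01 D Q x y HD HQ Hy Hp0) as Hw.
  pose proof (warg_Q_sub_z D Q x y HD HQ Hy) as Ew.
  rewrite xi_gterm_dbar by (auto; lia). unfold F_term.
  pose proof (dphi_relation k D s (warg D Q (x, y)) HD Hs Hw) as R.
  set (p := Q_sub_z Q (x, y)) in *. set (w := warg D Q (x, y)) in *.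
  assert (HX : 0 < p ^ 2 + IZR D) by (pose proof (pow2_ge_0 p); lra).
  assert (HsX : 0 < sqrt (p ^ 2 + IZR D)) by (now apply sqrt_lt_R0).
  assert (EX : IZR D / w = p ^ 2 + IZR D) by (rewrite Ew; field; lra).
  rewrite EX in R. apply (f_equal Cconj) in R.
  rewrite !Cmult_conj, !RtoC_conj, (phi_star_conj k D s w) in R by (auto; lra).
  rewrite !Cminus_conj, !RtoC_conj in R.
  replace (- - k - 1)%Z with (k - 1)%Z by lia.
  assert (Hpw := powerRZ_lt (p ^ 2 + IZR D) k HX).
  assert (E : 2 * 1 * p * w * powerRZ (p ^ 2 + IZR D) (- k) * Rpower (p ^ 2 + IZR D) (IZR k - 1 / 2)
     = 2 * sign p * (sqrt (1 - w) * w)).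
  { rewrite Rpower_minus_half, powerRZ_neg' by auto.
    rewrite Ew at 2. rewrite sqrt_1m_warg by auto.
    rewrite <- (sign_mult_Rabs p) at 1. field. lra. }
  set (Y := Rpower (p ^ 2 + IZR D) (IZR k - 1 / 2)) in *.
  assert (HY : RtoC Y <> 0%C) by (apply RtoC_nonzero, Rpower_neq_0).
  transitivity (RtoC (2 * 1 * p * w * powerRZ (p ^ 2 + IZR D) (- k) * Y) * / RtoC Y
     * Cpow_Z (qeval Q (x, y)) (k - 1) * Cconj (dphi k s D w))%C.
  { rewrite (RtoC_mult _ Y). field. auto. }
  rewrite E.
  transitivity (RtoC 2 * RtoC (sign p) * / RtoC Y * Cpow_Z (qeval Q (x, y)) (k - 1) *
     (RtoC (sqrt (1 - w) * w) * Cconj (dphi k s D w)))%C.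
  { rewrite (RtoC_mult (2 * sign p)), (RtoC_mult 2). ring. }
  rewrite R. field. auto.
Qed.

Lemma Q_sub_z_nonzero (D : Z) (Q : qform) (x y : R) : 0 < y -> ~ E_D D (x, y) -> Q_D D Q ->
  Q_sub_z Q (x, y) <> 0.
Proof.
  intros Hy HE HQ E. apply HE. split; [exact Hy|]. exists Q. split; auto.
  unfold Q_sub_z in E. simpl Im in E. apply Rmult_integral in E. destruct E as [E|E]; auto.
  exfalso. revert E. apply Rinv_neq_0_compat. lra.
Qed.

(** * From single terms to the series *)

Lemma is_Csum_value {T} (P : T -> Prop) (a b : T -> C) (A c : C) :
  is_Csum P a A -> ex_Csum P b -> (forall t, P t -> a t = (c * b t)%C) -> A = (c * Csum P b)%C.
Proof.
  intros Ha Hb E.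
  pose proof (is_Csum_scal P c b _ (Csum_correct _ _ Hb)) as H.
  apply (is_Csum_ext P a (fun t => c * b t)%C) in Ha; auto.
  apply is_Csum_unique in Ha, H. congruence.
Qed.

(** Conjugation and multiplication by constants commute with the sums, so a termwise identity
    suffices. *)
Lemma is_xi_Csum (kappa : Z) (P : qform -> Prop) (G : C -> C) (z : C) (a b : qform -> C) (c : C) :
  ex_Csum P a -> is_dbar G z (Csum P a) -> ex_Csum P b ->
  (forall Q, P Q -> (RtoC 2 * Ci * RtoC (powerRZ (Im z) kappa) * Cconj (a Q) = c * b Q)%C) ->
  is_xi kappa G z (c * Csum P b)%C.
Proof.
  intros Ha HG Hb E. exists (Csum P a). split; auto. symmetry.
  apply (is_Csum_value P (fun Q => RtoC 2 * Ci * RtoC (powerRZ (Im z) kappa) * Cconj (a Q))%C); auto.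
  apply is_Csum_scal, is_Csum_conj. now apply Csum_correct.
Qed.

Lemma f_term_gterm (k D : Z) (s z : C) (Q : qform) :
  gterm (fun _ => 1) (- k) (phi k s D) D z Q = f_term k s D z Q.
Proof. unfold gterm, f_term. ring. Qed.

Lemma ex_Csum_ext {T} (P : T -> Prop) (a b : T -> C) :
  (forall t, P t -> a t = b t) -> ex_Csum P a -> ex_Csum P b.
Proof. intros E [S H]. exists S. now apply (is_Csum_ext P a b). Qed.

(** Existence of the sums is not assumed, so the summands are identified as functions. *)
Lemma Csum_ext {T} (P : T -> Prop) (a b : T -> C) :
  (forall t, a t = b t) -> Csum P a = Csum P b.
Proof.
  intros E. replace b with a; auto.
  apply FunctionalExtensionality.functional_extensionality. exact E.
Qed.

Lemma is_dbar_ext (G G' : C -> C) (z v : C) : (forall u, G u = G' u) ->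
  is_dbar G z v -> is_dbar G' z v.
Proof.
  intros E (gx & gy & H1 & H2 & H3). exists gx, gy. split; [|split]; auto.
  - eapply is_derive_ext; [|exact H1]. intros t. apply E.
  - eapply is_derive_ext; [|exact H2]. intros t. apply E.
Qed.

(** Each part also asserts unconditional convergence of both series at z, so that the values of
    [Csum] there are genuine sums and not the default value of [iota]. *)
Theorem theorem1p5 :
  forall (k D : Z) (s : C),
    (0 < k)%Z -> Z.Even k -> is_positive_discriminant D ->
    (IZR k / 2 + 1 / 4 <= Re s)%R ->
    (forall z : C, upper_half_plane z -> ~ E_D D z ->
       ex_Csum (Q_D D) (F_term k s D z) /\
       ex_Csum (Q_D D) (f_term k (Cconj s) D z) /\
       is_xi (2 - 2 * k) (F_fun k s D) z
         (RtoC 2 * (Cconj s - RtoC (3 / 4) + RtoC (IZR k / 2))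
          * f_fun k (Cconj s) D z)%C)
    /\
    (forall z : C, upper_half_plane z -> ~ E_D D z ->
       ex_Csum (Q_D D) (f_term k s D z) /\
       ex_Csum (Q_D D) (F_term k (Cconj s) D z) /\
       is_xi (2 * k) (f_fun k s D) z
         (RtoC 2 * (Cconj s - RtoC (IZR k / 2) - RtoC (1 / 4))
          * F_fun k (Cconj s) D z)%C).
Proof.
  intros k D s Hk Hev [HD _] Hs.
  (* Positivity and evenness give k >= 2, which the majorant |Q|^-2 requires. *)
  assert (Hk2 : (2 <= k)%Z) by (destruct Hev; lia).
  assert (Hk2R := IZR_le _ _ Hk2).
  assert (Hsc : IZR k / 2 + 1 / 4 <= Re (Cconj s)) by (now rewrite re_conj).
  assert (Ef : forall s' x y, IZR k / 2 + 1 / 4 <= Re s' -> 0 < y -> ~ E_D D (x, y) ->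
     ex_Csum (Q_D D) (f_term k s' D (x, y))).
  { intros s' x y Hs' Hy HE.
    apply (ex_Csum_ext _ (gterm (fun _ => 1) (- k) (phi k s' D) D (x, y))).
    - intros Q _. apply f_term_gterm.
    - apply (ex_Csum_gterm _ (- k) k 0 _ (dphi k s' D)); auto; try lia.
      + intros _. rewrite Rabs_R1. lra.
      + now apply profile_bound_phi. }
  assert (EF : forall s' x y, IZR k / 2 + 1 / 4 <= Re s' -> 0 < y -> ~ E_D D (x, y) ->
     ex_Csum (Q_D D) (F_term k s' D (x, y))).
  { intros s' x y Hs' Hy HE.
    apply (ex_Csum_gterm sign (k - 1) k (Z.to_nat (2 * k - 1)) (phi_star k s' D) (dphi_star k s' D));
      auto; try lia.
    - apply Rabs_sign_le1.
    - now apply profile_bound_phi_star. }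
  split; intros [x y] Hy HE; unfold upper_half_plane in Hy; simpl in Hy.
  - split; [auto|]. split; [auto|].
    destruct (is_dbar_Csum_gterm sign (k - 1) k (Z.to_nat (2 * k - 1)) (phi_star k s D) (dphi_star k s D)
       D x y) as [H1 H2]; auto; try lia.
    + apply Rabs_sign_le1.
    + apply is_derive_sign.
    + intros w Hw. apply is_deriveC_phi_star; auto; lra.
    + now apply profile_bound_phi_star.
    + apply (is_xi_Csum _ _ _ _ _ _ _ H1 H2); [now apply Ef|].
      intros Q HQ. apply xi_F_term; auto; [|lra]. now apply (Q_sub_z_nonzero D).
  - split; [auto|]. split; [auto|].
    destruct (is_dbar_Csum_gterm (fun _ => 1) (- k) k 0 (phi k s D) (dphi k s D)
       D x y) as [H1 H2]; auto; try lia.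
    + intros _. rewrite Rabs_R1. lra.
    + intros u _. exact (is_derive_const (1 : R_NormedModule) u).
    + intros w Hw. apply is_deriveC_phi; auto; lra.
    + now apply profile_bound_phi.
    + apply (is_xi_Csum _ _ _ _ (gterm_dbar (fun _ => 1) (- k) (dphi k s D) D (x, y))); [auto | | now apply EF |].
      * eapply is_dbar_ext; [|exact H2]. intros z. apply Csum_ext. intros Q. apply f_term_gterm.
      * intros Q HQ. apply xi_f_term; auto; [|lra]. now apply (Q_sub_z_nonzero D).
Qed.
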